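(* Let $n\ge 1$ and let $i,m\in\mathbb{Z}$ with $1\le m<n/3-1$. Let $$S=[i-(m-1),\,i+(m-1)]_2,\qquad S'=\left[i-\tfrac12(m-1),\,i+\tfrac12(m-1)\right]_1 .$$ Then the iterate $T^k$ of the pentagram map is singular on $X_{S'}$ for $1\le k\le m+1$, but $T^{m+2}$ is nonsingular at generic $A\in X_{S'}$. Moreover, $T^{m+2}(A)\in Y_S$ for such $A$.
   Context: Notation: $[a,b]_k=\{a,a+k,a+2k,\dots,b\}$ (for $a\le b$ with $b-a$ a multiple of $k$; also used for half-integers $a,b$). $\overleftrightarrow{PQ}$ is the line through $P,Q$. Twisted polygons: work in the real projective plane. A twisted $n$-gon is a sequence $A=(A_i)$ of points, indexed either by $\mathbb{Z}$ or by $\frac12+\mathbb{Z}$, such that $A_{i+n}=\phi(A_i)$ for all $i$ for some projective transformation $\phi$, and such that every four consecutive points are in general position. $A$ and $B$ are projectively equivalent if $\psi(A_i)=B_i$ for all $i$ for some projective transformation $\psi$. $\mathcal{P}_n$ (resp. $\mathcal{P}_n^*$) is the space of twisted $n$-gons indexed by $\mathbb{Z}$ (resp. by $\frac12+\mathbb{Z}$) modulo projective equivalence. Coordinates: $[a,b,c,d]=\frac{(a-b)(c-d)}{(b-c)(d-a)}$ is the cross ratio (of collinear points) and $\chi(a,b,c,d)=[b,a,c,d]$. For each index $k$ of $A$, $x_{2k}(A)=\chi(A_{k-2},A_{k-1},B,D)$ and $x_{2k+1}(A)=\chi(A_{k+2},A_{k+1},C,D)$, where $B=\overleftrightarrow{A_{k-2}A_{k-1}}\cap\overleftrightarrow{A_kA_{k+1}}$,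 $C=\overleftrightarrow{A_{k-1}A_k}\cap\overleftrightarrow{A_{k+1}A_{k+2}}$, $D=\overleftrightarrow{A_{k-2}A_{k-1}}\cap\overleftrightarrow{A_{k+1}A_{k+2}}$. Then $x_{j+2n}=x_j$, and $x_1,\dots,x_{2n}$ are (generically defined) coordinates on $\mathcal{P}_n$ and on $\mathcal{P}_n^*$. The $y$-parameters are: on $\mathcal{P}_n$, $y_j=-(x_jx_{j+1})^{-1}$ for $j$ even and $y_j=-x_jx_{j+1}$ for $j$ odd; on $\mathcal{P}_n^*$, $y_j=-x_jx_{j+1}$ for $j$ even and $y_j=-(x_jx_{j+1})^{-1}$ for $j$ odd. Pentagram map: $T$ sends $A$ to $B$ with $B_i=\overleftrightarrow{A_{i-3/2}A_{i+1/2}}\cap\overleftrightarrow{A_{i-1/2}A_{i+3/2}}$, giving rational maps $\alpha_2:\mathcal{P}_n\to\mathcal{P}_n^*$ and $\alpha_1:\mathcal{P}_n^*\to\mathcal{P}_n$. In coordinates, on $\mathcal{P}_n$: $x_j(T(A))=x_{j+1}\frac{1-x_{j+3}x_{j+2}}{1-x_{j-1}x_{j-2}}$ for $j$ even and $x_j(T(A))=x_{j-1}\frac{1-x_{j-3}x_{j-2}}{1-x_{j+1}x_{j+2}}$ for $j$ odd; on $\mathcal{P}_n^*$ the same with the words even and odd interchanged. $T^k$ denotes the $k$-fold iterate, as a rational map defined on $\mathcal{P}_n$ or on $\mathcal{P}_n^*$ (whichever contains the subvariety under consideration), with target $\mathcal{P}_n$ or $\mathcal{P}_n^*$ depending on the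 source and the parity of $k$. A point is a singular point of the rational map $T^k$ if $T^k$ is not defined (regular) there; $T^k$ is singular on a subvariety if its points are singular points of $T^k$. ''Generic $A\in X$'' means $A$ in some dense (Zariski) open subset of $X$. Subvarieties: for $i\in\mathbb{Z}$, $X_i=\{A\in\mathcal{P}_n: y_{2i}(A)=-1\}$ and $Y_i=\{A\in\mathcal{P}_n^*: y_{2i}(A)=-1\}$; for $j\in\frac12+\mathbb{Z}$, $Y_j=\{A\in\mathcal{P}_n: y_{2j}(A)=-1\}$ and $X_j=\{A\in\mathcal{P}_n^*: y_{2j}(A)=-1\}$. For $S\subseteq\mathbb{Z}$ or $S\subseteq\frac12+\mathbb{Z}$, $X_S=\bigcap_{i\in S}X_i$ and $Y_S=\bigcap_{i\in S}Y_i$. (Thus for $m$ odd $X_{S'}\subseteq\mathcal{P}_n$, and for $m$ even $X_{S'}\subseteq\mathcal{P}_n^*$.) *)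

(* Defs.v *)
From mathcomp Require Import all_boot all_order all_algebra.
From mathcomp Require Import classical_sets reals mpoly.

Set Implicit Arguments.
Unset Strict Implicit.
Unset Printing Implicit Defensive.

Import Order.TTheory GRing.Theory Num.Theory.
Local Open Scope classical_set_scope.
Local Open Scope ring_scope.

(* Points and lines of the real projective plane are given by homogeneous
   coordinates: nonzero row vectors up to a nonzero factor.  A line is
   represented by the linear form vanishing on it, so that both the line through
   two points and the meet of two lines are cross products. *)

Section Plane.
Variable R : realType.
Implicit Types u v w a b c d : 'rV[R]_3.

Definition dot u v : R := (u *m v^T) 0 0.

Definition cross u v : 'rV[R]_3 :=
  \row_(j < 3) (u 0 (j + 1) * v 0 (j + 2%:R) - u 0 (j + 2%:R) * v 0 (j + 1)).

Definition line u v := cross u v.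
Definition meet l1 l2 := cross l1 l2.

Definition same_point u v := exists2 c : R, c != 0 & v = c *: u.

Definition collinear u v w := dot (line u v) w = 0.

(* No three of the four are collinear; this forces all four vectors to be
   nonzero, hence to represent points. *)
Definition general_position a b c d :=
  [/\ ~ collinear a b c, ~ collinear a b d, ~ collinear a c d
    & ~ collinear b c d].

(* If a, b, c, d lie on a line with coordinate vector l, then u |-> v,
   dot (cross u v) l is, up to one common factor, the difference of affine
   coordinates v - u on that line; the quotient below therefore is
   (a-b)(c-d)/((b-c)(d-a)), and it depends only on the points. *)
Definition cross_ratio a b c d : R :=
  let w u v := dot (cross u v) (line a b) in
  (w a b * w c d) / (w b c * w d a).

Definition chi a b c d : R := cross_ratio b a c d.

End Plane.

(* Indices in (1/2)Z are doubled: the index k is encoded by the integer 2k.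
   Integers k thus become the even a (parity a = false) and elements of
   1/2 + Z the odd a (parity a = true). *)
Definition parity (a : int) : bool := odd `|a|%N.

(* [a, b]_k *)
Definition arith (a b k : int) : set int :=
  [set c | exists t : nat, c = a + k * t%:Z /\ c <= b].

Section Polygons.
Variable R : realType.

(* A a is the vertex of (undoubled) index a/2.  A polygon indexed by Z
   (s = false) or by 1/2 + Z (s = true) consists of the A a with parity a = s;
   nothing below looks at the other values of A. *)
Definition polygon := int -> 'rV[R]_3.

Implicit Types (A B : polygon) (s : bool) (n k : nat) (a e c : int).

(* The polygons representing the points of P_n (s = false) and of P_n^*
   (s = true).  Points of these spaces are classes modulo projective
   equivalence; everything defined on polygons below is invariant under it. *)
Definition twisted s n : set polygon := [set A |
  (exists2 M : 'M[R]_3, M \in unitmx &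
     forall a, parity a = s -> same_point (A a *m M) (A (a + (2 * n)%:Z))) /\
  (forall a, parity a = s ->
     general_position (A a) (A (a + 2)) (A (a + 4)) (A (a + 6)))].

(* In the next two definitions e = 2k for an index k of A. *)
Definition xl A e : R :=
  let B := meet (line (A (e - 4)) (A (e - 2))) (line (A e) (A (e + 2))) in
  let D := meet (line (A (e - 4)) (A (e - 2)))
                (line (A (e + 2)) (A (e + 4))) in
  chi (A (e - 4)) (A (e - 2)) B D.

Definition xr A e : R :=
  let C := meet (line (A (e - 2)) (A e)) (line (A (e + 2)) (A (e + 4))) in
  let D := meet (line (A (e - 4)) (A (e - 2)))
                (line (A (e + 2)) (A (e + 4))) in
  chi (A (e + 4)) (A (e + 2)) C D.

(* The index j of the coordinates x_j and y_j is not doubled: x_{2k} and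
   x_{2k+1} belong to the vertex index k, which is encoded by 2k itself. *)
Definition xcoord s A (j : int) : R := if parity j == s then xl A j else xr A (j - 1).

Definition yparam s A (j : int) : R :=
  if parity j == s then - (xcoord s A j * xcoord s A (j + 1))^-1
  else - (xcoord s A j * xcoord s A (j + 1)).

(* x_1, ..., x_{2n} *)
Definition coords s n A : 'I_(2 * n) -> R := fun j => xcoord s A (j.+1)%:Z.

Definition pentagram A : polygon := fun a =>
  meet (line (A (a - 3)) (A (a + 1))) (line (A (a - 1)) (A (a + 3))).

(* X_i and Y_i for c = 2i. *)
Definition Xvar n c : set polygon :=
  [set A | twisted (parity c) n A /\ yparam (parity c) A c = -1].
Definition Yvar n c : set polygon :=
  [set A | twisted (~~ parity c) n A /\ yparam (~~ parity c) A c = -1].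

Definition XS n (S : set int) : set polygon := \bigcap_(c in S) Xvar n c.
Definition YS n (S : set int) : set polygon := \bigcap_(c in S) Yvar n c.

(* The Zariski topology of P_n and P_n^* in the coordinates x_1, ..., x_{2n},
   induced on a subset Z. *)
Definition zariski_open_in s n (Z U : set polygon) :=
  exists F : set {mpoly R[2 * n]},
    U = [set A | Z A /\ exists2 f, F f & f.@[coords s A] != 0].

Definition generically s n (Z : set polygon) (P : polygon -> Prop) :=
  exists U, [/\ zariski_open_in s n Z U,
    forall V, zariski_open_in s n Z V -> V !=set0 -> U `&` V !=set0
    & forall A, U A -> P A].

(* Let D be a Zariski dense subset of the space with parity s on which the map
   F to the space with parity s' is defined.  The rational map given by F is
   regular at A, with value the class of B in the target space: in a
   neighbourhood of A its coordinates are quotients f_j / g_j of polynomials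
   with g_j nonzero, and their values at A are the coordinates of B. *)
Definition regular_with_value s s' n (D : set polygon) (F : polygon -> polygon)
    A B :=
  twisted s' n B /\
  exists f g : 'I_(2 * n) -> {mpoly R[2 * n]},
    [/\ forall j, (g j).@[coords s A] != 0,
        forall j, coords s' B j =
          (f j).@[coords s A] / (g j).@[coords s A]
      & forall A', D A' -> (forall j, (g j).@[coords s A'] != 0) ->
          forall j, coords s' (F A') j =
            (f j).@[coords s A'] / (g j).@[coords s A']].

(* Polygons for which the first k steps of the construction stay within
   twisted polygons. *)
Definition iter_dom s n k : set polygon :=
  [set A | forall l, (l <= k)%N ->
     twisted (s (+) odd l) n (iter l pentagram A)].

(* T^k is regular at A, and T^k(A) = B. *)
Definition Tk_value s n k A B :=
  regular_with_value s (s (+) odd k) n (iter_dom s n k) (iter k pentagram) A B.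

Definition Tk_nonsingular s n k A := exists B, Tk_value s n k A B.

End Polygons.

(* Main.v *)
Require Import Defs.
From mathcomp Require Import all_boot all_order all_algebra perm.
From mathcomp Require Import boolp classical_sets reals mpoly.
From mathcomp Require Import ring lra zify.

Set Implicit Arguments.
Unset Strict Implicit.
Unset Printing Implicit Defensive.

Import Order.TTheory GRing.Theory Num.Theory.
Local Open Scope ring_scope.

(** The pentagram map becomes Dodgson condensation once the coordinates of a
    polygon are written through one potential.  A sequence of coordinates [x]
    has a nowhere vanishing potential [T], a product of coordinates, with
<<
      x y = T (y + 2) * T (y - 3) / (T (y - 2) * T (y + 1))
>>
    for all labels [y >= 3].  Put [tau 0 = tau 1 = T] and
<<
      tau (k + 2) y * tau k y = tau (k + 1) (y - 3) * tau (k + 1) (y + 3)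
                              - tau (k + 1) (y - 1) * tau (k + 1) (y + 1).
>>
    The coordinates of the [l]-th iterate are then given by the same ratio, with
    [T] replaced by [tau (l + 1)] at the labels of one parity and by [tau l] at
    the others ([iter_dom_level]).  Along the labels [2 i + 4 j + 3 k + q] the
    recurrence reads
<<
      P (k + 2) i j * P k (i + 1) (j + 1) = P (k + 1) i j * P (k + 1) (i + 1) (j + 1)
                                        - P (k + 1) i (j + 1) * P (k + 1) (i + 1) j,
>>
    the identity satisfied by the contiguous minors of a matrix when [P 0 = 1]; here
    both [P 0] and [P 1] are arbitrary.  The hypothesis [y_c = -1] means
    [x_c x_(c+1) = 1], that is [tau 2 c = 0].  Three properties of condensation
    carry the proof.

    - Every [P k] is a Laurent polynomial in the entries of [P 0] and [P 1]
      ([condensation_laurent]).  Hence [tau k] is regular on the whole torus of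
      coordinates, also where an earlier [tau] vanishes and the construction of
      the iterates breaks down.
    - If [P 2] vanishes at the first [m] places of one of the first [m] columns,
      then [P (m + 1)] vanishes at the origin ([Pv_vanish]): two adjacent columns of
      [P 1] are then proportional, and a determinant with such columns is zero.
      So [tau (m + 1)] vanishes at the labels of [S] on [X_S'] ([tau_run_vanish]).
    - [tau (m + 2)] and [tau (m + 3)] are not identically zero on [X_S'], at any
      label ([tau_run_generic]).  For data with [P 0 = 1] one has to find square
      matrices with entries [h (i + 2 j)] and nonzero determinant, under the
      constraints [h u * h (u + 3) = h (u + 1) * h (u + 2)] at the sites
      ([fold_minor_generic]).  It is here that [m < n / 3 - 1] is used: the
      sites then meet the window of the determinant in a single strip or at its
      two ends.

    The coordinates of [T^(m+2)] are ratios of values of [tau (m + 2)] and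
    [tau (m + 3)], hence regular at a generic point of [X_S'].  The recurrence at a
    label of [S], where [tau (m + 1)] is zero, says that the image has
    [x_c x_(c+1) = 1] there, so it lies in [Y_S] ([exit_value]).

    For [1 <= k <= m + 1] one of the coordinates of [T^k] is a ratio whose numerator
    contains a [tau] vanishing on [X_R], for a suitable initial part [R] of [S'],
    while the denominator does not vanish identically on [X_R].  As [X_R] is
    irreducible, being parametrized by a torus, a regular value of [T^k] at a point
    of [X_R] would have a zero coordinate; but coordinates of twisted polygons are
    nonzero ([singular_criterion]).

    The link with polygons is made by brackets: the coordinates of a polygon and of
    its image are ratios of determinants of vertex vectors, and every sequence of
    nonzero coordinates with period [2 n] comes from a twisted [n]-gon
    ([polygon_existence]). *)

(** * Laurent functions of nonzero variables *)

Section Laurent.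
Variable R : realFieldType.

(** Laurent polynomials are kept as expressions, so that statements about all
    of them, such as clearing denominators, are proved by induction. *)
Inductive lexpr (I : Type) :=
  | Cst of R | Var of I | Inv of I
  | Add of lexpr I & lexpr I | Mul of lexpr I & lexpr I.
Arguments Cst {I}.

Fixpoint ev (I : Type) (D : I -> R) (e : lexpr I) : R :=
  match e with
  | Cst c => c
  | Var i => D i
  | Inv i => (D i)^-1
  | Add e f => ev D e + ev D f
  | Mul e f => ev D e * ev D f
  end.

Fixpoint supp (I : Type) (e : lexpr I) : seq I :=
  match e with
  | Cst _ => [::]
  | Var i | Inv i => [:: i]
  | Add e f | Mul e f => supp e ++ supp f
  end.

Fixpoint invfree (I : Type) (e : lexpr I) : bool :=
  match e with
  | Inv _ => false
  | Add e f | Mul e f => invfree e && invfree f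
  | _ => true
  end.

Definition nz (I : Type) (D : I -> R) := forall i, D i != 0.

(** Only the values at points with nonzero coordinates matter: everywhere else
    [f] is unconstrained, because division by zero is total. *)
Definition lau (I : Type) (f : (I -> R) -> R) :=
  exists e, forall D, nz D -> f D = ev D e.

(** The units among Laurent functions, which may be substituted for the variables
    of another Laurent function. *)
Definition ulau (I : Type) (f : (I -> R) -> R) :=
  [/\ lau f, lau (fun D => (f D)^-1) & forall D, nz D -> f D != 0].

Section Closure.
Variable I : Type.
Implicit Types f g : (I -> R) -> R.

Lemma eq_lau f g : (forall D, nz D -> f D = g D) -> lau f -> lau g.
Proof. by move=> fg [e ef]; exists e => D nzD; rewrite -fg ?ef. Qed.

Lemma lau_cst c : lau (fun _ : I -> R => c).
Proof. by exists (Cst c). Qed.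

Lemma lau_var i : lau (fun D : I -> R => D i).
Proof. by exists (Var i). Qed.

Lemma lau_inv i : lau (fun D : I -> R => (D i)^-1).
Proof. by exists (Inv i). Qed.

Lemma lauD f g : lau f -> lau g -> lau (fun D => f D + g D).
Proof. by move=> [e ef] [e' eg]; exists (Add e e') => D nzD /=; rewrite ef ?eg. Qed.

Lemma lauM f g : lau f -> lau g -> lau (fun D => f D * g D).
Proof. by move=> [e ef] [e' eg]; exists (Mul e e') => D nzD /=; rewrite ef ?eg. Qed.

Lemma lauN f : lau f -> lau (fun D => - f D).
Proof.
move=> lf; apply: eq_lau (lauM (lau_cst (-1)) lf) => D _.
by rewrite mulN1r.
Qed.

Lemma lauB f g : lau f -> lau g -> lau (fun D => f D - g D).
Proof. by move=> lf lg; apply: lauD => //; apply: lauN. Qed.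

Lemma lau_sum (T : Type) (r : seq T) (F : T -> (I -> R) -> R) :
  (forall t, lau (F t)) -> lau (fun D => \sum_(t <- r) F t D).
Proof.
move=> lF; elim: r => [|t r IH].
  by apply: eq_lau (lau_cst 0) => D _; rewrite big_nil.
by apply: eq_lau (lauD (lF t) IH) => D _; rewrite big_cons.
Qed.

Lemma lau_prod (T : Type) (r : seq T) (F : T -> (I -> R) -> R) :
  (forall t, lau (F t)) -> lau (fun D => \prod_(t <- r) F t D).
Proof.
move=> lF; elim: r => [|t r IH].
  by apply: eq_lau (lau_cst 1) => D _; rewrite big_nil.
by apply: eq_lau (lauM (lF t) IH) => D _; rewrite big_cons.
Qed.

Lemma ulau_cst c : c != 0 -> ulau (fun _ : I -> R => c).
Proof. by move=> c0; split => //; apply: lau_cst. Qed.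

Lemma ulau_var i : ulau (fun D : I -> R => D i).
Proof. by split; [apply: lau_var | apply: lau_inv | move=> D; apply]. Qed.

Lemma eq_ulau f g : (forall D, nz D -> f D = g D) -> ulau f -> ulau g.
Proof.
move=> fg [lf lf' nf]; split; first exact: eq_lau lf.
  by apply: eq_lau lf' => D nzD; rewrite fg.
by move=> D nzD; rewrite -fg // nf.
Qed.

Lemma ulauM f g : ulau f -> ulau g -> ulau (fun D => f D * g D).
Proof.
move=> [lf lf' nf] [lg lg' ng]; split; first exact: lauM.
  by apply: eq_lau (lauM lf' lg') => D _; rewrite invfM.
by move=> D nzD; rewrite mulf_neq0 ?nf ?ng.
Qed.

Lemma ulauV f : ulau f -> ulau (fun D => (f D)^-1).
Proof.
move=> [lf lf' nf]; split=> //; last by move=> D nzD; rewrite invr_eq0 nf.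
by apply: eq_lau lf => D _; rewrite invrK.
Qed.

Lemma ulauX f n : ulau f -> ulau (fun D => f D ^+ n).
Proof.
move=> uf; elim: n => [|n IH].
  by apply: eq_ulau (ulau_cst (oner_neq0 R)) => D _; rewrite expr0.
by apply: eq_ulau (ulauM uf IH) => D _; rewrite exprS.
Qed.

Lemma ulau_prod (T : Type) (r : seq T) (F : T -> (I -> R) -> R) :
  (forall t, ulau (F t)) -> ulau (fun D => \prod_(t <- r) F t D).
Proof.
move=> lF; elim: r => [|t r IH].
  by apply: eq_ulau (ulau_cst (oner_neq0 R)) => D _; rewrite big_nil.
by apply: eq_ulau (ulauM (lF t) IH) => D _; rewrite big_cons.
Qed.

End Closure.

Lemma lau_ev (I J : Type) (e : lexpr I) (s : I -> (J -> R) -> R) :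
  (forall i, ulau (s i)) -> lau (fun x => ev (fun i => s i x) e).
Proof.
move=> us; elim: e => [c|i|i|e IHe f IHf|e IHe f IHf] /=.
- exact: lau_cst.
- by case: (us i).
- by case: (us i).
- exact: lauD.
- exact: lauM.
Qed.

Lemma lau_comp (I J : Type) (f : (I -> R) -> R) (s : I -> (J -> R) -> R) :
  lau f -> (forall i, ulau (s i)) -> lau (fun x => f (fun i => s i x)).
Proof.
move=> [e ef] us; apply: eq_lau (lau_ev e us) => x nzx.
by rewrite ef // => i; case: (us i) => _ _ ->.
Qed.

Lemma eq_ev (I : eqType) (D D' : I -> R) (e : lexpr I) :
  {in supp e, D =1 D'} -> ev D e = ev D' e.
Proof.
elim: e => [c|i|i|e IHe f IHf|e IHe f IHf] //= DD'.
- by rewrite DD' ?mem_head.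
- by rewrite DD' ?mem_head.
- by rewrite IHe ?IHf // => i ii; apply: DD'; rewrite mem_cat ii ?orbT.
- by rewrite IHe ?IHf // => i ii; apply: DD'; rewrite mem_cat ii ?orbT.
Qed.

Lemma lau_ext (I : eqType) (f : (I -> R) -> R) (D D' : I -> R) :
  lau f -> nz D -> D =1 D' -> f D = f D'.
Proof.
move=> [e ef] nD DD'; rewrite !ef //; first by apply: eq_ev => i _.
by move=> i; rewrite -DD'.
Qed.

Lemma nz_upd (I : eqType) (D : I -> R) i0 v : nz D -> v != 0 ->
  nz (fun i => if i == i0 then v else D i).
Proof. by move=> nD v0 i; case: ifP. Qed.

Lemma clear_denominators (I : eqType) (e : lexpr I) :
  exists e1 l, [/\ invfree e1, {subset l <= supp e} &
    forall D, {in supp e, forall i, D i != 0} ->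
      ev D e * \prod_(i <- l) D i = ev D e1].
Proof.
elim: e => [c|i|i|e [e1 [l [ie sl eq]]] f [f1 [k [jf sk fq]]]
  |e [e1 [l [ie sl eq]]] f [f1 [k [jf sk fq]]]].
- by exists (Cst c), [::]; split=> // D _; rewrite big_nil mulr1.
- by exists (Var i), [::]; split=> // D _; rewrite big_nil mulr1.
- exists (Cst 1), [:: i]; split=> // D nD.
  by rewrite big_seq1 /= mulVf // nD ?mem_head.
- pose P (s : seq I) := foldr (fun i e => Mul (Var i) e) (Cst 1) s.
  have evP D s : ev D (P s) = \prod_(i <- s) D i.
    by elim: s => [|i s IH] /=; rewrite ?big_nil ?big_cons ?IH.
  have iP s : invfree (P s) by elim: s.
  exists (Add (Mul e1 (P k)) (Mul f1 (P l))), (l ++ k); split.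
  + by rewrite /= ie jf !iP.
  + by move=> i; rewrite /= !mem_cat => /orP[/sl|/sk] ->; rewrite ?orbT.
  + move=> D nD /=; rewrite !evP big_cat /= -eq -?fq; first by ring.
    * by move=> i ii; apply: nD; rewrite /= mem_cat ii orbT.
    * by move=> i ii; apply: nD; rewrite /= mem_cat ii.
- exists (Mul e1 f1), (l ++ k); split.
  + by rewrite /= ie jf.
  + by move=> i; rewrite /= !mem_cat => /orP[/sl|/sk] ->; rewrite ?orbT.
  + move=> D nD /=; rewrite big_cat /= -eq -?fq; first by ring.
    * by move=> i ii; apply: nD; rewrite /= mem_cat ii orbT.
    * by move=> i ii; apply: nD; rewrite /= mem_cat ii.
Qed.

(** Substituting Laurent functions that are not units leaves the Laurent world; a
    product of the substituted functions brings the result back. *)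
Lemma lau_clear (I J : eqType) (e : lexpr I) (s : I -> (J -> R) -> R) :
  (forall i, lau (s i)) ->
  exists l h, [/\ {subset l <= supp e}, lau h &
    forall x, nz x -> {in supp e, forall i, s i x != 0} ->
      ev (fun i => s i x) e * \prod_(i <- l) s i x = h x].
Proof.
move=> ls; have [e1 [l [ie sl eq]]] := clear_denominators e.
exists l, (fun x => ev (fun i => s i x) e1); split=> //.
  elim: e1 ie {eq} => [c|i|i|f IHf g IHg|f IHf g IHg] //=.
  - by move=> _; apply: lau_cst.
  - by case/andP=> /IHf lf /IHg lg; apply: lauD.
  - by case/andP=> /IHf lf /IHg lg; apply: lauM.
by move=> x _ nx; rewrite eq.
Qed.

Lemma exists_nonroot (p : {poly R}) : p != 0 -> exists t, p.[t] != 0.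
Proof.
move=> p0; pose rs := [seq (i%:R : R) | i <- iota 0 (size p)].
have [/allP alr|] := boolP (all (root p) rs); last first.
  by case/allPn=> t _ rt; exists t.
have urs : uniq rs.
  rewrite map_inj_uniq ?iota_uniq // => i j /eqP.
  by rewrite eqr_nat => /eqP.
have := max_poly_roots p0 _ urs.
by rewrite size_map size_iota ltnn; move=> h; case: notF; apply: h; apply/allP.
Qed.


Section Line.
Variables (I : eqType) (L : seq I) (D1 D2 : I -> R).

(** Variables outside the finite set [L] are frozen to 1, so that avoiding the
    zeros of all coordinates along the line excludes finitely many [t] only. *)
Definition segment (t : R) (i : I) : R :=
  if i \in L then (1 - t) * D1 i + t * D2 i else 1.

Definition segment_poly (i : I) : {poly R} :=
  if i \in L then (1 - 'X) * (D1 i)%:P + 'X * (D2 i)%:P else 1.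

Lemma segment_polyE t i : (segment_poly i).[t] = segment t i.
Proof. by rewrite /segment_poly /segment; case: ifP => _; rewrite !hornerE. Qed.

Lemma segment_nonzero (e : lexpr I) t0 :
    (forall i, segment t0 i != 0) -> ev (segment t0) e != 0 ->
  exists2 p : {poly R}, p != 0 &
    forall t, (forall i, segment t i != 0) -> p.[t] != 0 -> ev (segment t) e != 0.
Proof.
move=> nt0 et0; have [e1 [l [ie sl eq]]] := clear_denominators e.
have [p hp] : exists p : {poly R}, forall t, ev (segment t) e1 = p.[t].
  elim: e1 ie {eq} => [c|i|i|a IHa b IHb|a IHa b IHb] //=.
  - by move=> _; exists c%:P => t; rewrite hornerC.
  - by move=> _; exists (segment_poly i) => t; rewrite segment_polyE.
  - by case/andP=> /IHa[p hp] /IHb[q hq]; exists (p + q) => t; rewrite hornerE hp hq.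
  - by case/andP=> /IHa[p hp] /IHb[q hq]; exists (p * q) => t; rewrite hornerE hp hq.
exists p; last first.
  move=> t nt; rewrite -hp -eq; last by move=> i _; apply: nt.
  by apply: contraNneq => ->; rewrite mul0r.
have: p.[t0] != 0.
  rewrite -hp -eq; last by move=> i _; apply: nt0.
  by rewrite mulf_neq0 // prodf_seq_neq0; apply/allP => i _; apply: nt0.
by apply: contraNneq => ->; rewrite horner0.
Qed.

End Line.

(** Laurent functions have no zero divisors.  Restricted to the line through the two
    given points, both functions and the coordinates become nonzero rational
    functions of one parameter, and an infinite field contains a parameter that
    is a root of none of them. *)
Lemma lau_nonzero2 (I : eqType) (f g : (I -> R) -> R) :
  lau f -> lau g ->
  (exists2 D, nz D & f D != 0) -> (exists2 D, nz D & g D != 0) ->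
  exists2 D, nz D & (f D != 0) && (g D != 0).
Proof.
move=> [e ef] [e' eg] [D1 n1 f1] [D2 n2 g2].
rewrite ef // in f1; rewrite eg // in g2.
pose L := supp e ++ supp e'; pose S := segment L D1 D2.
have S0 : {in L, S 0 =1 D1} by move=> i iL; rewrite /S /segment iL; ring.
have S1 : {in L, S 1 =1 D2} by move=> i iL; rewrite /S /segment iL; ring.
have out t i : i \notin L -> S t i != 0.
  by move=> iL; rewrite /S /segment (negPf iL) oner_neq0.
have nS0 i : S 0 i != 0 by have [/S0->|/out] := boolP (i \in L).
have nS1 i : S 1 i != 0 by have [/S1->|/out] := boolP (i \in L).
have [||p p0 hp] := @segment_nonzero _ L D1 D2 e 0 => //.
  by rewrite (@eq_ev _ _ D1) // => i ii; apply: S0; rewrite mem_cat ii.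
have [||q q0 hq] := @segment_nonzero _ L D1 D2 e' 1 => //.
  by rewrite (@eq_ev _ _ D2) // => i ii; apply: S1; rewrite mem_cat ii orbT.
have r0 : p * q * \prod_(i <- L) segment_poly L D1 D2 i != 0.
  rewrite !mulf_neq0 // prodf_seq_neq0; apply/allP => i iL /=.
  by have := n1 i; rewrite -S0 // /S -segment_polyE; apply: contraNneq => ->; rewrite horner0.
have [t] := exists_nonroot r0.
rewrite !hornerM horner_prod mulf_eq0 negb_or mulf_eq0 negb_or => /andP[/andP[pt qt]].
rewrite prodf_seq_neq0 => /allP nL.
have nSt : nz (S t).
  move=> i; have [iL|/out //] := boolP (i \in L).
  by rewrite /S -segment_polyE; have := nL i iL.
by exists (S t) => //; rewrite ef // eg // hp // hq.
Qed.

Lemma lau_eq0_dense (I : eqType) (f g : (I -> R) -> R) :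
  lau f -> lau g -> (exists2 D, nz D & g D != 0) ->
  (forall D, nz D -> g D != 0 -> f D = 0) -> forall D, nz D -> f D = 0.
Proof.
move=> lf lg hg fg D nD; apply/eqP; apply: contraT => fD.
have [||D' nD' /andP[]] := lau_nonzero2 lf lg; first by exists D.
  by [].
by move=> + gD'; rewrite fg // eqxx.
Qed.

Lemma lau_prod_nonzero (I T : eqType) (r : seq T) (F : T -> (I -> R) -> R) :
    (forall t, lau (F t)) ->
    {in r, forall t, exists2 D, nz D & F t D != 0} ->
  exists2 D, nz D & \prod_(t <- r) F t D != 0.
Proof.
move=> lF; elim: r => [|t r IH] nF.
  by exists (fun=> 1); rewrite ?big_nil ?oner_neq0 // => i; rewrite oner_neq0.
have [||D nD /andP[h1 h2]] := lau_nonzero2 (lF t) (lau_prod r lF).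
- by apply: nF; rewrite mem_head.
- by apply: IH => u ur; apply: nF; rewrite inE ur orbT.
by exists D => //; rewrite big_cons mulf_neq0.
Qed.

Definition upd (I : eqType) (D : I -> R) (i0 : I) (v : R) : I -> R :=
  fun i => if i == i0 then v else D i.

Lemma lau_upd (I : eqType) (f : (I -> R) -> R) i0 (mu : (I -> R) -> R) :
  lau f -> ulau mu -> lau (fun D => f (upd D i0 (mu D))).
Proof.
move=> lf um; apply: lau_comp => // i; rewrite /upd.
by case: eqP => _ //; apply: ulau_var.
Qed.

(** Division by a difference of a variable and a unit, performed along the structure
    of the expression; the remainder is the value at [D i0 = mu D]. *)
Lemma lau_div (I : eqType) (f : (I -> R) -> R) i0 (mu : (I -> R) -> R) :
    lau f -> ulau mu ->
    (forall D, nz D -> f (upd D i0 (mu D)) = 0) ->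
  exists2 g, lau g & forall D, nz D -> f D = (D i0 - mu D) * g D.
Proof.
move=> [e ef] [lm lm' nm] f0.
have [g lg eg] : exists2 g, lau g & forall D, nz D ->
    ev D e = ev (upd D i0 (mu D)) e + (D i0 - mu D) * g D.
  elim: e {f0 ef} => [c|i|i|a [ga la ea] b [gb lb eb]|a [ga la ea] b [gb lb eb]] /=.
  - by exists (fun=> 0) => [|D _]; [apply: lau_cst | ring].
  - rewrite /upd; case: eqP => [->|_].
      by exists (fun=> 1) => [|D _]; [apply: lau_cst | ring].
    by exists (fun=> 0) => [|D _]; [apply: lau_cst | ring].
  - rewrite /upd; case: eqP => [->|_].
      exists (fun D => - ((D i0)^-1 * (mu D)^-1)) => [|D nD].
        by apply: lauN; apply: lauM => //; apply: lau_inv.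
      by have := nD i0; have := nm D nD => ? ?; field; apply/andP.
    by exists (fun=> 0) => [|D _]; [apply: lau_cst | ring].
  - exists (fun D => ga D + gb D) => [|D nD]; first exact: lauD.
    by rewrite ea // eb //; ring.
  - exists (fun D => ga D * ev D b + (ev D a - (D i0 - mu D) * ga D) * gb D) => [|D nD].
      apply: lauD; apply: lauM => //; first by exists b.
      apply: lauB; first by exists a.
      by apply: lauM => //; apply: lauB => //; apply: lau_var.
    by rewrite ea // eb //; ring.
exists g => // D nD; rewrite ef // eg // -ef ?f0 ?add0r //.
by move=> i; rewrite /upd; case: ifP => _; [exact: nm | exact: nD].
Qed.

End Laurent.

(** * Condensation and its Laurent phenomenon *)

Notation site := (bool * (nat * nat))%type.

Section Dodgson.
Variable R : realFieldType.
Implicit Types (D : site -> R) (e : nat -> lexpr R site) (x y i j k : nat).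

Definition shift D x y : site -> R :=
  fun v => D (v.1, ((x + v.2.1)%N, (y + v.2.2)%N)).

(** The condensation process is invariant under translations, so one expression per
    layer, evaluated at translated data, describes the whole layer. *)
Definition Pv e k D x y : R := ev (shift D x y) (e k).

Definition dodgson (P : nat -> nat -> nat -> R) k x y : Prop :=
  P k.+2 x y * P k x.+1 y.+1 =
  P k.+1 x y * P k.+1 x.+1 y.+1 - P k.+1 x y.+1 * P k.+1 x.+1 y.

(** The layers 0 and 1 are the two halves of the data; the recurrence determines the
    others wherever no division by zero occurs. *)
Definition condensation e K : Prop :=
  [/\ forall D, nz D -> forall x y, Pv e 0 D x y = D (false, (x, y)),
      forall D, nz D -> forall x y, Pv e 1 D x y = D (true, (x, y)) &
      forall k, (k.+2 <= K)%N -> forall D, nz D -> forall x y,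
        dodgson (fun k => Pv e k D) k x y].

Lemma nz_shift D x y : nz D -> nz (shift D x y).
Proof. by move=> nD v; apply: nD. Qed.

Lemma Pv_shift e k D x y i j :
  Pv e k (shift D x y) i j = Pv e k D (x + i) (y + j).
Proof. by apply: eq_ev => v _; rewrite /shift /= !addnA. Qed.

Lemma Pv00 e k D : Pv e k D 0 0 = ev D (e k).
Proof. by apply: eq_ev => -[b [i j]] _; rewrite /shift /= !add0n. Qed.

Lemma lau_Pv e k x y : lau (fun D => Pv e k D x y).
Proof. by apply: lau_ev => v; apply: ulau_var. Qed.

(** Explicit solutions of the recurrence without zeros: layer [k] is a multiple of
    [2 ^ ((2 x + k) (2 y + k))]. *)
Definition twos : site -> R :=
  fun v => if v.1 then 2 ^+ ((v.2.1.*2.+1) * (v.2.2.*2.+1))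
           else 2 ^+ ((v.2.1.*2) * (v.2.2.*2)).

Lemma nz_twos : nz twos.
Proof. by move=> v; rewrite /twos; case: ifP => _; rewrite expf_neq0 // pnatr_eq0. Qed.

Lemma Pv_twos e K : condensation e K -> forall k, (k <= K)%N ->
  exists2 c : R, c != 0 &
    forall x y, Pv e k twos x y = c * 2 ^+ ((x.*2 + k) * (y.*2 + k)).
Proof.
move=> [e0 e1 erec].
suff H k : ((k <= K)%N -> exists2 c : R, c != 0 &
    forall x y, Pv e k twos x y = c * 2 ^+ ((x.*2 + k) * (y.*2 + k))) /\
  ((k.+1 <= K)%N -> exists2 c : R, c != 0 &
    forall x y, Pv e k.+1 twos x y = c * 2 ^+ ((x.*2 + k.+1) * (y.*2 + k.+1))).
  by move=> k; case: (H k).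
elim: k => [|k [IH0 IH1]].
  split=> _; exists 1; rewrite ?oner_neq0 // => x y; rewrite mul1r.
    by rewrite e0 ?/twos /= ?addn0 //; exact: nz_twos.
  by rewrite e1 ?/twos /= ?addn1 //; exact: nz_twos.
split=> // kK.
have [c c0 hc] := IH0 (ltnW (ltnW kK)).
have [d d0 hd] := IH1 (ltnW kK).
exists (d ^+ 2 / c * (4 - 4^-1)) => [|x y].
  rewrite !mulf_neq0 ?expf_neq0 ?invr_eq0 //.
  by rewrite subr_eq0; apply/eqP => h; lra.
have nzc : c * 2 ^+ ((x.+1.*2 + k) * (y.+1.*2 + k)) != 0.
  by rewrite mulf_neq0 // expf_neq0 // pnatr_eq0.
have := erec k kK _ nz_twos x y; rewrite /dodgson hc !hd => h.
apply: (mulIf nzc); rewrite h.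
have -> : (x.*2 + k.+2)%N = (x.*2 + k).+2 by lia.
have -> : (y.*2 + k.+2)%N = (y.*2 + k).+2 by lia.
have -> : (x.*2 + k.+1)%N = (x.*2 + k).+1 by lia.
have -> : (y.*2 + k.+1)%N = (y.*2 + k).+1 by lia.
have -> : (x.+1.*2 + k.+1)%N = (x.*2 + k).+3 by lia.
have -> : (y.+1.*2 + k.+1)%N = (y.*2 + k).+3 by lia.
have -> : (x.+1.*2 + k)%N = (x.*2 + k).+2 by lia.
have -> : (y.+1.*2 + k)%N = (y.*2 + k).+2 by lia.
move: (x.*2 + k)%N (y.*2 + k)%N => p q.
pose w : R := 2 ^+ (p.+2 * q.+2 + p.+2 * q.+2 - 2).
have E1 : (2 : R) ^+ (p.+2 * q.+2) * 2 ^+ (p.+2 * q.+2) = w * 4.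
  have -> : (4 : R) = 2 ^+ 2 by rewrite expr2; ring.
  by rewrite /w -!exprD; congr (_ ^+ _); nia.
have E2 : (2 : R) ^+ (p.+1 * q.+1) * 2 ^+ (p.+3 * q.+3) = w * 16.
  have -> : (16 : R) = 2 ^+ 4 by rewrite !exprS expr0; ring.
  by rewrite /w -!exprD; congr (_ ^+ _); nia.
have E3 : (2 : R) ^+ (p.+1 * q.+3) * 2 ^+ (p.+3 * q.+1) = w.
  by rewrite /w -!exprD; congr (_ ^+ _); nia.
transitivity (d ^+ 2 * (2 ^+ (p.+1 * q.+1) * 2 ^+ (p.+3 * q.+3)) -
              d ^+ 2 * (2 ^+ (p.+1 * q.+3) * 2 ^+ (p.+3 * q.+1))); first by ring.
rewrite E2 E3; transitivity (d ^+ 2 * (4 - 4^-1) *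
  (2 ^+ (p.+2 * q.+2) * 2 ^+ (p.+2 * q.+2))); last by field.
by rewrite E1; field.
Qed.

(** A region in which the recurrence may be solved by division. *)
Definition good e K B D :=
  forall k x y, (k <= K)%N -> (x <= B)%N -> (y <= B)%N -> Pv e k D x y != 0.

(** Laurent identities need a proof only where the recurrence can be divided out:
    [twos] shows that no value of a layer vanishes identically, so their product
    does not either. *)
Lemma good_dense e K B (f : (site -> R) -> R) :
    condensation e K -> lau f ->
    (forall D, nz D -> good e K B D -> f D = 0) ->
  forall D, nz D -> f D = 0.
Proof.
move=> ce lf fg.
pose r := [seq (k, v) | k <- iota 0 K.+1,
                v <- [seq (x, y) | x <- iota 0 B.+1, y <- iota 0 B.+1]].
pose F (t : nat * (nat * nat)) D := Pv e t.1 D t.2.1 t.2.2.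
have lF t : lau (F t) by apply: lau_Pv.
apply: (@lau_eq0_dense _ _ _ (fun D => \prod_(t <- r) F t D)) => //.
- exact: lau_prod.
- apply: lau_prod_nonzero => // t /allpairsP[kv [+ _ ->]].
  rewrite mem_iota /= add0n ltnS => kr.
  have [c c0 hc] := Pv_twos ce kr.
  exists twos; first exact: nz_twos.
  by rewrite /F /= hc mulf_neq0 // expf_neq0 // pnatr_eq0.
move=> D nD; rewrite prodf_seq_neq0 => /allP h; apply: fg => // k x y kK xB yB.
apply: (h (k, (x, y))); apply: allpairs_f; first by rewrite mem_iota ltnS.
by apply: allpairs_f; rewrite mem_iota ltnS.
Qed.

(** Two consecutive layers are again data for condensation. *)
Definition layers e i D : site -> R := fun v => Pv e (i + v.1) D v.2.1 v.2.2.

Definition fill (D : site -> R) : site -> R := fun v => if D v == 0 then 1 else D v.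

Lemma nz_fill D : nz (fill D).
Proof. by move=> v; rewrite /fill; case: ifPn => // _; rewrite oner_neq0. Qed.

(** Condensation restarted from the layers [i] and [i + 1] continues the original
    one.  Zeros far away are replaced by 1, which does not disturb the values
    computed from the good region. *)
Lemma layers_P e K B D i j x y :
    condensation e K -> nz D -> good e K B D ->
    (0 < i)%N -> (i + maxn j 1 <= K)%N -> (x + j <= B)%N -> (y + j <= B)%N ->
  Pv e j (fill (layers e i D)) x y = Pv e (i + j) D x y.
Proof.
move=> ce nD gD i0; have [e0 e1 erec] := ce.
suff H : (forall x y, (i + maxn j 1 <= K)%N -> (x + j <= B)%N -> (y + j <= B)%N ->
    Pv e j (fill (layers e i D)) x y = Pv e (i + j) D x y) /\
  (forall x y, (i + j.+1 <= K)%N -> (x + j.+1 <= B)%N -> (y + j.+1 <= B)%N ->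
    Pv e j.+1 (fill (layers e i D)) x y = Pv e (i + j.+1) D x y).
  by case: H => H _; apply: H.
elim: j {x y} => [|j [IH0 IH1]].
  split=> x y iK xB yB.
    rewrite e0; last exact: nz_fill.
    by rewrite /fill /layers /= ifN // gD //; lia.
  rewrite e1; last exact: nz_fill.
  by rewrite /fill /layers /= ifN // gD //; lia.
split=> x y iK xB yB; first by apply: IH1; lia.
have h1 := erec j ltac:(lia) _ (@nz_fill (layers e i D)) x y.
have h2 := erec (i + j)%N ltac:(lia) _ nD x y.
have nP : Pv e (i + j) D x.+1 y.+1 != 0 by apply: gD; lia.
apply: (mulIf nP); move: h1 h2; rewrite /dodgson !addnS.
by rewrite IH0 ?IH1; try lia; rewrite !addnS => -> ->.
Qed.

Definition z2 D x y := D (true, (x, y)) * D (true, (x.+1, y.+1)) -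
                       D (true, (x, y.+1)) * D (true, (x.+1, y)).

Lemma Pv2E e K D x y : condensation e K -> (2 <= K)%N -> nz D ->
  Pv e 2 D x y = z2 D x y / D (false, (x.+1, y.+1)).
Proof.
move=> [e0 e1 erec] K2 nD; have := erec 0 K2 D nD x y.
by rewrite /dodgson e0 // !e1 // /z2 => <-; rewrite mulfK.
Qed.

Lemma Pv3E e K D x y : condensation e K -> (3 <= K)%N -> nz D ->
  Pv e 3 D x y = (Pv e 2 D x y * Pv e 2 D x.+1 y.+1 -
    Pv e 2 D x y.+1 * Pv e 2 D x.+1 y) / D (true, (x.+1, y.+1)).
Proof.
move=> [e0 e1 erec] K3 nD; have := erec 1 K3 D nD x y.
by rewrite /dodgson e1 // => <-; rewrite mulfK.
Qed.

(** By the recurrence, [P 4] is a quotient with denominator [P 2 (x + 1) (y + 1)].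
    This formula has only entries of the data in its denominators: the relation
    between [P 2] and the data has been used to divide. *)
Definition fourth_layer (g : nat -> nat -> R) D x y :=
  - (g x y.+1 * g x.+1 y * g x.+1 y.+2 * g x.+2 y.+1 * D (false, (x.+2, y.+2))) /
      (D (true, (x.+1, y.+1)) * D (true, (x.+2, y.+2)) *
       D (true, (x.+1, y.+2)) * D (true, (x.+2, y.+1)))
  + (g x.+1 y.+1 * g x y * g x.+2 y.+2 - g x y * g x.+1 y.+2 * g x.+2 y.+1 -
     g x.+2 y.+2 * g x y.+1 * g x.+1 y) /
      (D (true, (x.+1, y.+1)) * D (true, (x.+2, y.+2)))
  + (g x y.+2 * g x.+1 y * g x.+2 y.+1 + g x.+2 y * g x y.+1 * g x.+1 y.+2 -
     g x.+1 y.+1 * g x y.+2 * g x.+2 y) /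
      (D (true, (x.+1, y.+2)) * D (true, (x.+2, y.+1))).

Lemma fourth_layer_rec (g : nat -> nat -> R) D x y : nz D ->
    (forall x y, g x y = z2 D x y / D (false, (x.+1, y.+1))) ->
    let h x y := (g x y * g x.+1 y.+1 - g x y.+1 * g x.+1 y) /
                 D (true, (x.+1, y.+1)) in
  fourth_layer g D x y * g x.+1 y.+1 = h x y * h x.+1 y.+1 - h x y.+1 * h x.+1 y.
Proof.
move=> nD gE h; rewrite /h /fourth_layer /=.
have := gE x.+1 y.+1; rewrite /z2.
have := nD (true, (x.+1, y.+1)); move: (D (true, (x.+1, y.+1))) => b11 n11.
have := nD (true, (x.+1, y.+2)); move: (D (true, (x.+1, y.+2))) => b12 n12.
have := nD (true, (x.+2, y.+1)); move: (D (true, (x.+2, y.+1))) => b21 n21.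
have := nD (true, (x.+2, y.+2)); move: (D (true, (x.+2, y.+2))) => b22 n22.
have := nD (false, (x.+2, y.+2)); move: (D (false, (x.+2, y.+2))) => a na.
move: (g x.+1 y.+1) => z zE.
have {}zE : z * a = b11 * b22 - b12 * b21 by rewrite zE mulfVK.
move: (g x y) (g x y.+1) (g x y.+2) (g x.+1 y) (g x.+1 y.+2) (g x.+2 y)
  (g x.+2 y.+1) (g x.+2 y.+2) => g00 g01 g02 g10 g12 g20 g21 g22.
set X := (z * g00 * g22 - _ - _) / _; set Y := (g02 * _ * _ + _ - _) / _.
transitivity (- (g01 * g10 * g12 * g21 * (z * a)) / (b11 * b22 * b12 * b21)
  + (X + Y) * z); first by ring.
by rewrite zE /X /Y; field; rewrite n11 n12 n21 n22.
Qed.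

Lemma Pv4E e K D x y : condensation e K -> (4 <= K)%N -> nz D ->
  Pv e 4 D x y = fourth_layer (fun i j => Pv e 2 D i j) D x y.
Proof.
move=> ce K4 nD; apply/eqP; rewrite -subr_eq0; apply/eqP.
pose f D := Pv e 4 D x y - fourth_layer (fun i j => Pv e 2 D i j) D x y.
suff: forall D, nz D -> f D = 0 by apply.
apply: (good_dense (B := (x + y).+1) ce) => [|{}D {}nD gD].
  have lp i j : lau (fun D => Pv e 2 D i j) by apply: lau_Pv.
  have la v : lau (fun D => D v) by apply: lau_var.
  have li (v w : site) : lau (fun D => (D v * D w)^-1).
    apply: eq_lau (lauM (lau_inv R v) (lau_inv R w)) => D' _.
    by rewrite invfM.
  have li4 (v w v' w' : site) : lau (fun D => (D v * D w * D v' * D w')^-1).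
    apply: eq_lau (lauM (li v w) (li v' w')) => D' _.
    by rewrite -invfM !mulrA.
  rewrite /f /fourth_layer; apply: lauB; first exact: lau_Pv.
  repeat first [apply: li | apply: li4 | exact: lau_Pv | apply: lp | apply: la | apply: lauD |
       apply: lauN | apply: lauM].
have [_ _ erec] := ce.
have n2 : Pv e 2 D x.+1 y.+1 != 0 by apply: gD; lia.
apply: (mulIf n2); rewrite mul0r mulrBl; apply/eqP; rewrite subr_eq0; apply/eqP.
rewrite fourth_layer_rec // => [|i j]; last by apply: Pv2E ce _ _ => //; lia.
by have := erec 2 K4 D nD x y; rewrite /dodgson => ->; rewrite !(Pv3E _ _ ce) //; lia.
Qed.

End Dodgson.

Section Phenomenon.
Variable R : realFieldType.
Implicit Types (D : site -> R) (e : nat -> lexpr R site) (x y i j k : nat).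

Section Realize.
Variables (e : nat -> lexpr R site) (K : nat) (x0 y0 : nat).
Hypotheses (ce : condensation e K) (K2 : (2 <= K)%N).

(** A layer 1 without zeros whose contiguous 2 x 2 minors vanish only at
    [(x0, y0)]. *)
Definition kinked : nat -> nat -> R :=
  fun i j => 2 ^+ (i * j) * (if (x0 < i)%N && (y0 < j)%N then 2^-1 else 1).

Definition flux i j : R :=
  kinked i j * kinked i.+1 j.+1 - kinked i j.+1 * kinked i.+1 j.

Lemma kinked_neq0 i j : kinked i j != 0.
Proof.
rewrite /kinked mulf_neq0 ?expf_neq0 ?pnatr_eq0 //.
by case: ifP => _; rewrite ?invr_eq0 ?pnatr_eq0 ?oner_neq0.
Qed.

Lemma flux_eq0 i j : (flux i j == 0) = (i == x0) && (j == y0).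
Proof.
have h0 : (2 : R) ^+ (i * j.+1 + i.+1 * j) != 0 by rewrite expf_neq0 // pnatr_eq0.
have E : flux i j = 2 ^+ (i * j.+1 + i.+1 * j) *
  (2 * (if (x0 < i)%N && (y0 < j)%N then 2^-1 else 1) *
       (if (x0 < i.+1)%N && (y0 < j.+1)%N then 2^-1 else 1) -
   (if (x0 < i)%N && (y0 < j.+1)%N then 2^-1 else 1) *
   (if (x0 < i.+1)%N && (y0 < j)%N then 2^-1 else 1)).
  have E1 : (2 : R) ^+ (i * j) * 2 ^+ (i.+1 * j.+1) =
            2 ^+ (i * j.+1 + i.+1 * j) * 2.
    by rewrite -exprD -exprSr; congr (_ ^+ _); lia.
  rewrite /flux /kinked mulrACA E1 (mulrACA (2 ^+ (i * j.+1))) -exprD.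
  by ring.
rewrite E mulf_eq0 (negPf h0) /= !ltnS.
case: (ltngtP i x0) => _; case: (ltngtP j y0) => _ /=;
  by first [apply/eqP; lra | apply/negbTE/eqP => h; lra].
Qed.

(** The values of [P 2] can be prescribed freely, provided they vanish only at
    [(x0, y0)]: away from that place the entry of layer 0 is solved for, at that
    place it stays free because [P 2] is zero there whatever it is. *)
Lemma realize (g : nat -> nat -> R) (alpha : R) :
    (forall i j, (g i j == 0) = (i == x0) && (j == y0)) -> alpha != 0 ->
  exists D, [/\ nz D, forall i j, Pv e 2 D i j = g i j,
    forall i j, D (true, (i, j)) = kinked i j
    & D (false, (x0.+1, y0.+1)) = alpha].
Proof.
move=> g0 a0.
pose a i j := match i, j with
  | i'.+1, j'.+1 => if (i' == x0) && (j' == y0) then alpha else flux i' j' / g i' j'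
  | _, _ => 1 end.
pose D (v : site) := if v.1 then kinked v.2.1 v.2.2 else a v.2.1 v.2.2.
have nD : nz D.
  move=> [[] [i j]]; rewrite /D /=; first exact: kinked_neq0.
  rewrite /a; case: i j => [|i] [|j]; rewrite ?oner_neq0 //.
  case: ifPn => // ij; rewrite mulf_neq0 ?invr_eq0 ?flux_eq0 ?g0 //.
exists D; split=> // [i j|]; last by rewrite /D /= !eqxx.
rewrite (Pv2E _ _ ce) // /z2 /D /= -/(flux i j).
case: ifPn => ij; last by rewrite invf_div mulrC mulfVK // flux_eq0.
have /eqP -> : g i j == 0 by rewrite g0.
have /eqP -> : flux i j == 0 by rewrite flux_eq0.
by rewrite mul0r.
Qed.

(** [P 3] is not divisible by any [P 2]; together with the next lemma this is the
    coprimality behind the Laurent phenomenon. *)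
Lemma Pv3_hyper x y : (3 <= K)%N ->
  exists2 D, nz D & (Pv e 2 D x0 y0 == 0) && (Pv e 3 D x y != 0).
Proof.
move=> K3.
pose g i j : R := if (i == x0) && (j == y0) then 0
                  else if (i == x) && (j == y) then 2 else 1.
have g0 i j : (g i j == 0) = (i == x0) && (j == y0).
  rewrite /g; do 2?case: ifP => _; rewrite ?eqxx ?oner_eq0 //.
  by rewrite pnatr_eq0.
have [D [nD PE _ _]] := realize g0 (oner_neq0 R).
exists D => //; rewrite PE g0 !eqxx /= (Pv3E _ _ ce) // !PE.
apply: mulf_neq0; last by rewrite invr_eq0; apply: nD.
have n21 : (2 : R) - 1 != 0 by apply/eqP => h; lra.
rewrite /g.
repeat (case: ifP => [/andP[/eqP ? /eqP ?]|?]);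
  first [by exfalso; lia
  | by rewrite ?(mul0r, mulr0, mul1r, mulr1, subr0, sub0r, oppr_eq0) ?pnatr_eq0 ?oner_eq0].
Qed.

(** At the place where the recurrence for [P 4] would divide by the vanishing [P 2],
    the formula of [fourth_layer] depends on the free entry of layer 0, which
    can be chosen to avoid a zero.  Elsewhere the recurrence itself is used, and a few values
    of [P 2] equal to 2 among values 1 make its right-hand side nonzero. *)
Lemma Pv4_hyper x y : (4 <= K)%N ->
  exists2 D, nz D & (Pv e 2 D x0 y0 == 0) && (Pv e 4 D x y != 0).
Proof.
move=> K4.
have [_ _ erec] := ce.
have [/andP[/eqP ex /eqP ey]|ne] := boolP ((x.+1 == x0) && (y.+1 == y0)).
  pose g i j : R := if (i == x0) && (j == y0) then 0 else 1.
  have g0 i j : (g i j == 0) = (i == x0) && (j == y0).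
    by rewrite /g; case: ifP => _; rewrite ?eqxx ?oner_eq0.
  suff [al al0 hal] : exists2 al : R, al != 0 &
      - al / (kinked x.+1 y.+1 * kinked x.+2 y.+2 * kinked x.+1 y.+2 *
        kinked x.+2 y.+1) + (- 2) / (kinked x.+1 y.+1 * kinked x.+2 y.+2)
        + 2 / (kinked x.+1 y.+2 * kinked x.+2 y.+1) != 0.
    have [D [nD PE bE aE]] := realize g0 al0.
    exists D => //; rewrite PE g0 !eqxx /= (Pv4E _ _ ce) // /fourth_layer !PE !bE.
    have -> : D (false, (x.+2, y.+2)) = al by rewrite ex ey.
    have g1 i j : (i != x.+1) || (j != y.+1) -> g i j = 1.
      by rewrite /g ex ey; case: eqP; case: eqP.
    have -> : g x.+1 y.+1 = 0 by rewrite /g ex ey !eqxx.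
    rewrite !g1; try lia.
    by move: hal; rewrite !(mul1r, mulr1, mul0r, sub0r, subr0) -opprD.
  pose p := kinked x.+1 y.+1 * kinked x.+2 y.+2 * kinked x.+1 y.+2 * kinked x.+2 y.+1.
  set c2 := (-2) / _; set c3 := 2 / _; rewrite -/p.
  have p0 : p != 0 by do 3 (apply: mulf_neq0; last exact: kinked_neq0); exact: kinked_neq0.
  have [c|c] := eqVneq (-1 / p + c2 + c3) 0; last by exists 1; rewrite ?oner_neq0.
  exists 2; rewrite ?pnatr_eq0 //.
  apply: contraNneq p0 => h.
  have : -1 / p = 0 by lra.
  by move/eqP; rewrite mulf_eq0 invr_eq0 oppr_eq0 oner_eq0.
have n2 (g : nat -> nat -> R) D : (forall i j, (g i j == 0) = (i == x0) && (j == y0)) ->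
    Pv e 2 D x.+1 y.+1 = g x.+1 y.+1 -> Pv e 2 D x.+1 y.+1 != 0.
  by move=> g0 ->; rewrite g0.
(* the values 2 are at opposite corners of the 3 x 3 block at (x, y), on the diagonal
   that does not have the zero at one of its ends *)
pose diag := (x == x0) && (y == y0) || (x.+2 == x0) && (y.+2 == y0).
pose two i j := if diag then (i == x) && (j == y.+2) || (i == x.+2) && (j == y)
                else (i == x) && (j == y) || (i == x.+2) && (j == y.+2).
pose g i j : R := if (i == x0) && (j == y0) then 0 else if two i j then 2 else 1.
have g0 i j : (g i j == 0) = (i == x0) && (j == y0).
  rewrite /g; do 2?case: ifP => _; rewrite ?eqxx ?oner_eq0 //.
  by rewrite pnatr_eq0.
have [D [nD PE bE _]] := realize g0 (oner_neq0 R).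
exists D => //; rewrite PE g0 !eqxx /=.
have := erec 2 K4 D nD x y; rewrite /dodgson => E.
apply: contraTneq (n2 g D g0 (PE _ _)) => P40.
have K3 : (3 <= K)%N by lia.
move: E; rewrite P40 mul0r => /eqP; rewrite eq_sym subr_eq0 !(Pv3E _ _ ce) // !PE.
have kn := kinked_neq0.
have n21 : (2 : R) - 1 != 0 by apply/eqP => h; lra.
have n12 : (1 : R) - 2 != 0 by apply/eqP => h; lra.
have [dg|dg] := boolP diag.
  have g2 : (g x y.+2 = 2) * (g x.+2 y = 2).
    by rewrite /g /two dg; move: dg; rewrite /diag => dg; split;
      (case: ifP => h; first by exfalso; lia); rewrite !eqxx ?orbT.
  have g1 : (g x y.+1 = 1) * (g x.+1 y = 1) * (g x.+1 y.+1 = 1) * (g x.+1 y.+2 = 1)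
            * (g x.+2 y.+1 = 1).
    rewrite /g /two dg; move: dg; rewrite /diag => dg.
    do !split; (case: ifP => h; first by exfalso; lia);
      (case: ifP => h'; first by exfalso; lia); by [].
  have gd : (g x y - 1) * (g x.+2 y.+2 - 1) = 0.
    case/orP: (dg) => /andP[/eqP ex /eqP ey].
      have -> : g x.+2 y.+2 = 1.
        rewrite /g /two dg; (case: ifP => h; first by exfalso; lia).
        by (case: ifP => h'; first by exfalso; lia).
      by rewrite subrr mulr0.
    have -> : g x y = 1.
      rewrite /g /two dg; (case: ifP => h; first by exfalso; lia).
      by (case: ifP => h'; first by exfalso; lia).
    by rewrite subrr mul0r.
  rewrite !g1 !g2 !mulr1 !mul1r mulrACA gd mul0r eq_sym.
  by rewrite !mulf_eq0 !invr_eq0 !bE !(negPf (kn _ _)) (negPf n12).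
have g2 : ((x == x0) && (y == y0) = false) * (g x y = 2) * (g x.+2 y.+2 = 2).
  have := dg; rewrite {1}/diag negb_or => /andP[d1 d2].
  rewrite /g /two (negPf dg).
  by rewrite (negPf d1) (negPf d2) !eqxx orbT.
have gd : (g x y.+1 * g x.+1 y.+2 - g x y.+2 * g x.+1 y.+1) *
          (g x.+1 y * g x.+2 y.+1 - g x.+1 y.+1 * g x.+2 y) = 0.
  have val i j : (i != x0) || (j != y0) -> two i j = false -> g i j = 1.
    move=> h t; rewrite /g t; case: ifP => // /andP[/eqP ei /eqP ej].
    by move: h; rewrite ei ej !eqxx.
  have tw i j : (i != x) || (j != y) -> (i != x.+2) || (j != y.+2) -> two i j = false.
    rewrite /two (negPf dg).
    by case: (i == x); case: (j == y); case: (i == x.+2); case: (j == y.+2).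
  have [h|h] := boolP ((x == x0) && (y.+1 == y0) || (x.+1 == x0) && (y.+2 == y0)
                       || (x == x0) && (y.+2 == y0)).
    by rewrite [X in _ * X](_ : _ = 0) ?mulr0 // !val ?mulr1 ?subrr ?tw //; lia.
  by rewrite [X in X * _](_ : _ = 0) ?mul0r // !val ?mulr1 ?subrr ?tw //; lia.
rewrite mulrACA [X in _ == X]mulrACA gd mul0r -(mulrACA) !mulf_eq0 !invr_eq0 !bE.
rewrite !(negPf (kn _ _)) !orbF !g2.
have g11 : g x.+1 y.+1 = 1.
  by rewrite /g /two (negPf dg); do 6?case: eqP => //; lia.
have g01 i j : (i != x) || (j != y) -> (i != x.+2) || (j != y.+2) ->
    exists b : bool, g i j = b%:R.
  rewrite /g /two (negPf dg) => h h'; exists (~~ ((i == x0) && (j == y0))).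
  case: ifP => // _; case: ifP => //.
  by move: h h'; case: (i == x); case: (j == y); case: (i == x.+2); case: (j == y.+2).
have n2b (b b' : bool) : (2 : R) - b%:R * b'%:R != 0.
  by apply/eqP; case: b; case: b' => /= h; lra.
have [||b1 ->] := g01 x y.+1; try lia.
have [||b2 ->] := g01 x.+1 y; try lia.
have [||b3 ->] := g01 x.+1 y.+2; try lia.
have [||b4 ->] := g01 x.+2 y.+1; try lia.
by rewrite g11 mulr1 mul1r !(negPf (n2b _ _)).
Qed.

End Realize.

Section Step.
Variables (e : nat -> lexpr R site) (K : nat).
Hypotheses (ce : condensation e K) (K4 : (4 <= K)%N).

(** The value of the entry [D (true, (x, y))] at which [P 2 x y] vanishes; hence
    [P 2 x y] is a unit times a difference of a variable and a unit, which is
    what [lau_div] divides by. *)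
Definition corner x y D : R :=
  D (true, (x, y.+1)) * D (true, (x.+1, y)) / D (true, (x.+1, y.+1)).

Lemma ulau_corner x y : ulau (corner x y).
Proof.
apply: ulauM; first by apply: ulauM; apply: ulau_var.
by apply: ulauV; apply: ulau_var.
Qed.

Lemma Pv2_corner D x y : nz D ->
  Pv e 2 D x y = (D (true, (x, y)) - corner x y D) *
    (D (true, (x.+1, y.+1)) / D (false, (x.+1, y.+1))).
Proof.
move=> nD; rewrite (Pv2E _ _ ce) //; last lia.
rewrite /z2 /corner mulrA; congr (_ / _); field; exact: nD.
Qed.

(** If a product of values of [P 2] divides [f * h] and no value of [P 2] divides
    [h], then it divides [f].  The factors are removed one at a time, so no
    unique factorization is needed. *)
Lemma cancel_Pv2 (r : seq site) (f g h : (site -> R) -> R) :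
    lau f -> lau g -> lau h ->
    (forall x y, exists2 D, nz D & (Pv e 2 D x y == 0) && (h D != 0)) ->
    (forall D, nz D -> f D * h D = g D * \prod_(v <- r) layers e 1 D v) ->
  exists2 q, lau q & forall D, nz D -> f D = q D * \prod_(v <- r) layers e 1 D v.
Proof.
move=> + lg lh hh; elim: r f => [|[b [x y]] r IH] f lf E.
  by exists f => // D nD; rewrite big_nil mulr1.
have [q lq fq] : exists2 q, lau q & forall D, nz D -> f D = q D * layers e 1 D (b, (x, y)).
  case: b E => E; last first.
    exists (fun D => f D / D (true, (x, y))) => [|D nD].
      by apply: lauM => //; apply: lau_inv.
    rewrite /layers /=; have [_ -> // _] := ce; rewrite mulfVK //; exact: nD.
  have [|q lq fq] := lau_div (i0 := (true, (x, y))) lf (ulau_corner x y).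
    have uh := lau_upd (true, (x, y)) lh (ulau_corner x y).
    have uf := lau_upd (true, (x, y)) lf (ulau_corner x y).
    apply: (lau_eq0_dense uf uh).
      have [D nD /andP[P0 hD]] := hh x y; exists D => //.
      rewrite -(lau_ext lh nD) // => i; rewrite /upd; case: eqP => // ->.
      move: P0; rewrite Pv2_corner // mulf_eq0 subr_eq0 => /orP[/eqP //|].
      by rewrite mulf_eq0 invr_eq0 !(negPf (nD _)).
    move=> D nD hD; set D' := upd _ _ _ in hD *.
    have nD' : nz D' by apply: nz_upd => //; case: (ulau_corner x y) => _ _ ->.
    have L0 : layers e 1 D' (true, (x, y)) = 0.
      rewrite /layers /= Pv2_corner //.
      have -> : D' (true, (x, y)) = corner x y D'.
        by rewrite /D' /corner /upd !xpair_eqE /= !eqxx !(gtn_eqF (ltnSn _)) andbF.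
      by rewrite subrr mul0r.
    by apply: (mulIf hD); rewrite mul0r E // big_cons L0 mul0r mulr0.
  exists (fun D => q D * (D (false, (x.+1, y.+1)) / D (true, (x.+1, y.+1)))) => [|D nD].
    apply: lauM => //; apply: lauM; first exact: lau_var.
    exact: lau_inv.
  rewrite /layers /= Pv2_corner // fq //.
  have := nD (false, (x.+1, y.+1)); have := nD (true, (x.+1, y.+1)) => ? ?.
  by field; apply/andP.
have [|q' lq' qq'] := IH q lq.
  move=> D nD; apply/eqP; rewrite -subr_eq0; apply/eqP.
  pose F D := q D * h D - g D * \prod_(v <- r) layers e 1 D v.
  suff: forall D, nz D -> F D = 0 by apply.
  have lP : lau (fun D => \prod_(v <- r) layers e 1 D v).
    by apply: lau_prod => v; apply: lau_Pv.
  apply: (good_dense (B := x + y) ce); first by apply: lauB; apply: lauM.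
  move=> {}D {}nD gD.
  have nL : layers e 1 D (b, (x, y)) != 0 by apply: gD => /=; lia.
  apply: (mulIf nL); rewrite mul0r /F mulrBl.
  rewrite -mulrA (mulrC (h D)) mulrA -fq // E // big_cons; ring.
exists q' => // D nD; rewrite fq // qq' // big_cons; ring.
Qed.

Definition rhs D : R :=
  Pv e K D 0 0 * Pv e K D 1 1 - Pv e K D 0 1 * Pv e K D 1 0.

Lemma layers_next i J B D : nz D -> good e K B D ->
    (0 < i)%N -> (2 <= J)%N -> (i + J = K.+1)%N -> (J < B)%N ->
    {in supp (e J), forall v : site, (v.2.1 <= B)%N && (v.2.2 <= B)%N} ->
  ev (layers e i D) (e J) * Pv e K.-1 D 1 1 = rhs D /\
  {in supp (e J), forall v, layers e i D v != 0}.
Proof.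
move=> nD gD i0 J2 iJ JB sB.
have nL : {in supp (e J), forall v, layers e i D v != 0}.
  by move=> v /sB /andP[vx vy]; apply: gD => //; case: v.1; lia.
split=> //.
have -> : ev (layers e i D) (e J) = Pv e J (fill (layers e i D)) 0 0.
  rewrite Pv00; apply: eq_ev => v /nL nv; by rewrite /fill (negPf nv).
case: J J2 iJ JB sB nL => [|[|j]] // _ iJ JB sB nL.
have [_ _ erec] := ce.
have := erec j ltac:(lia) _ (@nz_fill _ (layers e i D)) 0 0.
rewrite /dodgson (layers_P (j := j) ce nD gD) // ?(layers_P (j := j.+1) ce nD gD) //; try lia.
have -> : (i + j)%N = K.-1 by lia.
by have -> : (i + j.+1)%N = K by lia.
Qed.

(** Layer [K + 1] is layer [K] of the condensation restarted from the layers 1 and 2,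
    so its denominators are products of values of [P 2].  It is also layer
    [K - 2] of the condensation restarted from the layers 3 and 4, so its
    denominators are products of values of [P 3] and [P 4].  The two kinds of
    denominators are coprime. *)
Lemma laurent_step : exists2 f, lau f &
  forall D, nz D -> f D * Pv e K.-1 D 1 1 = rhs D.
Proof.
pose vs := supp (e K) ++ supp (e K.-2).
pose B := (K + \sum_(v <- vs) (v.2.1 + v.2.2)).+1.
have vB v : v \in vs -> (v.2.1 <= B)%N && (v.2.2 <= B)%N.
  move=> vv; have : (v.2.1 + v.2.2 <= \sum_(v <- vs) (v.2.1 + v.2.2))%N.
    by rewrite (big_rem _ vv) /= leq_addr.
  by rewrite /B; lia.
have lL i v : lau (fun D => layers e i D v) by apply: lau_Pv.
have [l1 [h1 [s1 lh1 E1]]] := lau_clear (e K) (lL 1%N).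
have [l3 [h3 [s3 lh3 E3]]] := lau_clear (e K.-2) (lL 3).
pose p1 D := \prod_(v <- l1) layers e 1 D v.
pose p3 D := \prod_(v <- l3) layers e 3 D v.
have lp1 : lau p1 by apply: lau_prod.
have lp3 : lau p3 by apply: lau_prod.
have main D : nz D -> good e K B D ->
    [/\ h1 D * p3 D = h3 D * p1 D, h1 D * Pv e K.-1 D 1 1 = rhs D * p1 D & p1 D != 0].
  move=> nD gD.
  have [G1 n1] := @layers_next 1 K B D nD gD isT ltac:(lia) ltac:(lia) ltac:(lia)
    (fun v vv => vB v ltac:(by rewrite mem_cat vv)).
  have [G3 n3] := @layers_next 3 K.-2 B D nD gD isT ltac:(lia) ltac:(lia) ltac:(lia)
    (fun v vv => vB v ltac:(by rewrite mem_cat vv orbT)).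
  have nP : Pv e K.-1 D 1 1 != 0 by apply: gD; lia.
  have EG : ev (layers e 1 D) (e K) = ev (layers e 3 D) (e K.-2).
    by apply: (mulIf nP); rewrite G1 G3.
  rewrite -(E1 D) // -(E3 D) // EG -/(p1 D) -/(p3 D); split; first by ring.
    by rewrite -G3; ring.
  by rewrite prodf_seq_neq0; apply/allP => v /s1 /n1.
have H13 D : nz D -> h1 D * p3 D = h3 D * p1 D.
  move=> nD; apply/eqP; rewrite -subr_eq0; apply/eqP.
  pose F D := h1 D * p3 D - h3 D * p1 D.
  suff: forall D, nz D -> F D = 0 by apply.
  apply: (good_dense (B := B) ce); first by apply: lauB; apply: lauM.
  by move=> {}D {}nD gD; rewrite /F; have [-> _ _] := main D nD gD; rewrite subrr.
have [|f lf fE] := cancel_Pv2 lh1 lh3 lp3 _ H13.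
  move=> x y; pose mu := corner x y.
  have up (g : (site -> R) -> R) : lau g -> lau (fun D => g (upd D (true, (x, y)) (mu D))).
    by move=> lg; apply: lau_upd => //; apply: ulau_corner.
  have ncor D : nz D -> mu D != 0 by case: (ulau_corner x y) => _ _; apply.
  have z0 D : nz D -> Pv e 2 (upd D (true, (x, y)) (mu D)) x y = 0.
    move=> nD; rewrite Pv2_corner; last by apply: nz_upd; rewrite ?ncor.
    rewrite [X in (_ - X) * _](_ : _ = mu D) ?[X in (X - _) * _](_ : _ = mu D) ?subrr ?mul0r //.
      by rewrite /upd eqxx.
    by rewrite /mu /corner /upd !xpair_eqE /= !eqxx !(gtn_eqF (ltnSn _)) andbF.
  have [||D nD hD] := @lau_prod_nonzero R site site l3
      (fun v D => layers e 3 (upd D (true, (x, y)) (mu D)) v).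
  - by move=> v; apply: up (lL 3 v).
  - move=> [b [i j]] _.
    have [D nD /andP[P0 hD]] : exists2 D, nz D &
        (Pv e 2 D x y == 0) && (layers e 3 D (b, (i, j)) != 0).
      by case: b; [apply: Pv4_hyper ce _ _ _ _ | apply: Pv3_hyper ce _ _ _ _]; lia.
    exists D => //; rewrite -(lau_ext (lL 3 _) nD) // => v.
    rewrite /upd; case: eqP => // ->.
    move: P0; rewrite Pv2_corner // mulf_eq0 subr_eq0 => /orP[/eqP //|].
    by rewrite mulf_eq0 invr_eq0 !(negPf (nD _)).
  exists (upd D (true, (x, y)) (mu D)); first by apply: nz_upd; rewrite ?ncor.
  by rewrite z0 // eqxx.
exists f => // D nD; apply/eqP; rewrite -subr_eq0; apply/eqP.
pose F D := f D * Pv e K.-1 D 1 1 - rhs D.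
suff: forall D, nz D -> F D = 0 by apply.
have lP k x y : lau (fun D => Pv e k D x y) by apply: lau_Pv.
apply: (good_dense (B := B) ce).
  by apply: lauB; [apply: lauM | apply: lauB; apply: lauM].
move=> {}D {}nD gD; have [_ H np] := main D nD gD.
apply: (mulIf np); rewrite mul0r /F mulrBl -H fE // -/(p1 D); ring.
Qed.

End Step.

(** The layers 2 and 3 are Laurent by their definition and layer 4 by [fourth_layer];
    the rest is [laurent_step]. *)
Theorem condensation_laurent K : exists e, condensation e K.
Proof.
have base : exists e, condensation e 4.
  pose f2 D : R := z2 D 0 0 / D (false, (1, 1)%N).
  have la (v : site) : lau (fun D => D v) by apply: lau_var.
  have li (v : site) : lau (fun D => (D v)^-1) by apply: lau_inv.
  have lf2 : lau f2 by apply: lauM => //; apply: lauB; apply: lauM.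
  have [e2 h2] := lf2.
  have lg x y : lau (fun D => ev (shift D x y) e2).
    by apply: lau_ev => v; apply: ulau_var.
  pose g D x y : R := ev (shift D x y) e2.
  pose f3 D : R := (g D 0 0 * g D 1 1 - g D 0 1 * g D 1 0) / D (true, (1, 1)%N).
  have [e3 h3] : lau f3 by apply: lauM => //; apply: lauB; apply: lauM; apply: lg.
  have lf4 : lau (fun D => fourth_layer (g D) D 0 0).
    have lgg i j : lau (fun D => g D i j) by apply: lg.
    have lii (v w : site) : lau (fun D : site -> R => (D v * D w)^-1).
      by apply: eq_lau (lauM (li v) (li w)) => D' _; rewrite invfM.
    have li4 (v w v' w' : site) : lau (fun D : site -> R => (D v * D w * D v' * D w')^-1).
      by apply: eq_lau (lauM (lii v w) (lii v' w')) => D' _; rewrite -invfM !mulrA.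
    rewrite /fourth_layer.
    repeat first [apply: lii | apply: li4 | apply: lgg | apply: la | apply: lauD |
       apply: lauN | apply: lauM].
  have [e4 h4] := lf4.
  pose e (k : nat) := nth (Cst _ 0) [:: Var _ (false, (0, 0)%N); Var _ (true, (0, 0)%N); e2; e3; e4] k.
  have P2 D x y : nz D -> Pv e 2 D x y = z2 D x y / D (false, (x.+1, y.+1)).
    move=> nD; rewrite /Pv /= -h2; last exact: nz_shift.
    by rewrite /f2 /z2 /shift /= !addn0 !addn1.
  have P3 D x y : nz D -> Pv e 3 D x y = (Pv e 2 D x y * Pv e 2 D x.+1 y.+1 -
      Pv e 2 D x y.+1 * Pv e 2 D x.+1 y) / D (true, (x.+1, y.+1)).
    move=> nD; rewrite {1}/Pv /= -h3; last exact: nz_shift.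
    rewrite /f3 /g -!/(Pv e 2 _ _ _) !Pv_shift /shift /= !addn0 !addn1.
    by [].
  have P4' D x y : nz D -> Pv e 4 D x y = fourth_layer (fun i j => Pv e 2 D i j) D x y.
    move=> nD; rewrite {1}/Pv /= -h4; last exact: nz_shift.
    rewrite /fourth_layer /g -!/(Pv e 2 _ _ _) !Pv_shift /shift /= !addn0 !addn1 !addn2.
    by [].
  exists e; split=> [D nD x y|D nD x y|[|[|[|k]]] // _ D nD x y].
  - by rewrite /Pv /= /shift /= !addn0.
  - by rewrite /Pv /= /shift /= !addn0.
  - by rewrite /dodgson P2 // /Pv /= /shift /= !addn0 mulfVK.
  - rewrite /dodgson P3 // [Pv e 1 _ _ _]/Pv /= /shift /= !addn0 mulfVK //.
  - by rewrite /dodgson P4' // !P3 // fourth_layer_rec // => i j; rewrite P2.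
have [K4|K4] := leqP K 4.
  have [e [e0 e1 erec]] := base; exists e; split=> // k kK.
  by apply: erec; apply: leq_trans kK K4.
elim: K K4 => // K IH; rewrite ltnS leq_eqVlt => K4.
have [e ce] : exists e, condensation e K.
  by case/orP: K4 => [/eqP <-|/IH].
have {}K4 : (4 <= K)%N by case/orP: K4 => [/eqP <-|/ltnW].
have [f [g gE] fE] := laurent_step ce K4.
exists (fun k => if k == K.+1 then g else e k).
have [e0 e1 erec] := ce.
have PE k D x y : (k <= K)%N ->
    Pv (fun k => if k == K.+1 then g else e k) k D x y = Pv e k D x y.
  by move=> kK; rewrite /Pv ltn_eqF.
split=> [D nD x y|D nD x y|k kK D nD x y].
- by rewrite PE ?e0.
- by rewrite PE ?e1 //; lia.
rewrite /dodgson !(PE k.+1) ?(PE k); try lia.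
move: kK; rewrite leq_eqVlt => /orP[/eqP [kK]|kK]; last first.
  by rewrite PE //; apply: erec.
rewrite kK {1}/Pv eqxx -gE; last exact: nz_shift.
have := fE _ (@nz_shift _ D x y nD); rewrite /rhs !Pv_shift -kK /= !addn0 !addn1.
by [].
Qed.

End Phenomenon.

(** * Gauge invariance and vanishing of condensation *)

Section Vanishing.
Variable R : realFieldType.
Variables (e : nat -> lexpr R site) (K : nat).
Hypothesis ce : condensation e K.
Implicit Types (D : site -> R) (x y i j k : nat).

(** A value of layer [k] at the origin depends on the entries with indices below [k];
    the first row and column of layer 0 are not among them. *)
Definition window B (v : site) :=
  [&& (v.2.1 < B)%N, (v.2.2 < B)%N & v.1 || (0 < v.2.1)%N && (0 < v.2.2)%N].

Definition restr B D : site -> R := fun v => if window B v then D v else 1.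

Lemma nz_restr B D : nz D -> nz (restr B D).
Proof. by move=> nD v; rewrite /restr; case: ifP; rewrite ?oner_neq0. Qed.

Lemma Pv_restr B k D x y : nz D -> (k <= K)%N -> (x + maxn k 1 <= B)%N ->
    (y + maxn k 1 <= B)%N -> (0 < k)%N || (0 < x)%N && (0 < y)%N ->
  Pv e k (restr B D) x y = Pv e k D x y.
Proof.
suff H k' : (forall x y, (k' <= K)%N -> (x + maxn k' 1 <= B)%N ->
      (y + maxn k' 1 <= B)%N -> (0 < k')%N || (0 < x)%N && (0 < y)%N ->
      forall D, nz D -> Pv e k' (restr B D) x y = Pv e k' D x y) /\
    (forall x y, (k'.+1 <= K)%N -> (x + k'.+1 <= B)%N -> (y + k'.+1 <= B)%N ->
      forall D, nz D -> Pv e k'.+1 (restr B D) x y = Pv e k'.+1 D x y).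
  by move=> nD kK xB yB hb; case: (H k) => H0 _; apply: H0.
have [e0 e1 erec] := ce.
elim: k' {k D x y} => [|k [IH0 IH1]].
  split=> x y kK xB yB.
    by move=> hb D nD; have nr := nz_restr B nD; rewrite !e0 // /restr /window ifT //=; lia.
  move=> D nD; have nr := nz_restr B nD.
  by rewrite !e1 // /restr /window ifT //=; lia.
split=> x y kK xB yB; first by move=> _; apply: IH1; lia.
move=> D nD; apply/eqP; rewrite -subr_eq0; apply/eqP.
pose F D := Pv e k.+2 (restr B D) x y - Pv e k.+2 D x y.
suff: forall D, nz D -> F D = 0 by apply.
apply: (good_dense (B := (x + y).+1) ce).
  apply: lauB; last exact: lau_Pv.
  apply: (lau_comp (s := fun v D => restr B D v) (lau_Pv e k.+2 x y)) => v.
  rewrite /restr; case: (window B v); first exact: ulau_var.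
  exact: ulau_cst (oner_neq0 R).
move=> {}D {}nD gD; have nP : Pv e k D x.+1 y.+1 != 0 by apply: gD; lia.
apply: (mulIf nP); rewrite mul0r /F mulrBl.
rewrite -{1}(IH0 x.+1 y.+1) ?orbT //; try lia.
have nr := nz_restr B nD.
have := erec k kK _ nr x y; have := erec k kK _ nD x y.
rewrite /dodgson => -> ->.
by rewrite !IH1 ?subrr //; lia.
Qed.

Lemma Pv_local k D D' : nz D -> nz D' -> (0 < k <= K)%N ->
  {in window k, D =1 D'} -> Pv e k D 0 0 = Pv e k D' 0 0.
Proof.
move=> nD nD' /andP[k0 kK] DD'.
rewrite -(@Pv_restr k) //; try lia; rewrite -(@Pv_restr k k D') //; try lia.
rewrite !Pv00; apply: eq_ev => v _; rewrite /restr; case: ifP => // /DD'.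
by [].
Qed.

Definition gauge (r c : nat -> nat -> R) D : site -> R :=
  fun v => r v.1 v.2.1 * c v.1 v.2.2 * D v.

(** The row factors for which a rescaling of the data by rows is compatible with the
    recurrence. *)
Definition gauge_factor (r : nat -> nat -> R) :=
  (forall k i, r k i != 0) /\
  (forall k i, r k.+2 i * r k i.+1 = r k.+1 i * r k.+1 i.+1).

Lemma nz_gauge r c D : gauge_factor r -> gauge_factor c -> nz D ->
  nz (gauge r c D).
Proof. by move=> [r0 _] [c0 _] nD v; rewrite /gauge !mulf_neq0. Qed.

(** Both terms on the right of the recurrence scale alike. *)
Lemma Pv_gauge r c k D x y : gauge_factor r -> gauge_factor c ->
    nz D -> (k <= K)%N ->
  Pv e k (gauge r c D) x y = r k x * c k y * Pv e k D x y.
Proof.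
move=> mr mc; have [r0 rr] := mr; have [c0 cc] := mc.
have [e0 e1 erec] := ce.
suff H k' : ((k' <= K)%N -> forall x y D, nz D ->
      Pv e k' (gauge r c D) x y = r k' x * c k' y * Pv e k' D x y) /\
    ((k'.+1 <= K)%N -> forall x y D, nz D ->
      Pv e k'.+1 (gauge r c D) x y = r k'.+1 x * c k'.+1 y * Pv e k'.+1 D x y).
  by move=> nD kK; case: (H k) => H0 _; apply: H0.
elim: k' {k D x y} => [|k [IH0 IH1]].
  split=> kK x y D nD; have nr := nz_gauge mr mc nD.
    by rewrite !e0.
  by rewrite !e1.
split=> // kK x y D nD; apply/eqP; rewrite -subr_eq0; apply/eqP.
pose F D := Pv e k.+2 (gauge r c D) x y - r k.+2 x * c k.+2 y * Pv e k.+2 D x y.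
suff: forall D, nz D -> F D = 0 by apply.
apply: (good_dense (B := (x + y).+1) ce).
  apply: lauB; last by apply: lauM; [apply: lau_cst | apply: lau_Pv].
  apply: (lau_comp (s := fun v D => gauge r c D v) (lau_Pv e k.+2 x y)) => v.
  rewrite /gauge; apply: ulauM; last exact: ulau_var.
  by apply: ulau_cst; rewrite mulf_neq0.
move=> {}D {}nD gD; have nP : Pv e k D x.+1 y.+1 != 0 by apply: gD; lia.
have nrc : r k x.+1 * c k y.+1 * Pv e k D x.+1 y.+1 != 0 by rewrite !mulf_neq0.
apply: (mulIf nrc); rewrite mul0r /F mulrBl.
have nr := nz_gauge mr mc nD.
have := erec k kK _ nr x y; have := erec k kK _ nD x y.
rewrite /dodgson IH0 ?(ltnW (ltnW kK)) // !IH1 ?(ltnW kK) // => E ->.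
transitivity (r k.+1 x * r k.+1 x.+1 * (c k.+1 y * c k.+1 y.+1) *
  (Pv e k.+1 D x y * Pv e k.+1 D x.+1 y.+1 - Pv e k.+1 D x y.+1 * Pv e k.+1 D x.+1 y)
  - r k.+2 x * r k x.+1 * (c k.+2 y * c k y.+1) * (Pv e k.+2 D x y * Pv e k D x.+1 y.+1)).
  by ring.
by rewrite -E rr cc subrr.
Qed.

(** Only the values of [P 2] in a finite window have to be nonzero to restart the
    condensation from the layers 1 and 2. *)
Lemma Pv_next m D : nz D -> (0 < m < K)%N ->
    (forall i j, (i < m)%N -> (j < m)%N -> Pv e 2 D i j != 0) ->
  Pv e m.+1 D 0 0 = ev (restr m (layers e 1 D)) (e m).
Proof.
move=> nD /andP[m0 mK] n2.
pose s (v : site) D := restr m (layers e 1 D) v.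
have ls v : lau (s v).
  rewrite /s /restr; case: (window m v); last exact: lau_cst.
  by rewrite /layers; apply: lau_Pv.
have [l [h [sl lh E]]] := lau_clear (e m) ls.
pose p D := \prod_(v <- l) s v D.
have np D' : nz D' -> (forall i j, (i < m)%N -> (j < m)%N -> Pv e 2 D' i j != 0) ->
    forall v, s v D' != 0.
  move=> nD' n2' [b [i j]]; rewrite /s /restr /window /layers /=; case: ifP => /=.
    case/and3P=> im jm _; case: b => /=; first exact: n2'.
    by have [_ -> // _] := ce; apply: nD'.
  by rewrite oner_neq0.
have H : forall D, nz D -> Pv e m.+1 D 0 0 * p D - h D = 0.
  apply: (good_dense (B := m.+1) ce).
    apply: lauB => //; apply: lauM; first exact: lau_Pv.
    exact: lau_prod.
  move=> D' nD' gD'.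
  have n2' : forall i j, (i < m)%N -> (j < m)%N -> Pv e 2 D' i j != 0.
    by move=> i j im jm; apply: gD'; lia.
  have ns := np D' nD' n2'.
  rewrite -E //.
  apply/eqP; rewrite subr_eq0; apply/eqP; congr (_ * _).
  have nL : nz (restr m (layers e 1 D')) by move=> v; apply: ns.
  have := layers_P (i := 1) (j := m) (x := 0) (y := 0) ce nD' gD'.
  rewrite add1n => <- //; try lia.
  rewrite -Pv00; apply: Pv_local => //; try lia; first exact: nz_fill.
  move=> v vm; have wv : window m v := vm.
  have := ns v; rewrite /s /restr wv => nv.
  by rewrite /fill (negPf nv).
have ns := np D nD n2.
have npD : p D != 0 by rewrite prodf_seq_neq0; apply/allP => v _; apply: ns.
apply: (mulIf npD); rewrite E //.
by apply/eqP; rewrite -subr_eq0 H.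
Qed.

Section ProportionalColumns.
Variables (m j0 : nat).
Hypotheses (hm : (0 < m < K)%N) (hj : (j0 < m)%N).
Implicit Types (z : option site -> R).

(** Layer 1 is deformed with the extra variable [None]: at the value 1 its columns
    [j0] and [j0 + 1] are proportional down to row [m], and [P 2] vanishes along
    column [j0]. *)
Definition twisted_columns z : site -> R := fun v =>
  if [&& v.1, v.2.2 == j0.+1 & (v.2.1 <= m)%N] then
    z (Some (true, (0, j0.+1)%N)) / z (Some (true, (0, j0)%N)) *
    z (Some (true, (v.2.1, j0))) * z None ^+ v.2.1
  else z (Some v).

Lemma ulau_twisted v : ulau (fun z => twisted_columns z v).
Proof.
rewrite /twisted_columns; case: [&& _, _ & _]; last exact: ulau_var.
apply: ulauM; last by apply: ulauX; apply: ulau_var.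
apply: ulauM; last exact: ulau_var.
by apply: ulauM; [|apply: ulauV]; apply: ulau_var.
Qed.

Lemma nz_twisted z : nz z -> nz (twisted_columns z).
Proof. by move=> nzz v; case: (ulau_twisted v) => _ _; apply. Qed.

Definition column_unit i z : R :=
  z (Some (true, (0, j0.+1)%N)) / z (Some (true, (0, j0)%N)) *
  z (Some (true, (i, j0))) * z (Some (true, (i.+1, j0))) * z None ^+ i /
  z (Some (false, (i.+1, j0.+1))).

Lemma ulau_column_unit i : ulau (column_unit i).
Proof.
apply: ulauM; last by apply: ulauV; apply: ulau_var.
apply: ulauM; last by apply: ulauX; apply: ulau_var.
apply: ulauM; last exact: ulau_var.
apply: ulauM; last exact: ulau_var.
by apply: ulauM; [|apply: ulauV]; apply: ulau_var.
Qed.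

Lemma lau_Pv_twisted k x y : lau (fun z => Pv e k (twisted_columns z) x y).
Proof.
exact: (lau_comp (s := fun v z => twisted_columns z v) (lau_Pv e k x y) ulau_twisted).
Qed.

Lemma Pv2_twisted z i : nz z -> (i < m)%N ->
  Pv e 2 (twisted_columns z) i j0 = (z None - 1) * column_unit i z.
Proof.
move=> nzz im; rewrite (Pv2E _ _ ce); [|lia|exact: nz_twisted].
rewrite /z2 /twisted_columns /column_unit /= !eqxx (ltn_eqF (ltnSn j0)) /=.
rewrite im (ltnW im) exprS [RHS]mulrA; congr (_ / _); ring.
Qed.

Lemma Pv2_generic i j : j != j0 -> exists z,
  [/\ nz z, z None = 1 & Pv e 2 (twisted_columns z) i j != 0].
Proof.
move=> jj0; pose col := if (j < j0)%N then j else j.+1.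
have c0 : col != j0 by rewrite /col; case: ifP => h; lia.
have c1 : col != j0.+1 by rewrite /col; case: ifP => h; lia.
pose z (v : option site) : R := if v == Some (true, (i, col)) then 2 else 1.
have nzz : nz z by move=> v; rewrite /z; case: ifP; rewrite ?oner_neq0 ?pnatr_eq0.
have zE v : twisted_columns z v = if v == (true, (i, col)) then 2 else 1.
  rewrite /twisted_columns; case: ifP => // /and3P[v1 v2 v3].
  rewrite /z /= !(inj_eq (@Some_inj _)) !xpair_eqE /=.
  rewrite (eq_sym j0) (eq_sym j0.+1) (negPf c0) (negPf c1) !andbF expr1n divr1 !mulr1.
  case: v v1 v2 {v3} => [b [r c]] /= _ /eqP ->.
  by rewrite !xpair_eqE (eq_sym j0.+1) (negPf c1) !andbF.
exists z; split=> //; rewrite (Pv2E _ _ ce); [|lia|exact: nz_twisted].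
rewrite mulf_neq0 ?invr_eq0 ?nz_twisted // /z2 !zE !xpair_eqE /= !eqxx /=.
rewrite (gtn_eqF (ltnSn i)) /= /col; case: (ltnP j j0) => _.
  by rewrite ?eqxx ?(gtn_eqF (ltnSn j)) /=; apply/eqP => h; lra.
by rewrite ?eqxx ?(ltn_eqF (ltnSn j)) /=; apply/eqP => h; lra.
Qed.

(** The layers 1 and 2 of the deformed data, with the factor [z None - 1] taken out
    of column [j0] of layer 2. *)
Definition rescaled z : site -> R := fun v =>
  if window m v then
    if v.1 && (v.2.2 == j0) then column_unit v.2.1 z
    else layers e 1 (twisted_columns z) v
  else 1.

Lemma lau_rescaled v : lau (fun z => rescaled z v).
Proof.
rewrite /rescaled; case: (window m v); last exact: lau_cst.
case: (v.1 && _); first by case: (ulau_column_unit v.2.1).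
exact: lau_Pv_twisted.
Qed.

(** The gauge that puts the factor back: after the restart, a value of layer [k] in
    column [j] is computed from the columns [j] to [j + k - 1] of layer 2. *)
Definition column_factor (t : R) k j : R := \prod_(j <= l < j + k) (if l == j0 then t else 1).

Lemma column_factor_gauge_factor t : t != 0 -> gauge_factor (column_factor t).
Proof.
move=> t0; split=> [k i|k i].
  rewrite /column_factor prodf_seq_neq0; apply/allP => l _ /=.
  by case: ifP; rewrite ?oner_neq0.
rewrite /column_factor !addnS.
rewrite [X in X * _]big_nat_recr /=; last lia.
rewrite [X in _ = _ * X]big_nat_recr /=; last lia.
by rewrite !addSn; ring.
Qed.

(** Restarting from the layers 1 and 2, whose column [j0] carries the factor
    [z None - 1], produces this factor once, by gauge invariance. *)
Lemma Pv_twisted_eq z : nz z -> z None != 1 ->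
    (forall i j, (i < m)%N -> (j < m)%N -> j != j0 ->
       Pv e 2 (twisted_columns z) i j != 0) ->
  Pv e m.+1 (twisted_columns z) 0 0 = (z None - 1) * ev (rescaled z) (e m) /\
  nz (rescaled z).
Proof.
move=> nzz z1 n2; have nD := nz_twisted nzz.
have t0 : z None - 1 != 0 by rewrite subr_eq0.
have nM : nz (rescaled z).
  move=> [b [i j]]; rewrite /rescaled /window /=.
  case: ifP => [/and3P[im jm _]|_]; last exact: oner_neq0.
  case: ifP => [_|bj]; first by case: (ulau_column_unit i) => _ _; apply.
  case: b bj => /= bj; last by rewrite /layers; have [_ -> // _] := ce.
  by apply: n2 => //; rewrite bj.
split=> //; rewrite (Pv_next nD hm); last first.
  move=> i j im jm; have [->|jj] := eqVneq j j0; last exact: n2.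
  rewrite Pv2_twisted // mulf_neq0 //.
  by case: (ulau_column_unit i) => _ _; apply.
have mr : gauge_factor (fun _ _ => 1 : R) by split=> *; rewrite ?oner_neq0.
have mc := column_factor_gauge_factor t0.
have -> : ev (restr m (layers e 1 (twisted_columns z))) (e m) =
    Pv e m (gauge (fun _ _ => 1) (column_factor (z None - 1)) (rescaled z)) 0 0.
  have /andP[m0 mK] := hm.
  rewrite -(@Pv_restr m m (gauge _ _ _)); try lia; last exact: (nz_gauge mr mc nM).
  rewrite !Pv00; apply: eq_ev => -[b [i j]] _.
  rewrite /restr /gauge /rescaled; case: ifP => // /and3P[/= im jm _].
  rewrite mul1r /column_factor; case: b => /=.
    rewrite addn1 big_nat1; case: eqP => [->|_]; last by rewrite mul1r.
    by rewrite /layers /= Pv2_twisted.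
  by rewrite addn0 big_geq // mul1r.
rewrite Pv_gauge //; last by case/andP: hm => _ /ltnW.
rewrite mul1r Pv00; congr (_ * _); rewrite /column_factor add0n.
rewrite (bigD1_seq j0) ?mem_index_iota ?iota_uniq //= eqxx big1 ?mulr1 // => l.
by move/negPf ->.
Qed.

(** The factor [z None - 1] survives the passage to the limit [z None = 1] because
    [P (m + 1)] and [rescaled] are Laurent and the denominators do not vanish
    identically there. *)
Lemma Pv_twisted_one z : nz z -> z None = 1 ->
  Pv e m.+1 (twisted_columns z) 0 0 = 0.
Proof.
pose E z := Pv e m.+1 (twisted_columns z) 0 0.
have lE : lau E by apply: lau_Pv_twisted.
have [l [h [sl lh H]]] := lau_clear (e m) lau_rescaled.
pose M z := \prod_(v <- l) rescaled z v.
have lM : lau M by apply: lau_prod => v; apply: lau_rescaled.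
have key : forall z, nz z -> E z * M z - (z None - 1) * h z = 0.
  pose F (t : nat * nat) z := if t.2 == j0 then 1 else Pv e 2 (twisted_columns z) t.1 t.2.
  have lF t : lau (F t).
    by rewrite /F; case: (t.2 == j0); [apply: lau_cst | apply: lau_Pv_twisted].
  pose r := [seq (i, j) | i <- iota 0 m, j <- iota 0 m].
  have lt : lau (fun z => z None - 1) by apply: lauB; [apply: lau_var | apply: lau_cst].
  have lg : lau (fun z => (z None - 1) * \prod_(t <- r) F t z).
    by apply: lauM => //; apply: lau_prod.
  apply: (lau_eq0_dense _ lg).
  - by apply: lauB; apply: lauM.
  - have ht : exists2 z : option site -> R, nz z & z None - 1 != 0.
      exists (fun=> 2); first by move=> v; rewrite pnatr_eq0.
      by apply/eqP => ?; lra.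
    have hr : exists2 z : option site -> R, nz z & \prod_(t <- r) F t z != 0.
      apply: lau_prod_nonzero => // -[i j] _; rewrite /F /=.
      have [_|jj] := boolP (j == j0).
        by exists (fun=> 1) => [v|]; rewrite oner_neq0.
      by have [w [nw _ nP]] := Pv2_generic i jj; exists w.
    have [w nw /andP[h1 h2]] := lau_nonzero2 lt (lau_prod r lF) ht hr.
    by exists w => //; rewrite mulf_neq0.
  - move=> w nw; rewrite mulf_eq0 negb_or subr_eq0 => /andP[w1].
    rewrite prodf_seq_neq0 => /allP n2.
    have [|EE nM] := Pv_twisted_eq nw w1.
      move=> i j im jm jj; have /= := n2 (i, j); rewrite /F /= (negPf jj).
      by apply; apply: allpairs_f; rewrite mem_iota.
    by rewrite /E EE -mulrA /M H ?subrr // => v _; apply: nM.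
pose one (w : option site -> R) := upd w None (1 : R).
have n1 w : nz w -> nz (one w) by move=> nw; apply: nz_upd; rewrite ?oner_neq0.
have u1 : ulau (fun _ : option site -> R => 1) by apply: ulau_cst; rewrite oner_neq0.
move=> nzz z1.
have -> : Pv e m.+1 (twisted_columns z) 0 0 = E (one z).
  by apply: (lau_ext lE nzz) => v; rewrite /one /upd; case: eqP => [->|].
have lE1 : lau (fun z => E (one z)) by apply: (lau_upd None lE u1).
have lM1 v : lau (fun z => rescaled (one z) v) by apply: (lau_upd None (lau_rescaled v) u1).
apply: (lau_eq0_dense lE1 (lau_prod l lM1)) => //.
  apply: lau_prod_nonzero => // -[b [i j]] _.
  have uno : exists2 z : option site -> R, nz z & nz (one z).
    exists (fun=> 1); first by move=> v; rewrite oner_neq0.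
    by apply: n1 => v; rewrite oner_neq0.
  rewrite /rescaled; case: (window _ _); last first.
    by case: uno => z' nz' _; exists z' => //; rewrite oner_neq0.
  case: b => /=; last first.
    case: uno => z' nz' nz1; exists z' => //; have [_ e1 _] := ce.
    by rewrite /layers /= e1; exact: nz_twisted.
  have [_|jj] := boolP (j == j0).
    case: uno => z' nz' nz1; exists z' => //.
    by case: (ulau_column_unit i) => _ _; apply.
  have [z' [nz' z1' nP]] := Pv2_generic i jj; exists z' => //.
  rewrite /layers /= -(lau_ext (lau_Pv_twisted 2 i j) nz') // => v.
  by rewrite /one /upd; case: eqP => [->|].
move=> w nw nM; have /eqP := key _ (n1 w nw).
have -> : one w None = 1 by rewrite /one /upd eqxx.
rewrite subrr mul0r subr0 mulf_eq0 => /orP[/eqP //|].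
by move: nM => /negPf; rewrite /M => ->.
Qed.

End ProportionalColumns.

(** The vanishing of [P 2] along column [j0] says that the columns [j0] and [j0 + 1]
    of layer 1 are proportional down to row [m], so the data are
    [twisted_columns] with parameter 1. *)
Theorem Pv_vanish m j0 D : (0 < m < K)%N -> (j0 < m)%N -> nz D ->
    (forall i, (i < m)%N -> Pv e 2 D i j0 = 0) ->
  Pv e m.+1 D 0 0 = 0.
Proof.
move=> hm hj nD P0.
pose z (v : option site) : R := if v is Some w then D w else 1.
have nzz : nz z by case=> [v|]; [apply: nD | apply: oner_neq0].
rewrite -(Pv_twisted_one hm hj nzz (erefl _)); apply: eq_ev => v _.
rewrite /shift !add0n -surjective_pairing -surjective_pairing.
rewrite /twisted_columns; case: ifP => // /and3P[v1 /eqP v2 v3] /=.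
rewrite expr1n mulr1; case: v v1 v2 v3 => [[] // [i j]] /= _ ->.
elim: i => [|i IH] im; first by rewrite mulfVK.
have := P0 i im; rewrite (Pv2E _ _ ce) //; last by lia.
move/eqP; rewrite mulf_eq0 invr_eq0 (negPf (nD _)) orbF /z2 subr_eq0 IH 1?ltnW //.
move/eqP => E; apply: (mulfI (nD (true, (i, j0)))); rewrite E; ring.
Qed.

End Vanishing.

(** * Determinants of folded arrays *)

Definition minor (R : comNzRingType) (f : nat -> nat -> R) k x y : R :=
  \det (\matrix_(i < k, j < k) f (x + i)%N (y + j)%N).

Section Minors.
Variables (R : comNzRingType) (f : nat -> nat -> R).

Lemma minor0 x y : minor f 0 x y = 1.
Proof. by rewrite /minor det_mx00. Qed.

Lemma minor1 x y : minor f 1 x y = f x y.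
Proof. by rewrite /minor det_mx11 mxE !addn0. Qed.

Lemma adj_corners k x y (A := \matrix_(i < k.+2, j < k.+2) f (x + i)%N (y + j)%N) :
  (\adj A ord0 ord0 = minor f k.+1 x.+1 y.+1) *
  (\adj A ord_max ord_max = minor f k.+1 x y) *
  (\adj A ord0 ord_max = (-1) ^+ k.+1 * minor f k.+1 x y.+1) *
  (\adj A ord_max ord0 = (-1) ^+ k.+1 * minor f k.+1 x.+1 y).
Proof.
have lift_max (i : 'I_k.+1) : lift ord_max i = i :> nat by rewrite lift_max.
do !split; rewrite mxE /cofactor /= ?addn0 ?add0n ?addnn ?expr0 ?mul1r.
- by congr (\det _); apply/matrixP => i j; rewrite !mxE !lift0 !addnS !addSn.
- rewrite -signr_odd odd_double expr0 mul1r.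
  by congr (\det _); apply/matrixP => i j; rewrite !mxE !lift_max.
- congr (_ * \det _); apply/matrixP => i j.
  by rewrite !mxE lift_max lift0 addnS addSn.
- congr (_ * \det _); apply/matrixP => i j.
  by rewrite !mxE lift_max lift0 addnS addSn.
Qed.
End Minors.

Section Desnanot.
Variables (R : idomainType).

Lemma det_single_col n (M : 'M[R]_n) (i0 j0 : 'I_n) :
  (forall i, i != i0 -> M i j0 = 0) -> \det M = M i0 j0 * cofactor M i0 j0.
Proof.
move=> M0; rewrite (expand_det_col _ j0) (bigD1 i0) //= big1 ?addr0 // => i.
by move=> /M0 ->; rewrite mul0r.
Qed.

Lemma det_outer_cols k (M : 'M[R]_k.+2) :
    (forall i j : 'I_k.+2, (0 < j < k.+1)%N -> M i j = (i == j)%:R) ->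
  \det M = M ord0 ord0 * M ord_max ord_max - M ord0 ord_max * M ord_max ord0.
Proof.
elim: k M => [|k IH] M HM.
  rewrite (expand_det_row _ ord0) !big_ord_recl big_ord0 addr0 /cofactor !det_mx11 !mxE /=.
  rewrite expr0 expr1 mul1r mulN1r mulrN.
  have -> : lift ord0 0 = ord_max :> 'I_2 by apply: val_inj.
  by have -> : lift ord_max 0 = ord0 :> 'I_2 by apply: val_inj.
pose j1 : 'I_k.+3 := lift ord0 ord0.
have M1 i : i != j1 -> M i j1 = 0.
  by move=> ij; rewrite HM // (negPf ij).
rewrite (det_single_col M1) HM // eqxx mul1r /cofactor addnn -signr_odd odd_double mul1r.
have l0 : lift j1 ord0 = ord0 :> 'I_k.+3 by apply: val_inj.
have lm : lift j1 ord_max = ord_max :> 'I_k.+3 by apply: val_inj.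
rewrite IH => [|i j hj]; rewrite !mxE ?l0 ?lm //.
rewrite HM; last by rewrite /= /bump; case: leqP; lia.
by rewrite (inj_eq lift_inj).
Qed.

(** Jacobi's proof: multiply the matrix by the identity with its outer columns replaced
    by those of the adjugate. *)
Lemma dodgson_nonsingular (f : nat -> nat -> R) k x y : minor f k.+2 x y != 0 ->
  minor f k.+2 x y * minor f k x.+1 y.+1 =
  minor f k.+1 x y * minor f k.+1 x.+1 y.+1 -
  minor f k.+1 x y.+1 * minor f k.+1 x.+1 y.
Proof.
move=> d0; pose A := \matrix_(i < k.+2, j < k.+2) f (x + i)%N (y + j)%N.
have dA : \det A = minor f k.+2 x y by [].
pose C := \matrix_(i < k.+2, j < k.+2)
  if (j == ord0) || (j == ord_max) then \adj A i j else (i == j)%:R.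
have [[[a00 amm] a0m] am0] := adj_corners f k x y; rewrite -/A in a00 amm a0m am0.
have CE i j : C i j = if (j == ord0) || (j == ord_max) then \adj A i j else (i == j)%:R.
  by rewrite [LHS]mxE.
have dC : \det C = minor f k.+1 x y * minor f k.+1 x.+1 y.+1 -
    minor f k.+1 x y.+1 * minor f k.+1 x.+1 y.
  rewrite det_outer_cols => [|i j /andP[j0 jm]]; last first.
    by rewrite CE -!(inj_eq val_inj) /= (gtn_eqF j0) (ltn_eqF jm).
  rewrite !CE !eqxx !orbT /= a00 amm a0m am0.
  rewrite mulrACA -exprD addnn -signr_odd odd_double mul1r; ring.
have AC i j : (A *m C) i j =
    if (j == ord0) || (j == ord_max) then \det A * (i == j)%:R else A i j.
  rewrite mxE; case: ifP => jj.
    have -> : \det A * (i == j)%:R = (A *m \adj A) i j by rewrite mul_mx_adj mxE mulr_natr.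
    by rewrite [RHS]mxE; apply: eq_bigr => l _; rewrite CE jj.
  rewrite (bigD1 j) //= CE jj eqxx mulr1 big1 ?addr0 // => l lj.
  by rewrite CE jj (negPf lj) mulr0.
have : \det (A *m C) = \det A * (\det A * minor f k x.+1 y.+1).
  rewrite (@det_single_col _ _ ord0 ord0) => [|i i0]; last first.
    by rewrite AC eqxx (negPf i0) mulr0.
  rewrite AC !eqxx mulr1; congr (_ * _).
  rewrite /cofactor addn0 expr0 mul1r.
  have l0m : lift ord0 ord_max = ord_max :> 'I_k.+2 by apply: val_inj.
  have entry i j : row' ord0 (col' ord0 (A *m C)) i j = (A *m C) (lift ord0 i) (lift ord0 j).
    by rewrite mxE [LHS]mxE.
  rewrite [LHS](@det_single_col k.+1 _ ord_max ord_max) => [|i im]; last first.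
    rewrite entry AC l0m eqxx orbT -[ord_max]l0m (inj_eq lift_inj) (negPf im).
    by rewrite mulr0.
  rewrite entry AC l0m eqxx orbT mulr1; congr (_ * _).
  rewrite /cofactor addnn -signr_odd odd_double mul1r; congr (\det _).
  apply/matrixP => i j; rewrite mxE [LHS]mxE entry AC [RHS]mxE.
  have lv (l : 'I_k) : lift ord0 (lift ord_max l) = l.+1 :> nat by rewrite lift0 lift_max.
  rewrite ifF ?mxE ?lv ?addSn ?addnS //.
  apply/negbTE; rewrite negb_or; apply/andP; split; apply/eqP => /(congr1 val);
    rewrite [LHS]lv //=.
  by case=> jE; have := ltn_ord j; rewrite [X in (X < _)%N]jE ltnn.
rewrite det_mulmx dC -dA => /(mulfI _) <- //.
Qed.

End Desnanot.

(** The matrix minus an indeterminate on its diagonal is nonsingular, since its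
    determinant is a characteristic polynomial up to sign. *)
Lemma desnanot_jacobi (R : idomainType) (f : nat -> nat -> R) k x y :
  minor f k.+2 x y * minor f k x.+1 y.+1 =
  minor f k.+1 x y * minor f k.+1 x.+1 y.+1 -
  minor f k.+1 x y.+1 * minor f k.+1 x.+1 y.
Proof.
pose g i j : {poly R} := (f i j)%:P - (if (i + y == j + x)%N then 'X else 0).
have ev0 l a b : (minor g l a b).[0] = minor f l a b.
  rewrite /minor -horner_evalE -det_map_mx; congr (\det _).
  apply/matrixP => i j; rewrite !mxE /= /horner_eval /g.
  by case: ifP => _; rewrite ?subr0 ?hornerD ?hornerN ?hornerX ?hornerC ?subr0.
have n0 : minor g k.+2 x y != 0.
  pose A := \matrix_(i < k.+2, j < k.+2) f (x + i)%N (y + j)%N.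
  have := monic_neq0 (char_poly_monic A); rewrite /char_poly.
  have -> : char_poly_mx A = - (\matrix_(i < k.+2, j < k.+2) g (x + i)%N (y + j)%N).
    apply/matrixP => i j; rewrite !mxE /g opprB.
    have -> : (x + i + y == y + j + x)%N = (i == j).
      by rewrite -(inj_eq val_inj) /=; lia.
    by case: eqP => _; rewrite ?mulr1n ?mulr0n.
  by rewrite -scaleN1r detZ mulf_eq0 negb_or => /andP[].
by have := dodgson_nonsingular n0 => /(congr1 (horner^~ 0)); rewrite !hornerE !ev0.
Qed.

Section Folded.
Variable R : realFieldType.
Implicit Types (K f u : nat) (h : nat -> R).

(** A vector in the kernel has coordinate sum 0 by column [a], then all its
    coordinates except [r] vanish, hence also the last one. *)
Lemma det_ones_plus_units n (M : 'M[R]_n) (a : 'I_n) (r : 'I_n) :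
    (forall i, M i a = 1) ->
    (forall i, i != r -> exists j, forall i', M i' j = 1 + (i' == i)%:R) ->
  \det M != 0.
Proof.
move=> Ma Mu; apply/negP => /det0P[v v0 vM].
have s0 : \sum_i v 0 i = 0.
  have := congr1 (fun w : 'rV_n => w 0 a) vM; rewrite !mxE => E.
  by rewrite -[RHS]E; apply: eq_bigr => i _; rewrite Ma mulr1.
have vi i : i != r -> v 0 i = 0.
  move=> ir; have [j Mj] := Mu i ir.
  have := congr1 (fun w : 'rV_n => w 0 j) vM; rewrite !mxE.
  under eq_bigr => l _ do rewrite Mj mulrDr mulr1.
  rewrite big_split /= s0 add0r (bigD1 i) //= eqxx mulr1 big1 ?addr0 // => l /negPf ->.
  by rewrite mulr0.
have vr : v 0 r = 0.
  by move: s0; rewrite (bigD1 r) //= big1 ?addr0 // => l /vi.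
case/eqP: v0; apply/rowP => l; rewrite [RHS]mxE.
by have [->|/vi] := eqVneq l r.
Qed.

(** A permuted triangular matrix with nonzero diagonal; [s] is the permutation and [p]
    the order on the rows. *)
Lemma det_triangular_support n (N : 'M[R]_n) (s : 'I_n -> 'I_n) (p : 'I_n -> nat) :
    injective s -> injective p -> (forall j, N (s j) j != 0) ->
    (forall i j, N i j != 0 -> (p (s j) <= p i)%N) ->
  \det N != 0.
Proof.
move=> si ip Ns Np; apply/negP => /det0P[v v0 vN].
have [i0 vi0] : exists i, v 0 i != 0.
  apply/existsP; apply: contraNT v0; rewrite negb_exists => /forallP v0.
  by apply/eqP/rowP => i; rewrite mxE; apply/eqP; have := v0 i; rewrite negbK.
have [i vi imax] := @arg_maxnP _ i0 (fun i => v 0 i != 0) p vi0.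
have [t ts st] := injF_bij si.
have := congr1 (fun w : 'rV_n => w 0 (t i)) vN; rewrite !mxE (bigD1 i) //= big1.
  by rewrite addr0 => /eqP; rewrite mulf_eq0 (negPf vi) -{1}(st i) (negPf (Ns _)).
move=> l li; apply/eqP; rewrite mulf_eq0; apply/norP => -[vl Nl].
have := Np _ _ Nl; rewrite st leq_eqVlt => /orP[/eqP /ip E|].
  by rewrite E eqxx in li.
by rewrite ltnNge; have /= -> := imax l vl.
Qed.

(** The determinant is an affine function of the coefficient of the all-ones
    matrix, up to scaling, and it is nonzero without that matrix. *)
Lemma det_ones_plus_scaled n (N : 'M[R]_n) : \det N != 0 ->
  exists2 t : R, 0 < t & \det (const_mx 1 + t *: N) != 0.
Proof.
move=> dN; have uN : N \in unitmx by rewrite unitmxE unitfE.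
have [w wN] : exists w : 'rV[R]_n, w *m N = const_mx 1.
  by exists (const_mx 1 *m invmx N); rewrite mulmxKV.
have [t t0 tw] : exists2 t : R, 0 < t & t != - \sum_i w 0 i.
  have [e|e] := eqVneq 1 (- \sum_i w 0 i); last by exists 1; rewrite ?ltr01.
  by exists 2; rewrite ?ltr0n // -e -[X in _ != X]/(1%:R) eqr_nat.
exists t => //; apply/negP => /det0P[v v0].
set s := \sum_i v 0 i.
have -> : v *m (const_mx 1 + t *: N) = s *: const_mx 1 + t *: (v *m N).
  rewrite mulmxDr -scalemxAr; congr (_ + _); apply/rowP => j.
  by rewrite !mxE mulr1; apply: eq_bigr => l _; rewrite mxE mulr1.
rewrite -wN !scalemxAl -mulmxDl => E.
have vE : t *: v = - s *: w.
  have : (s *: w + t *: v) *m N *m invmx N = 0 by rewrite E mul0mx.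
  by rewrite mulmxK // addrC scaleNr => /eqP; rewrite addr_eq0 => /eqP.
have sE : t * s = - s * \sum_i w 0 i.
  have := congr1 (fun u : 'rV_n => \sum_i u 0 i) vE.
  by under eq_bigr do rewrite mxE; under [RHS]eq_bigr do rewrite mxE;
    rewrite -!big_distrr.
have s0 : s = 0.
  have /eqP : s * (t + \sum_i w 0 i) = 0 by rewrite mulrDr mulrC sE; ring.
  by rewrite mulf_eq0 addr_eq0 (negPf tw) orbF => /eqP.
move: vE; rewrite s0 oppr0 scale0r => /eqP; rewrite scaler_eq0 (gt_eqF t0) /= => /eqP E0.
by rewrite E0 eqxx in v0.
Qed.

Lemma exists_minor_neq0 k x y : exists2 f : nat -> nat -> R,
  (forall i j, f i j != 0) & minor f k x y != 0.
Proof.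
case: k => [|k]; first by exists (fun _ _ => 1) => [*|]; rewrite ?minor0 oner_neq0.
pose f i j : R := 1 + ((x + j == y + i) && (y < j))%N%:R.
exists f => [i j|].
  by rewrite /f; case: (_ && _); rewrite ?addr0 ?oner_neq0 // -(natrD _ 1 1) pnatr_eq0.
apply: (@det_ones_plus_units _ _ ord0 ord0) => [i|i i0].
  by rewrite mxE /f /= addn0 ltnn andbF addr0.
exists i => i'; rewrite mxE /f; congr (1 + _%:R); congr nat_of_bool.
rewrite -!(inj_eq val_inj) /= in i0 *; apply/idP/idP; lia.
Qed.

(** The matrices met after folding have entries that depend on [i + 2 j] only. *)
Definition fold_minor h K : R := minor (fun i j => h (i + j.*2)%N) K 0 0.

(** The cells of the matrix with label in [U] leave one column empty and contain, for
    every row but one, a column whose only such cell is in that row.  Then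
    [det_ones_plus_units] applies to [h = 1 + U]. *)
Definition near_permutation K (U : pred nat) : Prop :=
  exists a, [/\ (a < K)%N, forall i, (i < K)%N -> ~~ U (i + a.*2)%N &
    exists2 r, (r < K)%N & forall i, (i < K)%N -> i != r ->
      exists2 j, (j < K)%N &
        forall i', (i' < K)%N -> U (i' + j.*2)%N = (i' == i)].

Lemma near_permutation_det K U : near_permutation K U ->
  fold_minor (fun u => 1 + (U u)%:R) K != 0.
Proof.
move=> [a [aK Ua [r rK Ur]]].
apply: (@det_ones_plus_units _ _ (Ordinal aK) (Ordinal rK)) => [i|i ir].
  by rewrite mxE /= !add0n (negPf (Ua _ (ltn_ord i))) addr0.
have [j jK Uj] := Ur i (ltn_ord i) ltac:(by rewrite -(inj_eq val_inj) in ir).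
by exists (Ordinal jK) => i'; rewrite mxE /= !add0n (Uj _ (ltn_ord i')).
Qed.

(** Rotating the matrix by a half turn. *)
Lemma near_permutation_rev K U : near_permutation K U ->
  near_permutation K (fun u => U (3 * K - 3 - u)%N).
Proof.
move=> [a [aK Ua [r rK Ur]]].
exists (K - 1 - a)%N; split; first by lia.
  move=> i iK; have := Ua (K - 1 - i)%N ltac:(lia).
  by congr (~~ U _); lia.
exists (K - 1 - r)%N; first by lia.
move=> i iK ir; have [j jK Uj] := Ur (K - 1 - i)%N ltac:(lia) ltac:(lia).
exists (K - 1 - j)%N; first by lia.
move=> i' iK'; have := Uj (K - 1 - i')%N ltac:(lia).
have -> : (K - 1 - i' + j.*2 = 3 * K - 3 - (i' + (K - 1 - j).*2))%N by lia.
by move=> ->; lia.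
Qed.

(** Three labels outside the strip suffice: one just above it, and two below it whose
    distance [k1] is about [K].  The four cases for the parities of [f] and [K]
    only differ by the constants [d1], [k1], [d2] (the labels), [a] (the empty
    column) and [c], [x1] (the exceptional row). *)
Lemma one_strip_low K f : (2 <= K)%N -> (f <= 2 * K - 3)%N ->
    ((if odd f then uphalf K else K./2) <= uphalf f)%N ->
  exists2 U : pred nat, near_permutation K U &
    forall u, (f <= u <= f + K)%N -> ~~ U u.
Proof.
suff H a k d1 k1 d2 c x1 : (2 <= K)%N -> (x1 <= a < K)%N ->
    [\/ [/\ f.+1 = a.*2, K = k.*2, [/\ d1 = 1, k1 = K.-1 & d2 = 2]%N & c = 1%N /\ x1 = k],
        [/\ f.+1 = a.*2, K = k.*2.+1, [/\ d1 = 1, k1 = K & d2 = 1]%N & c = 1%N /\ x1 = k.+1],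
        [/\ f = a.*2, K = k.*2, [/\ d1 = 2, k1 = K.-1 & d2 = 1]%N & c = 1%N /\ x1 = k] |
        [/\ f = a.*2, K = k.*2.+1, [/\ d1 = 1, k1 = K & d2 = 1]%N & c = 0%N /\ x1 = k]] ->
    exists2 U : pred nat, near_permutation K U &
      forall u, (f <= u <= f + K)%N -> ~~ U u.
  move=> K2 fK hlow.
  have [of_|of_] := boolP (odd f); have [oK|oK] := boolP (odd K);
    rewrite ?of_ ?(negPf of_) in hlow.
  - apply: (H (uphalf f) K./2 1%N K 1%N 1%N (K./2).+1) => //; first lia.
    by constructor 2; split; [lia | lia | split | split].
  - apply: (H (uphalf f) K./2 1%N K.-1 2 1%N K./2) => //; first lia.
    by constructor 1; split; [lia | lia | split | split].
  - apply: (H (uphalf f) K./2 1%N K 1%N 0%N K./2) => //; first lia.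
    by constructor 4; split; [lia | lia | split | split].
  - apply: (H (uphalf f) K./2 2 K.-1 1%N 1%N K./2) => //; first lia.
    by constructor 3; split; [lia | lia | split | split].
move=> K2 hx hyp.
pose U u := [|| (u + d1 == f)%N, (u + d1 + k1 == f)%N | (u == f + K + d2)%N].
have UE u : U u = [|| (u + d1 == f)%N, (u + d1 + k1 == f)%N | (u == f + K + d2)%N] by [].
exists U; last first.
  by move=> u hu; rewrite UE; case: hyp => -[? ? [? ? ?] [? ?]]; lia.
exists a; split; first by lia.
  by move=> i iK; rewrite UE; case: hyp => -[? ? [? ? ?] [? ?]]; lia.
exists (c + (a - x1).*2)%N.
  by case: hyp => -[? ? [? ? ?] [? ?]]; lia.
move=> i iK ir.
have c1 : (c <= 1)%N by clear -hyp; case: hyp => -[_ _ _ [-> _]].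
have [p Ep] : exists p, i = (1 - c + p.*2)%N \/ i = (c + p.*2)%N.
  by exists ((i - (odd i))./2)%N; clear -c1; lia.
case: Ep => Ep.
  exists (a - p.+1)%N => [|i' iK']; first by clear -hx; lia.
  rewrite UE; apply/idP/idP => [|/eqP->]; clear ir; case: hyp => -[hf hK [e1 e2 e3] [ec ex]];
    clear U UE; subst d1 k1 d2 c x1 K i; clear -hf hx iK iK'; lia.
have [il|il] := ltnP i (c + (a - x1).*2).
  exists (a - (x1 + 1 + p))%N => [|i' iK']; first by clear -hx; lia.
  rewrite UE; apply/idP/idP => [|/eqP->]; clear ir; case: hyp => -[hf hK [e1 e2 e3] [ec ex]];
    clear U UE; subst d1 k1 d2 c x1 K i; clear -hf hx iK iK' il; lia.
exists (a + (k - p - c).+1)%N => [|i' iK'].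
  case: hyp => -[hf hK [e1 e2 e3] [ec ex]];
    clear U UE; subst d1 k1 d2 c x1 K i; clear -hf hx iK il ir; lia.
rewrite UE; apply/idP/idP => [|/eqP->]; case: hyp => -[hf hK [e1 e2 e3] [ec ex]];
  clear U UE; subst d1 k1 d2 c x1 K i; clear -hf hx iK iK' il ir; lia.
Qed.

Lemma one_strip K f : (2 <= K)%N -> (f <= 2 * K - 3)%N ->
  exists2 U : pred nat, near_permutation K U &
    forall u, (f <= u <= f + K)%N -> ~~ U u.
Proof.
move=> K2 fK.
have [h|h] := leqP (if odd f then uphalf K else K./2) (uphalf f).
  exact: one_strip_low.
have fK' : (2 * K - 3 - f <= 2 * K - 3)%N by lia.
have h' : ((if odd (2 * K - 3 - f) then uphalf K else K./2) <= uphalf (2 * K - 3 - f))%N.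
  move: h; have [of_|of_] := boolP (odd f); have [of'|of'] := boolP (odd (2 * K - 3 - f));
    by rewrite ?of_ ?of'; lia.
have [U nU Uf] := one_strip_low K2 fK' h'.
exists (fun u => U (3 * K - 3 - u)%N); first exact: near_permutation_rev.
by move=> u hu; apply: Uf; lia.
Qed.

Definition end_label K := (2 * K - 2 + odd K)%N.

(** The support of a permuted triangular matrix which is constant in steps of 2 near
    both ends, and hence leaves the relations at the sites near the ends
    intact. *)
Definition two_ended K u : bool :=
  (u <= K.-1)%N && (odd u == odd K.-1) ||
  (end_label K <= u)%N && (odd u == odd (end_label K)).

Lemma two_ended_det K : (2 <= K)%N ->
  exists2 t : R, 0 < t & fold_minor (fun u => 1 + t * (two_ended K u)%:R) K != 0.
Proof.
move=> K2; case: K K2 => // K K2.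
pose N : 'M[R]_K.+1 := \matrix_(i, j) (two_ended K.+1 (i + j.*2))%:R.
pose sn (j : nat) := if (j.*2 <= K)%N then (K - j.*2)%N else (end_label K.+1 - j.*2)%N.
have snK (j : 'I_K.+1) : (sn j < K.+1)%N.
  by rewrite /sn /end_label; have := ltn_ord j; case: ifP => h; lia.
pose s j := Ordinal (snK j).
pose p (i : 'I_K.+1) := if odd i == odd K then (K - i)%N else (K + i.+1)%N.
have [|t t0 dt] := @det_ones_plus_scaled _ N.
  apply: (@det_triangular_support _ _ s p).
  - move=> j j' /(congr1 val) /= E; apply: val_inj => /=.
    move: E (ltn_ord j) (ltn_ord j'); rewrite /sn /end_label.
    by case: ifP => h; case: ifP => h'; lia.
  - move=> i i' E; apply: val_inj; move: E (ltn_ord i) (ltn_ord i'); rewrite /p.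
    by rewrite /=; do 2?case: eqP => ?; lia.
  - move=> j; rewrite mxE pnatr_eq0 eqb0 negbK /two_ended /= /sn /end_label.
    by have := ltn_ord j; case: ifP => h; lia.
  - have ho : odd (end_label K.+1) = ~~ odd K by rewrite /end_label; lia.
    move=> i j; rewrite mxE pnatr_eq0 eqb0 negbK /two_ended oddD odd_double addbF ho /=.
    have iK := ltn_ord i; case/orP=> /andP[hu /eqP hodd].
      have jK : (j.*2 <= K)%N by lia.
      have sE : s j = (K - j.*2)%N :> nat by rewrite /= /sn jK.
      have so : odd (s j) = odd K by rewrite sE; lia.
      by rewrite /p so hodd eqxx sE; lia.
    rewrite /end_label in hu.
    have jK : (j.*2 <= K)%N = false by lia.
    have sE : s j = (end_label K.+1 - j.*2)%N :> nat by rewrite /= /sn jK.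
    have so : odd (s j) = ~~ odd K.
      by rewrite sE; have := ltn_ord j; rewrite /end_label; lia.
    rewrite /p so hodd sE /end_label; clear -hu iK jK; move: hu jK iK.
    by move: (i : nat) (j : nat) => i' j'; case: (odd K) => /=; lia.
exists t => //; rewrite /fold_minor /minor; congr (\det _ != 0): dt.
by apply/matrixP => i j; rewrite !mxE !add0n.
Qed.

Lemma two_ended_periodic K u : (2 <= K)%N ->
  (u + 2 < K)%N || (end_label K <= u)%N -> two_ended K (u + 2) = two_ended K u.
Proof.
move=> K2; rewrite /two_ended oddD addbF.
have EK : (K <= end_label K)%N by rewrite /end_label; clear -K2; lia.
move: (end_label K) (odd u == _) EK => E b EK /orP[h|h].
  have -> : (u + 2 <= K.-1)%N by clear -h; lia.
  have -> : (u <= K.-1)%N by clear -h; lia.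
  by rewrite !(leqNgt E) (leq_trans h EK) (leq_trans _ (leq_trans h EK)) // ltnS leq_addr.
have -> : (u + 2 <= K.-1)%N = false by clear -h EK K2; lia.
have -> : (u <= K.-1)%N = false by clear -h EK K2; lia.
by rewrite h (leq_trans h) ?leq_addr.
Qed.

(** Here [Z] holds the sites at which [h] must satisfy the relation that makes the
    second layer vanish.  In the first case [h] is constant on the strip that
    contains them, in the second case it is 2-periodic near both ends. *)
Lemma fold_minor_generic K (Z : pred nat) : (2 <= K)%N ->
    (exists2 f, (f <= 2 * K - 3)%N &
       forall u, Z u -> (u + 6 <= 3 * K)%N -> (f <= u)%N && (u + 3 <= f + K)%N) \/
    (forall u, Z u -> (u + 6 <= 3 * K)%N -> (u + 3 < K)%N || (end_label K <= u)%N) ->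
  exists h, [/\ forall u, h u != 0, fold_minor h K != 0 &
    forall u, Z u -> (u + 6 <= 3 * K)%N -> h u * h (u + 3)%N = h (u + 1)%N * h (u + 2)%N].
Proof.
move=> K2 [[f fK Zf]|Zf].
  have [U nU Uf] := one_strip K2 fK.
  exists (fun u => 1 + (U u)%:R); split.
  - by move=> u; case: (U u); rewrite ?addr0 ?oner_neq0 // -(natrD _ 1 1) pnatr_eq0.
  - exact: near_permutation_det.
  - move=> u Zu uK; have /andP[h1 h2] := Zf u Zu uK.
    by rewrite !(negPf (Uf _ _)) //; lia.
have [t t0 dt] := two_ended_det K2.
exists (fun u => 1 + t * (two_ended K u)%:R); split=> // [u|u Zu uK].
  by apply/lt0r_neq0/ltr_wpDr; rewrite ?mulr_ge0 ?ltr01 ?ler0n ?(ltW t0).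
have hz := Zf u Zu uK.
have E1 : two_ended K (u + 2) = two_ended K u.
  by apply: two_ended_periodic => //; move: hz; clear; lia.
have E2 : two_ended K (u + 3) = two_ended K (u + 1).
  rewrite -[(u + 3)%N]/(u + (1 + 2))%N addnA.
  by apply: two_ended_periodic => //; move: hz; clear; lia.
by rewrite E1 E2 mulrC.
Qed.

End Folded.

(** * Folding condensation along labels *)

Section Folding.
Variable R : realFieldType.
Variables (e : nat -> lexpr R site) (K : nat).
Hypothesis ce : condensation e K.
Implicit Types (D : site -> R) (X T : nat -> R) (k q u y : nat).

Lemma lau_minor k x y : lau (fun D : site -> R => minor (fun i j => D (true, (i, j))) k x y).
Proof.
rewrite /minor /determinant; apply: lau_sum => s.
apply: lauM; first exact: lau_cst.
have lp : lau (fun D : site -> R => \prod_(i <- index_enum 'I_k) D (true, ((x + i)%N, (y + s i)%N))).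
  by apply: lau_prod => i; apply: lau_var.
by apply: eq_lau lp => D _; apply: eq_bigr => i _; rewrite mxE.
Qed.

(** Contiguous minors satisfy the recurrence and have the same first two layers. *)
Lemma Pv_minor k D x y : nz D -> (forall v, D (false, v) = 1) -> (k <= K)%N ->
  Pv e k D x y = minor (fun i j => D (true, (i, j))) k x y.
Proof.
move=> nD D1; have [e0 e1 erec] := ce.
pose one D (v : site) : R := if v.1 then D v else 1.
have n1 D' : nz D' -> nz (one D').
  by move=> nD' v; rewrite /one; case: v.1; rewrite ?oner_neq0.
suff H k' : ((k' <= K)%N -> forall D x y, nz D ->
      Pv e k' (one D) x y = minor (fun i j => D (true, (i, j))) k' x y) /\
    ((k'.+1 <= K)%N -> forall D x y, nz D ->
      Pv e k'.+1 (one D) x y = minor (fun i j => D (true, (i, j))) k'.+1 x y).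
  move=> kK; have [H0 _] := H k; rewrite -H0 //.
  by apply: eq_ev => -[[] v] _; rewrite /shift /one.
elim: k' => [|k' [IH0 IH1]].
  split=> _ D' x' y' nD'; first by rewrite e0 ?minor0 //; apply: n1.
  by rewrite e1 ?minor1 //; apply: n1.
split=> // kK D' x' y' nD'; apply/eqP; rewrite -subr_eq0; apply/eqP.
pose F D := Pv e k'.+2 (one D) x' y' - minor (fun i j => D (true, (i, j))) k'.+2 x' y'.
suff: forall D, nz D -> F D = 0 by apply.
have lF : lau F.
  apply: lauB; last exact: lau_minor.
  apply: (lau_comp (s := fun v D => one D v) (lau_Pv e k'.+2 x' y')) => -[b v].
  by rewrite /one; case: b => /=; [apply: ulau_var | apply: ulau_cst; apply: oner_neq0].
apply: (lau_eq0_dense lF (lau_minor k' x'.+1 y'.+1)).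
  have [f f0 mf] := exists_minor_neq0 R k' x'.+1 y'.+1.
  exists (fun v : site => f v.2.1 v.2.2) => // v; exact: f0.
move=> D2 nD2 m0; apply: (mulIf m0); rewrite mul0r /F mulrBl desnanot_jacobi.
rewrite -!IH1 ?(ltnW kK) // -IH0 ?(ltnW (ltnW kK)) //.
by rewrite [X in X - _](erec k' kK _ (n1 _ nD2) x' y') subrr.
Qed.

(** The data read off a sequence of labels: the place [(i, j)] of layer [k] carries
    the label [q + 3 k + 2 i + 4 j]. *)
Definition fold T q : site -> R := fun v => T (q + 3 * v.1 + (v.2.1 + v.2.2.*2).*2)%N.

(** The value of layer [k] at the label [y], whose window of data starts at
    [y - 3 k]. *)
Definition tau T k y : R := Pv e k (fold T (y - 3 * k)) 0 0.

Lemma Pv_fold T k q x y : Pv e k (fold T q) x y = tau T k (q + (x + y.*2).*2 + 3 * k).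
Proof.
rewrite /tau addnK; apply: eq_ev => -[b [i j]] _.
by rewrite /shift /fold /=; congr T; case: b => /=; lia.
Qed.

Section Tau.
Variable T : nat -> R.
Hypothesis T0 : forall u, T u != 0.

Lemma nz_fold q : nz (fold T q). Proof. by move=> v; apply: T0. Qed.

Lemma tau0 y : tau T 0 y = T y.
Proof. by have [e0 _ _] := ce; rewrite /tau e0 /fold /= ?muln0 ?subn0 ?addn0 //; apply: nz_fold. Qed.

Lemma tau1 y : (3 <= y)%N -> tau T 1 y = T y.
Proof.
have [_ e1 _] := ce; move=> y3; rewrite /tau e1; last exact: nz_fold.
by rewrite /fold /=; congr T; lia.
Qed.

Lemma tau_rec k y : (k.+2 <= K)%N -> (3 * k + 6 <= y)%N ->
  tau T k.+2 y * tau T k y =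
  tau T k.+1 (y - 3) * tau T k.+1 (y + 3) - tau T k.+1 (y - 1) * tau T k.+1 (y + 1).
Proof.
move=> kK hy; have [_ _ erec] := ce.
have := erec k kK _ (nz_fold (y - 3 * k - 6)) 0 0.
rewrite /dodgson !Pv_fold.
set q := (y - 3 * k - 6)%N.
have -> : (q + (0 + 0.*2).*2 + 3 * k.+2 = y)%N by lia.
have -> : (q + (1 + 1.*2).*2 + 3 * k = y)%N by lia.
have -> : (q + (0 + 0.*2).*2 + 3 * k.+1 = y - 3)%N by lia.
have -> : (q + (1 + 1.*2).*2 + 3 * k.+1 = y + 3)%N by lia.
have -> : (q + (0 + 1.*2).*2 + 3 * k.+1 = y + 1)%N by lia.
have -> : (q + (1 + 0.*2).*2 + 3 * k.+1 = y - 1)%N by lia.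
by move=> ->; rewrite [X in _ - X]mulrC.
Qed.

Lemma tau2_eq0 y : (2 <= K)%N -> (6 <= y)%N ->
  T (y - 3) * T (y + 3) = T (y - 1) * T (y + 1) -> tau T 2 y = 0.
Proof.
move=> K2 y6 E; have := @tau_rec 0 y K2 y6.
rewrite tau0 !tau1; try lia.
by rewrite E subrr => /eqP; rewrite mulf_eq0 (negPf (T0 y)) orbF => /eqP.
Qed.

End Tau.

Definition growth X u : R := \prod_(0 <= t < u) X (t + 3)%N.
(** The potential is determined up to gauge by [potential_coord]; this solution has
    the ratio [growth X u] over four labels, and is a product of coordinates, so
    a unit among Laurent functions of [X]. *)
Definition potential X u : R := \prod_(0 <= k < u %/ 4) growth X (u %% 4 + 4 * k).

Lemma growthS X u : growth X u.+1 = growth X u * X (u + 3)%N.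
Proof. by rewrite /growth big_nat_recr. Qed.

Lemma potential4 X u : potential X (u + 4) = potential X u * growth X u.
Proof.
rewrite /potential.
have -> : ((u + 4) %/ 4 = (u %/ 4).+1)%N by lia.
have -> : ((u + 4) %% 4 = u %% 4)%N by lia.
rewrite big_nat_recr //=; congr (_ * growth X _); lia.
Qed.

Lemma growth_neq0 X u : (forall y, X y != 0) -> growth X u != 0.
Proof. by move=> X0; rewrite prodf_seq_neq0; apply/allP => t _; apply: X0. Qed.

Lemma potential_neq0 X u : (forall y, X y != 0) -> potential X u != 0.
Proof. by move=> X0; rewrite prodf_seq_neq0; apply/allP => t _; apply: growth_neq0. Qed.

Lemma potential_coord X y : (3 <= y)%N ->
  potential X (y + 2) * potential X (y - 3) =
  X y * (potential X (y - 2) * potential X (y + 1)).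
Proof.
move=> y3; have -> : (y + 2 = y - 2 + 4)%N by lia.
have -> : (y + 1 = y - 3 + 4)%N by lia.
rewrite !potential4 (_ : y - 2 = (y - 3).+1)%N; last lia.
by rewrite growthS subnK //; ring.
Qed.

(** Extends row factors of the layers 0 and 1 to a gauge factor. *)
Fixpoint spread (r0 r1 : nat -> R) k : (nat -> R) * (nat -> R) :=
  if k is k'.+1 then
    let: (a, b) := spread r0 r1 k' in (b, fun i => b i * b i.+1 / a i.+1)
  else (r0, r1).

Lemma spread_gauge_factor r0 r1 : (forall i, r0 i != 0) -> (forall i, r1 i != 0) ->
  gauge_factor (fun k i => (spread r0 r1 k).1 i).
Proof.
move=> n0 n1.
have S k : (forall i, (spread r0 r1 k).1 i != 0) /\ (forall i, (spread r0 r1 k).2 i != 0).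
  elim: k => //= k; case: (spread r0 r1 k) => a b /= [na nb]; split=> // i.
  by rewrite !mulf_neq0 ?invr_eq0.
split=> k i; first by case: (S k).
have [] := S k; rewrite /=; case: (spread r0 r1 k) => a b /= na nb.
by rewrite mulfVK.
Qed.

Section Nonvanishing.
Variables (N k q : nat) (Z : pred nat).
Hypotheses (kK : (2 <= k <= K)%N) (N0 : (0 < N)%N) (Neven : ~~ odd N)
  (Nk : (6 * k <= N + 10)%N)
  (Zper : forall y, Z (y + N)%N = Z y) (Zodd : forall y, Z y -> odd y = odd q).

(* the representative of y modulo N in the period starting at q + 6 *)
Let rep y := (q + 6 + ((y + (q + 6) * (N - 1)) %% N))%N.

Let repE y : exists c, (rep y + c * N = y + (q + 6) * N)%N.
Proof.
exists ((y + (q + 6) * (N - 1)) %/ N)%N; rewrite /rep.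
have := divn_eq (y + (q + 6) * (N - 1)) N.
have : ((q + 6) * (N - 1) + (q + 6) = (q + 6) * N)%N by case: N N0 => // N' _; nia.
by move: (_ * (N - 1))%N (_ %/ N * N)%N (_ %% N)%N => a b c; lia.
Qed.

Let Zrep y : Z (rep y) = Z y.
Proof.
have [c E] := repE y.
have Zc z n : Z (z + n * N)%N = Z z.
  elim: n => [|n IH]; first by rewrite addn0.
  by rewrite mulSn [(N + _)%N]addnC addnA Zper.
by rewrite -(Zc (rep y) c) E Zc.
Qed.

(** [N]-periodic coordinates [X] are built from the matrix of [fold_minor_generic].
    Over the window of [tau k (q + 3 k)] they come from the potential [T], equal
    to 1 on layer 0 and to [h] on layer 1, and they are 1 elsewhere in the period.
    The potential of [X] differs from [T] on this window by a function that is
    geometric in steps of 4, hence by a gauge. *)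
Lemma tau_nonvanishing :
    (exists2 f, (f <= 2 * k - 3)%N & forall u, Z (q + 6 + u.*2)%N -> (u + 6 <= 3 * k)%N ->
       (f <= u)%N && (u + 3 <= f + k)%N) \/
    (forall u, Z (q + 6 + u.*2)%N -> (u + 6 <= 3 * k)%N ->
       (u + 3 < k)%N || (end_label k <= u)%N) ->
  exists X, [/\ forall y, X y != 0, forall y, X (y + N)%N = X y,
    forall y, Z y -> X y * X y.+1 = 1 & tau (potential X) k (q + 3 * k) != 0].
Proof.
have [k2 kK'] := andP kK.
move=> /(@fold_minor_generic R k (fun u => Z (q + 6 + u.*2)%N) k2) [h [h0 mh hZ]].
pose T y := if (q + 3 <= y)%N && ~~ odd (y - (q + 3)) then h ((y - (q + 3))./2) else 1.
have T0 y : T y != 0 by rewrite /T; case: ifP => _; rewrite ?oner_neq0.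
have Th u : T (q + 3 + u.*2)%N = h u.
  by rewrite /T leq_addr /= addKn odd_double doubleK.
have T1 u : T (q + u.*2)%N = 1.
  by rewrite /T; case: ifP => // /andP[h1 h2]; exfalso; lia.
pose Xs y := T (y + 2)%N * T (y - 3)%N / (T (y - 2)%N * T (y + 1)%N).
have Xs0 y : Xs y != 0 by rewrite !mulf_neq0 ?invr_eq0 ?mulf_neq0.
pose X y := if (rep y + 5 <= q + 6 * k)%N then Xs (rep y) else 1.
have X0 y : X y != 0 by rewrite /X; case: ifP => _; rewrite ?oner_neq0.
have XN y : X (y + N)%N = X y.
  have E : rep (y + N) = rep y by rewrite /rep (addnAC y) modnDr.
  by rewrite /X E.
have repN y : (rep y < q + 6 + N)%N by rewrite /rep ltn_add2l ltn_pmod.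
have rep_id y : (q + 6 <= y < q + 6 + N)%N -> rep y = y.
  move=> hy; have [c E] := repE y; have := repN y.
  have h1 : (q + 6 <= rep y)%N by rewrite /rep leq_addr.
  move=> h2; suff cE : c = (q + 6)%N by move: E; rewrite cE; lia.
  have [] : (c * N < (q + 6).+1 * N)%N /\ ((q + 6) * N < c.+1 * N)%N by rewrite !mulSn; lia.
  by rewrite !ltn_pmul2r //; lia.
have XS y : (q + 6 <= y)%N -> (y + 5 <= q + 6 * k)%N -> X y = Xs y.
  by move=> h1 h2; rewrite /X rep_id ?h2 //; lia.
have pX w : (q + 6 <= w)%N -> (w + 6 <= q + 6 * k)%N ->
    Xs w * Xs w.+1 = T (w - 3)%N * T (w + 3)%N / (T (w - 1)%N * T (w + 1)%N).
  move=> h1 h2; rewrite /Xs.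
  have -> : (w.+1 - 3 = w - 2)%N by lia.
  have -> : (w.+1 - 2 = w - 1)%N by lia.
  have -> : (w.+1 + 2 = w + 3)%N by lia.
  have -> : (w.+1 + 1 = w + 2)%N by lia.
  have := T0 (w + 2)%N; have := T0 (w - 2)%N; have := T0 (w + 1)%N; have := T0 (w - 1)%N.
  by move=> ? ? ? ?; field; do !(apply/andP; split).
exists X; split=> // [y Zy|].
  have Zr : Z (rep y) by rewrite Zrep.
  have or := Zodd Zr; have := repN y; have q6 : (q + 6 <= rep y)%N by rewrite /rep leq_addr.
  move=> hN; have repS : (rep y).+1 != (q + 6 + N)%N.
    by apply/eqP => hh; move: or Neven; lia.
  have rS : rep y.+1 = (rep y).+1.
    have [c E] := repE y; have [c' E'] := repE y.+1.
    have h1 := repN y.+1; have h2 : (q + 6 <= rep y.+1)%N by rewrite /rep leq_addr.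
    suff cc : c = c' by move: E E'; rewrite cc; lia.
    have [] : (c * N < c'.+1 * N)%N /\ (c' * N < c.+1 * N)%N by rewrite !mulSn; lia.
    by rewrite !ltn_pmul2r //; lia.
  rewrite /X rS; have [hw|hw] := leqP (rep y + 5) (q + 6 * k); last first.
    by rewrite ifF ?mulr1 //; lia.
  have hw6 : (rep y + 6 <= q + 6 * k)%N.
    by move: hw; rewrite leq_eqVlt => /orP[/eqP hh|]; lia.
  rewrite ifT; last by lia.
  rewrite pX //; set u := ((rep y - (q + 6))./2)%N.
  have yu : rep y = (q + 6 + u.*2)%N by rewrite /u; lia.
  have -> : (rep y - 3 = q + 3 + u.*2)%N by lia.
  have -> : (rep y + 3 = q + 3 + (u + 3).*2)%N by lia.
  have -> : (rep y - 1 = q + 3 + (u + 1).*2)%N by lia.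
  have -> : (rep y + 1 = q + 3 + (u + 2).*2)%N by lia.
  by rewrite !Th hZ ?divff ?mulf_neq0 //; [rewrite -yu | lia].
pose P := potential X.
have P0 y : P y != 0 by apply: potential_neq0.
(* the two potentials differ by a function that is geometric in steps of 4 *)
pose th y := P y / T y.
have th0 y : th y != 0 by rewrite mulf_neq0 ?invr_eq0.
pose kap := th (q + 7)%N / th (q + 3)%N.
have kap0 : kap != 0 by rewrite mulf_neq0 ?invr_eq0.
have step v : (q + 3 <= v)%N -> (v + 7 <= q + 6 * k)%N -> th (v + 4)%N = kap * th v.
  move=> qv; rewrite -(subnKC qv); elim: (v - (q + 3))%N => [|w IH] hw.
    by rewrite addn0 /kap mulfVK //; congr th; lia.
  have {IH} := IH ltac:(lia); set z := (q + 3 + w)%N => IH.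
  have -> : (q + 3 + w.+1 = z + 1)%N by rewrite /z; lia.
  have -> : (z + 1 + 4 = z + 5)%N by lia.
  have := @potential_coord X (z + 3) ltac:(lia).
  rewrite XS; [|rewrite /z; lia|rewrite /z; lia]; rewrite /Xs -/P.
  have -> : (z + 3 + 2 = z + 5)%N by lia.
  have -> : (z + 3 - 3 = z)%N by lia.
  have -> : (z + 3 - 2 = z + 1)%N by lia.
  have -> : (z + 3 + 1 = z + 4)%N by lia.
  move=> E; move: IH; rewrite /th => IH.
  have Pz4 : P (z + 4)%N = kap * (P z / T z) * T (z + 4)%N by rewrite -IH mulfVK.
  rewrite Pz4 in E; apply: (mulIf (P0 z)); rewrite mulrAC E.
  have := T0 (z + 5)%N; have := T0 (z + 4)%N; have := T0 (z + 1)%N; have := T0 z.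
  by move=> ? ? ? ?; field; do !(apply/andP; split).
have steps v j : (q + 3 <= v)%N -> (v + 3 + 4 * j <= q + 6 * k)%N ->
    th (v + 4 * j)%N = kap ^+ j * th v.
  move=> qv; elim: j => [|j IH] hj; first by rewrite muln0 addn0 expr0 mul1r.
  by rewrite mulnS [(4 + _)%N]addnC addnA step ?IH ?exprS ?mulrA //; lia.
(* such a function is a product of a row and a column gauge *)
pose r := fun l i => (spread (fun i => th (q + i.*2 + 4)%N / kap) (fun i => th (q + 3 + i.*2)%N) l).1 i.
have mr : gauge_factor r.
  by apply: spread_gauge_factor => i; rewrite ?mulf_neq0 ?invr_eq0.
have mc : gauge_factor (fun _ j => kap ^+ j).
  by split=> l i; rewrite ?expf_neq0.
rewrite /tau addnK -/P.
have nT : nz (fold T q) by apply: nz_fold.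
have nP : nz (fold P q) by apply: nz_fold.
rewrite (Pv_local ce nP (nz_gauge mr mc nT)); first last.
- move=> [b [i j]] /and3P[/= ik jk ij]; rewrite /gauge /fold /=.
  have thE y : P y = th y * T y by rewrite /th mulfVK.
  case: b ij => /= ij.
    rewrite thE; congr (_ * _); rewrite mulrC -steps; try lia.
    by congr th; lia.
  case: j jk ij => [|j] jk; first by rewrite andbF.
  rewrite andbT => i0; rewrite thE; congr (_ * _).
  rewrite exprS mulrA mulfVK // mulrC -steps; try lia.
  by congr th; lia.
- by lia.
rewrite (Pv_gauge ce) //; apply: mulf_neq0.
  by rewrite expr0 mulr1; case: mr => nr _; apply: nr.
rewrite Pv_minor // => [|[i j]].
  suff -> : minor (fun i j => fold T q (true, (i, j))) k 0 0 = fold_minor h k by [].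
  rewrite /fold_minor /minor; congr (\det _); apply/matrixP => i j.
  by rewrite !mxE /fold /= -Th; congr T; lia.
rewrite /fold /= muln0 addn0; exact: T1.
Qed.

End Nonvanishing.
End Folding.

(** * Brackets of plane vectors *)

Section Brackets.
Variable R : realType.
Implicit Types u v w a b c d : 'rV[R]_3.

Definition bracket u v w : R := dot (cross u v) w.

Let i0 : 'I_3 := 0.
Let i1 : 'I_3 := 1.
Let i2 : 'I_3 := 2%:R.

Lemma cross_coord u v :
  (cross u v 0 i0 = u 0 i1 * v 0 i2 - u 0 i2 * v 0 i1) *
  (cross u v 0 i1 = u 0 i2 * v 0 i0 - u 0 i0 * v 0 i2) *
  (cross u v 0 i2 = u 0 i0 * v 0 i1 - u 0 i1 * v 0 i0).
Proof.
have e : (i0 + 1 = i1) * (i0 + 2%:R = i2) * (i1 + 1 = i2) * (i1 + 2%:R = i0) *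
         (i2 + 1 = i0) * (i2 + 2%:R = i1) by do !split; apply: val_inj.
by rewrite !mxE !e.
Qed.

Lemma dot_coord u v : dot u v = u 0 i0 * v 0 i0 + u 0 i1 * v 0 i1 + u 0 i2 * v 0 i2.
Proof.
rewrite /dot mxE !big_ord_recl big_ord0 addr0 !mxE addrA.
by congr (_ + _ + _); congr (u 0 _ * v 0 _); apply: val_inj.
Qed.

Lemma row3P u v : u 0 i0 = v 0 i0 -> u 0 i1 = v 0 i1 -> u 0 i2 = v 0 i2 -> u = v.
Proof.
move=> e0 e1 e2; apply/rowP => -[[|[|[|//]]] hi].
- by rewrite (_ : Ordinal hi = i0) //; apply: val_inj.
- by rewrite (_ : Ordinal hi = i1) //; apply: val_inj.
- by rewrite (_ : Ordinal hi = i2) //; apply: val_inj.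
Qed.

Lemma comb_coord (x y : R) a b i : (x *: b - y *: a) 0 i = x * b 0 i - y * a 0 i.
Proof. by rewrite !mxE. Qed.

Lemma meet_line a b c d :
  meet (line a b) (line c d) = bracket a c d *: b - bracket b c d *: a.
Proof.
by apply: row3P; rewrite comb_coord /meet /line /bracket !dot_coord !cross_coord; ring.
Qed.

Lemma meet_line_r a b c d :
  meet (line a b) (line c d) = bracket a b d *: c - bracket a b c *: d.
Proof.
by apply: row3P; rewrite comb_coord /meet /line /bracket !dot_coord !cross_coord; ring.
Qed.

Lemma bracketE u v w : bracket u v w =
  u 0 i0 * (v 0 i1 * w 0 i2 - v 0 i2 * w 0 i1) -
  u 0 i1 * (v 0 i0 * w 0 i2 - v 0 i2 * w 0 i0) +
  u 0 i2 * (v 0 i0 * w 0 i1 - v 0 i1 * w 0 i0).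
Proof. by rewrite /bracket dot_coord !cross_coord; ring. Qed.

Lemma bracketC u v w : bracket v u w = - bracket u v w.
Proof. by rewrite !bracketE; ring. Qed.

Lemma bracket_rot u v w : bracket v w u = bracket u v w.
Proof. by rewrite !bracketE; ring. Qed.

Lemma bracket_scale x y z u v w :
  bracket (x *: u) (y *: v) (z *: w) = x * y * z * bracket u v w.
Proof. by rewrite !bracketE !mxE; ring. Qed.

Lemma mulmx_coord u (M : 'M[R]_3) j :
  (u *m M) 0 j = u 0 i0 * M i0 j + u 0 i1 * M i1 j + u 0 i2 * M i2 j.
Proof.
rewrite mxE !big_ord_recl big_ord0 addr0 addrA.
by congr (_ + _ + _); congr (u 0 _ * M _ j); apply: val_inj.
Qed.

Definition volume (M : 'M[R]_3) := bracket (row i0 M) (row i1 M) (row i2 M).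

Lemma bracket_mulmx u v w (M : 'M[R]_3) :
  bracket (u *m M) (v *m M) (w *m M) = volume M * bracket u v w.
Proof. by rewrite /volume !bracketE !mulmx_coord !mxE; ring. Qed.

Lemma volume1 : volume 1%:M = 1.
Proof. by rewrite /volume bracketE !mxE /= !mulr1n !mulr0n; ring. Qed.

Lemma volume_unit M : M \in unitmx -> volume M != 0.
Proof.
move=> uM; have := bracket_mulmx (row i0 M) (row i1 M) (row i2 M) (invmx M).
rewrite -!row_mul mulmxV // -/(volume _) volume1 -/(volume M) => /esym E.
by apply: contraTneq (oner_neq0 R) => M0; rewrite negbK -E M0 mulr0.
Qed.


(** All four points lie on the line through [a] and [b]; in the basis [a], [b] the
    cross ratio is a ratio of 2 x 2 determinants. *)
Lemma chi_pencil (a b : 'rV[R]_3) (x1 x2 y1 y2 : R) (z : 'rV[R]_3) :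
  bracket a b z != 0 -> x2 != 0 -> y1 != 0 ->
  chi a b (x2 *: b - x1 *: a) (y2 *: b - y1 *: a) = (x2 * y1 - x1 * y2) / (x2 * y1).
Proof.
move=> abz x2N y1N.
have N0 : dot (cross a b) (cross a b) != 0.
  apply: contraNneq abz; rewrite dot_coord => /eqP.
  have sq (r : R) : 0 <= r * r by rewrite -expr2 sqr_ge0.
  rewrite paddr_eq0 ?addr_ge0 // paddr_eq0 // !mulf_eq0 !orbb.
  move=> /andP[/andP[/eqP e0 /eqP e1] /eqP e2].
  by rewrite /bracket dot_coord e0 e1 e2 !mul0r !addr0.
rewrite /chi /cross_ratio.
set Nn := dot _ _ in N0.
have -> : dot (cross b a) (line b a) = Nn.
  by rewrite /line /Nn !dot_coord !cross_coord; ring.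
have -> : dot (cross (x2 *: b - x1 *: a) (y2 *: b - y1 *: a)) (line b a) =
          (x1 * y2 - x2 * y1) * Nn.
  by rewrite /line /Nn !dot_coord !cross_coord !comb_coord; ring.
have -> : dot (cross a (x2 *: b - x1 *: a)) (line b a) = - (x2 * Nn).
  by rewrite /line /Nn !dot_coord !cross_coord !comb_coord; ring.
have -> : dot (cross (y2 *: b - y1 *: a) b) (line b a) = y1 * Nn.
  by rewrite /line /Nn !dot_coord !cross_coord !comb_coord; ring.
by field; rewrite ?N0 ?x2N ?y1N.
Qed.

Section FivePoints.
Variables p1 p2 p3 p4 p5 : 'rV[R]_3.

(** The two coordinates attached to [p3], as ratios of brackets of the five vertices
    around it. *)
Definition xl5 : R := (bracket p1 p2 p4 * bracket p3 p4 p5) /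
                      (bracket p1 p3 p4 * bracket p2 p4 p5).
Definition xr5 : R := (bracket p1 p2 p3 * bracket p2 p4 p5) /
                      (bracket p2 p3 p5 * bracket p1 p2 p4).

Lemma xl5E : bracket p1 p2 p4 != 0 -> bracket p1 p3 p4 != 0 ->
  bracket p2 p4 p5 != 0 ->
  chi p1 p2 (meet (line p1 p2) (line p3 p4)) (meet (line p1 p2) (line p4 p5)) = xl5.
Proof.
move=> n1 n2 n3; rewrite !meet_line (chi_pencil _ _ n1) // /xl5.
by congr (_ / _); rewrite !bracketE; ring.
Qed.

Lemma xr5E : bracket p2 p4 p5 != 0 -> bracket p2 p3 p5 != 0 ->
  bracket p1 p2 p4 != 0 ->
  chi p5 p4 (meet (line p2 p3) (line p4 p5)) (meet (line p1 p2) (line p4 p5)) = xr5.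
Proof.
move=> n1 n2 n3; rewrite !meet_line_r (@chi_pencil _ _ _ _ _ _ p2) //.
  by rewrite /xr5; congr (_ / _); rewrite !bracketE; ring.
by apply: contraNneq n1 => E; rewrite -oppr_eq0 -bracketC -E bracket_rot.
Qed.

(** A Pluecker relation.  The left-hand side controls whether the image polygon is in
    general position, and the only factor of the right-hand side that may
    vanish for points in general position is [bracket p1 p3 p5]. *)
Lemma defect5 : bracket p1 p2 p4 != 0 -> bracket p2 p4 p5 != 0 ->
  bracket p1 p3 p4 != 0 -> bracket p2 p3 p5 != 0 ->
  1 - xl5 * xr5 =
  (bracket p1 p3 p5 * bracket p2 p3 p4) / (bracket p1 p3 p4 * bracket p2 p3 p5).
Proof.
move=> n1 n2 n3 n4; rewrite /xl5 /xr5.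
have -> : bracket p1 p3 p5 * bracket p2 p3 p4 =
   bracket p1 p3 p4 * bracket p2 p3 p5 - bracket p1 p2 p3 * bracket p3 p4 p5.
  by rewrite !bracketE; ring.
by field; rewrite n1 n2 n3 n4.
Qed.
End FivePoints.

Lemma xl5_proj (M : 'M[R]_3) (c1 c2 c3 c4 c5 : R) p1 p2 p3 p4 p5 :
  M \in unitmx -> [/\ c1 != 0, c2 != 0, c3 != 0, c4 != 0 & c5 != 0] ->
  bracket p1 p3 p4 != 0 -> bracket p2 p4 p5 != 0 ->
  xl5 (c1 *: (p1 *m M)) (c2 *: (p2 *m M)) (c3 *: (p3 *m M)) (c4 *: (p4 *m M))
    (c5 *: (p5 *m M)) = xl5 p1 p2 p3 p4 p5.
Proof.
move=> /volume_unit uM [n1 n2 n3 n4 n5] z1 z2.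
rewrite /xl5 !bracket_scale !bracket_mulmx.
by field; rewrite n1 n2 n3 n4 n5 z1 z2 uM.
Qed.

Lemma xr5_proj (M : 'M[R]_3) (c1 c2 c3 c4 c5 : R) p1 p2 p3 p4 p5 :
  M \in unitmx -> [/\ c1 != 0, c2 != 0, c3 != 0, c4 != 0 & c5 != 0] ->
  bracket p2 p3 p5 != 0 -> bracket p1 p2 p4 != 0 ->
  xr5 (c1 *: (p1 *m M)) (c2 *: (p2 *m M)) (c3 *: (p3 *m M)) (c4 *: (p4 *m M))
    (c5 *: (p5 *m M)) = xr5 p1 p2 p3 p4 p5.
Proof.
move=> /volume_unit uM [n1 n2 n3 n4 n5] z1 z2.
rewrite /xr5 !bracket_scale !bracket_mulmx.
by field; rewrite n1 n2 n3 n4 n5 z1 z2 uM.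
Qed.

(** Two consecutive meets share a line, so their join is that line, up to a bracket. *)
Lemma bracket_meet l0 l1 l2 l3 l4 :
  [/\ bracket (meet l0 l1) (meet l1 l2) (meet l2 l3) = bracket l0 l1 l2 * bracket l1 l2 l3,
      bracket (meet l0 l1) (meet l1 l2) (meet l3 l4) = bracket l0 l1 l2 * bracket l1 l3 l4
    & bracket (meet l0 l1) (meet l2 l3) (meet l3 l4) = bracket l2 l3 l4 * bracket l0 l1 l3].
Proof. by split; rewrite /meet !bracketE !cross_coord; ring. Qed.

(** The lines here join vertices two steps apart, so consecutive lines share the
    vertices of a window and their bracket factors. *)
Lemma bracket_lines a b c d f : bracket (line a c) (line b d) (line c f) =
  bracket a c f * bracket b c d.
Proof. by rewrite /line !bracketE !cross_coord; ring. Qed.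
Lemma bracket_lines013 a b c d g : bracket (line a c) (line b d) (line d g) =
  bracket b d g * bracket a c d.
Proof. by rewrite /line !bracketE !cross_coord; ring. Qed.
Lemma bracket_lines134 b d f g h : bracket (line b d) (line d g) (line f h) =
  bracket b d g * bracket d f h.
Proof. by rewrite /line !bracketE !cross_coord; ring. Qed.
End Brackets.

(** * The pentagram map in coordinates *)

Section Parity.

Lemma parityE (a : int) : {t : int | a = 2 * t + (parity a)%:Z}.
Proof.
case: a => m; rewrite /parity.
  by exists (m./2)%:Z; have := odd_double_half m; lia.
exists (- (m.+2./2)%:Z); have := odd_double_half m.+2.
by rewrite /= negbK NegzE; case: (odd m); rewrite /=; lia.
Qed.

Lemma parityD (a b : int) : parity (a + b) = parity a (+) parity b.
Proof.
have [t et] := parityE a; have [u eu] := parityE b; have [v ev] := parityE (a + b).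
by move: et eu ev; case: (parity a); case: (parity b); case: (parity (a + b)) => /=; lia.
Qed.

Lemma parityN (a : int) : parity (- a) = parity a.
Proof. by rewrite /parity abszN. Qed.

Lemma parityM2 (a : int) : parity (2 * a) = false.
Proof. by rewrite /parity abszM oddM. Qed.

Lemma parity_nat (m : nat) : parity m%:Z = odd m.
Proof. by []. Qed.

Lemma periodicZ (V : Type) (f : int -> V) (N : nat) :
  (forall j, f (j + N%:Z) = f j) -> forall j q, f (j + N%:Z * q) = f j.
Proof.
move=> fP; have pos i (m : nat) : f (i + N%:Z * m%:Z) = f i.
  elim: m => [|m IHm]; first by rewrite mulr0 addr0.
  by rewrite -[RHS]IHm -[RHS]fP intS; congr (f _); ring.
move=> j [] m; first exact: pos.
by rewrite -[LHS](pos _ m.+1) NegzE; congr (f _); ring.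
Qed.

(** Every integer label has a representative modulo [N] in any period of natural
    numbers. *)
Lemma label_of (N : nat) (c : int) (b : nat) : (0 < N)%N ->
  exists y q, [/\ (b <= y)%N, (y < b + N)%N & y%:Z = c + N%:Z * q].
Proof.
move=> N0; have nz0 : N%:Z != 0 by rewrite eqz_nat -lt0n.
exists (b + `|((c - b%:Z) %% N)%Z|)%N, (- ((c - b%:Z) %/ N)%Z); rewrite leq_addr.
have := divz_eq (c - b%:Z) N; have := modz_ge0 (c - b%:Z) nz0.
have : ((c - b%:Z) %% N)%Z < N by rewrite ltz_pmod.
move: (_ %% _)%Z (_ %/ _)%Z => r q h1 h2 h3; split=> //; first by rewrite ltn_add2l; lia.
rewrite PoszD gez0_abs // mulrN [N%:Z * q]mulrC.
by move: (q * N)%Z h3 => z; lia.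
Qed.

End Parity.

Section PentagramPoints.
Variable R : realType.
Implicit Types a b c d f g h k : 'rV[R]_3.

Definition gp a b c d := [/\ bracket a b c != 0, bracket a b d != 0,
  bracket a c d != 0 & bracket b c d != 0].

Lemma gpE a b c d : general_position a b c d <-> gp a b c d.
Proof. by split=> -[n1 n2 n3 n4]; split; apply/eqP. Qed.

Lemma defect_neq0 a b c d f : gp a b c d -> gp b c d f ->
  (xl5 a b c d f * xr5 a b c d f != 1) = (bracket a c f != 0).
Proof.
move=> [n1 n2 n3 n4] [m1 m2 m3 m4].
rewrite eq_sym -subr_eq0 defect5 // mulf_eq0 invr_eq0 !mulf_eq0.
by rewrite (negbTE n3) (negbTE n4) (negbTE m2) !orbF.
Qed.

(** The vertices of the image around [q3] are determined by eight consecutive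
    vertices [a], ..., [k]. *)
Section Eight.
Variables a b c d f g h k : 'rV[R]_3.
Hypotheses (ha : gp a b c d) (hb : gp b c d f) (hc : gp c d f g) (hd : gp d f g h)
  (hf : gp f g h k).
Let q1 := meet (line a c) (line b d).
Let q2 := meet (line b d) (line c f).
Let q3 := meet (line c f) (line d g).
Let q4 := meet (line d g) (line f h).
Let q5 := meet (line f h) (line g k).

Lemma gp_pentagram : bracket a c f != 0 -> bracket b d g != 0 -> bracket c f h != 0 ->
  gp q1 q2 q3 q4.
Proof.
move: ha hb hc hd => [a1 a2 a3 a4] [b1 b2 b3 b4] [c1 c2 c3 c4] [d1 d2 d3 d4].
move=> n1 n2 n3; rewrite /gp /q1 /q2 /q3 /q4.
have [-> _ _] := bracket_meet (line a c) (line b d) (line c f) (line d g) (line d g).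
have [_ -> _] := bracket_meet (line a c) (line b d) (line c f) (line d g) (line f h).
have [_ _ ->] := bracket_meet (line a c) (line b d) (line c f) (line d g) (line f h).
have [-> _ _] := bracket_meet (line b d) (line c f) (line d g) (line f h) (line d g).
rewrite !bracket_lines bracket_lines013 bracket_lines134.
by split; rewrite !mulf_neq0.
Qed.

Lemma gp_pentagram_inv : gp q1 q2 q3 q4 -> bracket a c f != 0.
Proof.
move=> [+ _ _ _]; rewrite /q1 /q2 /q3.
have [-> _ _] := bracket_meet (line a c) (line b d) (line c f) (line d g) (line d g).
by rewrite bracket_lines; apply: contraNneq => ->; rewrite !mul0r.
Qed.

Hypotheses (n1 : bracket a c f != 0) (n2 : bracket b d g != 0)
  (n3 : bracket c f h != 0) (n4 : bracket d g k != 0).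

Lemma xl_pentagram5 : xl5 q1 q2 q3 q4 q5 =
  xl5 b c d f g * (1 - xl5 a b c d f * xr5 a b c d f) /
  (1 - xl5 c d f g h * xr5 c d f g h).
Proof.
move: ha hb hc hd hf => [a1 a2 a3 a4] [b1 b2 b3 b4] [c1 c2 c3 c4] [d1 d2 d3 d4].
move=> [f1 f2 f3 f4].
rewrite !defect5 // /xl5 /q1 /q2 /q3 /q4 /q5.
have [_ -> _] := bracket_meet (line a c) (line b d) (line c f) (line d g) (line f h).
have [_ _ ->] := bracket_meet (line a c) (line b d) (line c f) (line d g) (line f h).
have [-> _ _] := bracket_meet (line c f) (line d g) (line f h) (line g k) (line d g).
have [_ _ ->] := bracket_meet (line b d) (line c f) (line d g) (line f h) (line g k).
rewrite !bracket_lines bracket_lines013 bracket_lines134 (bracket_lines013 b c d f h).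
by field; rewrite ?a1 ?a2 ?a3 ?a4 ?b1 ?b2 ?b3 ?b4 ?c1 ?c2 ?c3 ?c4 ?d1 ?d2 ?d3 ?d4
  ?f1 ?f2 ?f3 ?f4 ?n1 ?n2 ?n3 ?n4.
Qed.

Lemma xr_pentagram5 : xr5 q1 q2 q3 q4 q5 =
  xr5 c d f g h * (1 - xl5 d f g h k * xr5 d f g h k) /
  (1 - xl5 b c d f g * xr5 b c d f g).
Proof.
move: ha hb hc hd hf => [a1 a2 a3 a4] [b1 b2 b3 b4] [c1 c2 c3 c4] [d1 d2 d3 d4].
move=> [f1 f2 f3 f4].
rewrite !defect5 // /xr5 /q1 /q2 /q3 /q4 /q5.
have [-> _ _] := bracket_meet (line a c) (line b d) (line c f) (line d g) (line d g).
have [_ -> _] := bracket_meet (line a c) (line b d) (line c f) (line d g) (line f h).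
have [_ -> _] := bracket_meet (line b d) (line c f) (line d g) (line f h) (line g k).
have [_ _ ->] := bracket_meet (line b d) (line c f) (line d g) (line f h) (line g k).
rewrite !bracket_lines !bracket_lines134 (bracket_lines013 b c d f h).
by field; rewrite ?a1 ?a2 ?a3 ?a4 ?b1 ?b2 ?b3 ?b4 ?c1 ?c2 ?c3 ?c4 ?d1 ?d2 ?d3 ?d4
  ?f1 ?f2 ?f3 ?f4 ?n1 ?n2 ?n3 ?n4.
Qed.
End Eight.
End PentagramPoints.

Section Twisted.
Variable R : realType.
Implicit Types (A : polygon R) (s : bool) (n : nat) (e a : int).

(** The product [x_c x_(c+1)] attached to a vertex, equal to 1 exactly where the
    pentagram map degenerates. *)
Definition wc A e := xl A e * xr A e.

Lemma twisted_gp s n A a : twisted s n A -> parity a = s ->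
  gp (A a) (A (a + 2)) (A (a + 4)) (A (a + 6)).
Proof. by move=> [_ h] /h /gpE. Qed.

Lemma twisted_gp4 s n A e k1 k2 k3 k4 : twisted s n A -> parity (e + k1) = s ->
  k2 = k1 + 2 -> k3 = k1 + 4 -> k4 = k1 + 6 ->
  gp (A (e + k1)) (A (e + k2)) (A (e + k3)) (A (e + k4)).
Proof. by move=> tA pa -> -> ->; rewrite !(addrA e); apply: (twisted_gp tA pa). Qed.

Lemma xlxrE s n A e : twisted s n A -> parity e = s ->
  [/\ xl A e = xl5 (A (e - 4)) (A (e - 2)) (A e) (A (e + 2)) (A (e + 4)),
      xr A e = xr5 (A (e - 4)) (A (e - 2)) (A e) (A (e + 2)) (A (e + 4)),
      xl A e != 0 & xr A e != 0].
Proof.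
move=> tA pe.
have := @twisted_gp4 s n A e (-4) (-2) 0 2 tA; rewrite parityD pe addbF addr0.
case=> // a1 a2 a3 a4.
have := @twisted_gp4 s n A e (-2) 0 2 4 tA; rewrite parityD pe addbF addr0.
case=> // b1 b2 b3 b4.
have el : xl A e = xl5 (A (e - 4)) (A (e - 2)) (A e) (A (e + 2)) (A (e + 4)).
  by rewrite -xl5E.
have er : xr A e = xr5 (A (e - 4)) (A (e - 2)) (A e) (A (e + 2)) (A (e + 4)).
  by rewrite -xr5E.
by split=> //; rewrite ?el ?er /xl5 /xr5 mulf_neq0 ?invr_eq0 // mulf_neq0.
Qed.

Lemma pentagramE A e k k1 k2 k3 k4 : k1 = k - 3 -> k2 = k + 1 -> k3 = k - 1 ->
  k4 = k + 3 -> pentagram A (e + k) =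
  meet (line (A (e + k1)) (A (e + k2))) (line (A (e + k3)) (A (e + k4))).
Proof. by move=> -> -> -> ->; rewrite /pentagram !(addrA e). Qed.

Lemma wc_neq1 s n A e : twisted s n A -> parity e = s ->
  (wc A e != 1) = (bracket (A (e - 4)) (A e) (A (e + 4)) != 0).
Proof.
move=> tA pe; rewrite /wc; have [-> -> _ _] := xlxrE tA pe.
have := @twisted_gp4 s n A e (-4) (-2) 0 2 tA; rewrite parityD pe addbF addr0 => ga.
have := @twisted_gp4 s n A e (-2) 0 2 4 tA; rewrite parityD pe addbF addr0 => gb.
by apply: defect_neq0; [apply: ga | apply: gb].
Qed.

Lemma wc_neq1_shift s n A e k k1 k2 k3 : twisted s n A -> parity (e + k) = s ->
  k1 = k - 4 -> k2 = k -> k3 = k + 4 ->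
  (wc A (e + k) != 1) = (bracket (A (e + k1)) (A (e + k2)) (A (e + k3)) != 0).
Proof. by move=> tA pe -> -> ->; rewrite (wc_neq1 tA pe) !(addrA e). Qed.

Lemma xl_shift s n A e k k1 k2 k3 k4 k5 : twisted s n A -> parity (e + k) = s ->
  k1 = k - 4 -> k2 = k - 2 -> k3 = k -> k4 = k + 2 -> k5 = k + 4 ->
  xl A (e + k) = xl5 (A (e + k1)) (A (e + k2)) (A (e + k3)) (A (e + k4)) (A (e + k5)).
Proof. by move=> tA pe -> -> -> -> ->; have [-> _ _ _] := xlxrE tA pe; rewrite !(addrA e). Qed.

Lemma xr_shift s n A e k k1 k2 k3 k4 k5 : twisted s n A -> parity (e + k) = s ->
  k1 = k - 4 -> k2 = k - 2 -> k3 = k -> k4 = k + 2 -> k5 = k + 4 ->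
  xr A (e + k) = xr5 (A (e + k1)) (A (e + k2)) (A (e + k3)) (A (e + k4)) (A (e + k5)).
Proof. by move=> tA pe -> -> -> -> ->; have [_ -> _ _] := xlxrE tA pe; rewrite !(addrA e). Qed.

Section Window.
Variables (s : bool) (n : nat) (A : polygon R) (e : int).
Hypotheses (tA : twisted s n A) (pe : parity e = ~~ s).

Let odd_shift k : odd `|k|%N -> parity (e + k) = s.
Proof. by rewrite parityD pe /parity => ->; case: s. Qed.
Let ga : gp (A (e + -7)) (A (e + -5)) (A (e + -3)) (A (e + -1)).
Proof. by apply: (twisted_gp4 tA) => //; exact: odd_shift. Qed.
Let gb : gp (A (e + -5)) (A (e + -3)) (A (e + -1)) (A (e + 1)).
Proof. by apply: (twisted_gp4 tA) => //; exact: odd_shift. Qed.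
Let gc : gp (A (e + -3)) (A (e + -1)) (A (e + 1)) (A (e + 3)).
Proof. by apply: (twisted_gp4 tA) => //; exact: odd_shift. Qed.
Let gd : gp (A (e + -1)) (A (e + 1)) (A (e + 3)) (A (e + 5)).
Proof. by apply: (twisted_gp4 tA) => //; exact: odd_shift. Qed.
Let gf : gp (A (e + 1)) (A (e + 3)) (A (e + 5)) (A (e + 7)).
Proof. by apply: (twisted_gp4 tA) => //; exact: odd_shift. Qed.

Let P1 : pentagram A (e + -4) =
  meet (line (A (e + -7)) (A (e + -3))) (line (A (e + -5)) (A (e + -1))).
Proof. exact: pentagramE. Qed.
Let P2 : pentagram A (e + -2) =
  meet (line (A (e + -5)) (A (e + -1))) (line (A (e + -3)) (A (e + 1))).
Proof. exact: pentagramE. Qed.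
Let P3 : pentagram A e =
  meet (line (A (e + -3)) (A (e + 1))) (line (A (e + -1)) (A (e + 3))).
Proof. by []. Qed.
Let P4 : pentagram A (e + 2) =
  meet (line (A (e + -1)) (A (e + 3))) (line (A (e + 1)) (A (e + 5))).
Proof. exact: pentagramE. Qed.
Let P5 : pentagram A (e + 4) =
  meet (line (A (e + 1)) (A (e + 5))) (line (A (e + 3)) (A (e + 7))).
Proof. exact: pentagramE. Qed.

Lemma pentagram_gp_inv :
  gp (pentagram A (e - 4)) (pentagram A (e - 2)) (pentagram A e) (pentagram A (e + 2)) ->
  wc A (e - 3) != 1.
Proof.
rewrite P1 P2 P3 P4 => /gp_pentagram_inv.
by rewrite (@wc_neq1_shift _ _ _ e (-3) (-7) (-3) 1 tA) //; apply: odd_shift.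
Qed.

Hypothesis w1 : forall c, parity c = s -> wc A c != 1.

Let n1 : bracket (A (e + -7)) (A (e + -3)) (A (e + 1)) != 0.
Proof. by rewrite -(@wc_neq1_shift s n A e (-3)) ?w1 //; apply: odd_shift. Qed.
Let n2 : bracket (A (e + -5)) (A (e + -1)) (A (e + 3)) != 0.
Proof. by rewrite -(@wc_neq1_shift s n A e (-1)) ?w1 //; apply: odd_shift. Qed.
Let n3 : bracket (A (e + -3)) (A (e + 1)) (A (e + 5)) != 0.
Proof. by rewrite -(@wc_neq1_shift s n A e 1) ?w1 //; apply: odd_shift. Qed.
Let n4 : bracket (A (e + -1)) (A (e + 3)) (A (e + 7)) != 0.
Proof. by rewrite -(@wc_neq1_shift s n A e 3) ?w1 //; apply: odd_shift. Qed.

Lemma pentagram_gp :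
  gp (pentagram A (e - 4)) (pentagram A (e - 2)) (pentagram A e) (pentagram A (e + 2)).
Proof. by rewrite P1 P2 P3 P4; apply: gp_pentagram. Qed.

Lemma xl_pentagram : twisted (~~ s) n (pentagram A) -> xl (pentagram A) e =
  xl A (e - 1) * (1 - wc A (e - 3)) / (1 - wc A (e + 1)).
Proof.
move=> tB; have [-> _ _ _] := xlxrE tB pe.
rewrite P1 P2 P3 P4 P5 xl_pentagram5 // /wc.
rewrite (@xl_shift s n A e (-1) (-5) (-3) (-1) 1 3 tA) //; last exact: odd_shift.
rewrite (@xl_shift s n A e (-3) (-7) (-5) (-3) (-1) 1 tA) //; last exact: odd_shift.
rewrite (@xr_shift s n A e (-3) (-7) (-5) (-3) (-1) 1 tA) //; last exact: odd_shift.
rewrite (@xl_shift s n A e 1 (-3) (-1) 1 3 5 tA) //; last exact: odd_shift.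
by rewrite (@xr_shift s n A e 1 (-3) (-1) 1 3 5 tA) //; last exact: odd_shift.
Qed.

Lemma xr_pentagram : twisted (~~ s) n (pentagram A) -> xr (pentagram A) e =
  xr A (e + 1) * (1 - wc A (e + 3)) / (1 - wc A (e - 1)).
Proof.
move=> tB; have [_ -> _ _] := xlxrE tB pe.
rewrite P1 P2 P3 P4 P5 xr_pentagram5 // /wc.
rewrite (@xr_shift s n A e 1 (-3) (-1) 1 3 5 tA) //; last exact: odd_shift.
rewrite (@xl_shift s n A e 3 (-1) 1 3 5 7 tA) //; last exact: odd_shift.
rewrite (@xr_shift s n A e 3 (-1) 1 3 5 7 tA) //; last exact: odd_shift.
rewrite (@xl_shift s n A e (-1) (-5) (-3) (-1) 1 3 tA) //; last exact: odd_shift.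
by rewrite (@xr_shift s n A e (-1) (-5) (-3) (-1) 1 3 tA) //; last exact: odd_shift.
Qed.

End Window.

(** The bracket of three consecutive vertices of the image has the factor that
    distinguishes [wc] from 1. *)
Lemma twisted_pentagram_wc s n A : twisted s n A -> twisted (~~ s) n (pentagram A) ->
  forall c, parity c = s -> wc A c != 1.
Proof.
move=> tA tB c pc.
have pe : parity (c + 3) = ~~ s by rewrite parityD pc addbT.
have := pentagram_gp_inv tA pe; rewrite addrK; apply.
have := @twisted_gp4 _ _ _ (c + 3) (-4) (-2) 0 2 tB; rewrite addr0.
by apply; rewrite // parityD pe addbF.
Qed.

Lemma meet_lines_proj (M : 'M[R]_3) (c1 c2 c3 c4 : R) (a b c d : 'rV[R]_3) :
  meet (line (c1 *: (a *m M)) (c2 *: (b *m M))) (line (c3 *: (c *m M)) (c4 *: (d *m M)))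
  = (c1 * c2 * c3 * c4 * volume M) *: (meet (line a b) (line c d) *m M).
Proof.
rewrite !meet_line !bracket_scale !bracket_mulmx mulmxBl scalerBr -!scalemxAl !scalerA.
by congr (_ *: _ - _ *: _); ring.
Qed.

(** The monodromy of a polygon is also that of its image, since meets of lines are
    equivariant. *)
Lemma twisted_pentagram s n A : twisted s n A ->
  (forall c, parity c = s -> wc A c != 1) -> twisted (~~ s) n (pentagram A).
Proof.
move=> tA w1; split.
  have [[M uM hM] _] := tA; exists M => // a pa.
  have hA k : odd `|k|%N -> exists2 c : R, c != 0 &
      A (a + (2 * n)%:Z + k) = c *: (A (a + k) *m M).
    move=> ok; rewrite addrAC; apply: hM.
    by rewrite parityD pa /parity ok; case: (s).
  have [c1 n1 e1] := hA (-3) isT; have [c2 n2 e2] := hA 1 isT.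
  have [c3 n3 e3] := hA (-1) isT; have [c4 n4 e4] := hA 3 isT.
  rewrite /pentagram e1 e2 e3 e4 meet_lines_proj.
  by exists (c1 * c2 * c3 * c4 * volume M); rewrite // !mulf_neq0 ?volume_unit.
move=> a pa; apply/gpE.
have pe : parity (a + 4) = ~~ s by rewrite parityD pa addbF.
have := pentagram_gp tA pe w1.
by rewrite addrK -[a + 4 - 2]addrA -[a + 4 + 2]addrA.
Qed.

Lemma xlxr_periodic s n A e : twisted s n A -> parity e = s ->
  xl A (e + (2 * n)%:Z) = xl A e /\ xr A (e + (2 * n)%:Z) = xr A e.
Proof.
move=> tA pe.
have pe' : parity (e + (2 * n)%:Z) = s by rewrite parityD parity_nat oddM addbF.
have [-> -> _ _] := xlxrE tA pe; have [-> -> _ _] := xlxrE tA pe'.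
have := @twisted_gp4 s n A e (-4) (-2) 0 2 tA; rewrite parityD pe addbF addr0.
case=> // a1 a2 a3 a4.
have := @twisted_gp4 s n A e (-2) 0 2 4 tA; rewrite parityD pe addbF addr0.
case=> // b1 b2 b3 b4.
have [[M uM hM] _] := tA.
have hA k : ~~ odd `|k|%N -> exists2 c : R, c != 0 &
    A (e + (2 * n)%:Z + k) = c *: (A (e + k) *m M).
  move=> ok; rewrite addrAC; apply: hM.
  by rewrite parityD pe /parity (negbTE ok) addbF.
have [c1 n1 ->] := hA (-4) isT; have [c2 n2 ->] := hA (-2) isT.
have [c3 n3] := hA 0 isT; rewrite !addr0 => ->.
have [c4 n4 ->] := hA 2 isT; have [c5 n5 ->] := hA 4 isT.
by rewrite xl5_proj ?xr5_proj.
Qed.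

Lemma xcoord_periodic s n A j : twisted s n A ->
  xcoord s A (j + (2 * n)%:Z) = xcoord s A j.
Proof.
move=> tA; rewrite /xcoord parityD parity_nat oddM addbF.
case: eqP => [pj|/eqP pj]; first by have [] := xlxr_periodic tA pj.
rewrite addrAC; apply: (proj2 (xlxr_periodic tA _)).
by rewrite parityD addbT; case: (parity j) pj; case: (s).
Qed.

Lemma xcoord_neq0 s n A j : twisted s n A -> xcoord s A j != 0.
Proof.
move=> tA; rewrite /xcoord; case: ifP => [/eqP pj|/eqP pj].
  by have [_ _] := xlxrE tA pj.
have pj' : parity (j - 1) = s.
  by rewrite parityD addbT; case: (parity j) pj; case: (s).
by have [_ _] := xlxrE tA pj'.
Qed.

Section Step.
Variables (s : bool) (n : nat) (A : polygon R).
Hypotheses (tA : twisted s n A) (tB : twisted (~~ s) n (pentagram A)).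
Local Notation x := (xcoord s A).

Lemma wcE c : parity c = s -> wc A c = x c * x (c + 1).
Proof.
move=> pc; rewrite /xcoord parityD pc eqxx addbT addrK /wc.
by case: (s).
Qed.

Lemma xcoord_pentagram_l j : parity j = s ->
  xcoord (~~ s) (pentagram A) j =
  x (j + 1) * (1 - x (j + 2) * x (j + 3)) / (1 - x (j - 2) * x (j - 1)).
Proof.
move=> pj; have pj1 : parity (j - 1) = ~~ s by rewrite parityD pj addbT.
rewrite {1}/xcoord pj ifN; last by case: (s).
have w1 := twisted_pentagram_wc tA tB.
rewrite (xr_pentagram tA pj1 w1 tB) !wcE ?parityD ?pj ?addbF ?addbT ?negbK //.
have -> : j - 1 + 3 = j + 2 by lia.
have -> : j - 1 - 1 = j - 2 by lia.
have -> : j + 2 + 1 = j + 3 by lia.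
have -> : j - 2 + 1 = j - 1 by lia.
have -> : j - 1 + 1 = j by lia.
suff -> : x (j + 1) = xr A j by [].
by rewrite /xcoord parityD pj addbT addrK; case: (s).
Qed.

Lemma xcoord_pentagram_r j : parity j = ~~ s ->
  xcoord (~~ s) (pentagram A) j =
  x (j - 1) * (1 - x (j - 3) * x (j - 2)) / (1 - x (j + 1) * x (j + 2)).
Proof.
move=> pj; rewrite {1}/xcoord pj eqxx.
have w1 := twisted_pentagram_wc tA tB.
rewrite (xl_pentagram tA pj w1 tB) !wcE ?parityD ?pj ?addbF ?addbT ?negbK //.
have -> : j - 3 + 1 = j - 2 by lia.
have -> : j + 1 + 1 = j + 2 by lia.
suff -> : x (j - 1) = xl A (j - 1) by [].
by rewrite /xcoord parityD pj addbT negbK eqxx.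
Qed.
End Step.
End Twisted.

(** * Twisted polygons with prescribed coordinates *)

Section Existence.
Variable R : realType.


(** Cramer's rule: a row vector killed by [M] has zero coordinates. *)
Lemma volume_unitmx (M : 'M[R]_3) : volume M != 0 -> M \in unitmx.
Proof.
move=> vM; rewrite -row_free_unit; apply: inj_row_free => v vM0.
have E j : v 0 0 * M 0 j + v 0 1 * M 1 j + v 0 2%:R * M 2%:R j = 0.
  by rewrite -mulmx_coord vM0 mxE.
have kill i : v 0 i * volume M = 0 -> v 0 i = (0 : 'rV[R]_3) 0 i.
  by move/eqP; rewrite mulf_eq0 (negbTE vM) orbF mxE => /eqP.
move: (E 0) (E 1) (E 2%:R) => e0 e1 e2.
apply: row3P; apply: kill; rewrite /volume bracketE !mxE.
- have -> : 0 = (v 0 0 * M 0 0 + v 0 1 * M 1 0 + v 0 2%:R * M 2%:R 0) *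
       (M 1 1 * M 2%:R 2%:R - M 1 2%:R * M 2%:R 1) -
      (v 0 0 * M 0 1 + v 0 1 * M 1 1 + v 0 2%:R * M 2%:R 1) *
       (M 1 0 * M 2%:R 2%:R - M 1 2%:R * M 2%:R 0) +
      (v 0 0 * M 0 2%:R + v 0 1 * M 1 2%:R + v 0 2%:R * M 2%:R 2%:R) *
       (M 1 0 * M 2%:R 1 - M 1 1 * M 2%:R 0).
    by rewrite e0 e1 e2; ring.
  by ring.
- have -> : 0 = - (v 0 0 * M 0 0 + v 0 1 * M 1 0 + v 0 2%:R * M 2%:R 0) *
       (M 0 1 * M 2%:R 2%:R - M 0 2%:R * M 2%:R 1) +
      (v 0 0 * M 0 1 + v 0 1 * M 1 1 + v 0 2%:R * M 2%:R 1) *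
       (M 0 0 * M 2%:R 2%:R - M 0 2%:R * M 2%:R 0) -
      (v 0 0 * M 0 2%:R + v 0 1 * M 1 2%:R + v 0 2%:R * M 2%:R 2%:R) *
       (M 0 0 * M 2%:R 1 - M 0 1 * M 2%:R 0).
    by rewrite e0 e1 e2; ring.
  by ring.
- have -> : 0 = (v 0 0 * M 0 0 + v 0 1 * M 1 0 + v 0 2%:R * M 2%:R 0) *
       (M 0 1 * M 1 2%:R - M 0 2%:R * M 1 1) -
      (v 0 0 * M 0 1 + v 0 1 * M 1 1 + v 0 2%:R * M 2%:R 1) *
       (M 0 0 * M 1 2%:R - M 0 2%:R * M 1 0) +
      (v 0 0 * M 0 2%:R + v 0 1 * M 1 2%:R + v 0 2%:R * M 2%:R 2%:R) *
       (M 0 0 * M 1 1 - M 0 1 * M 1 0).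
    by rewrite e0 e1 e2; ring.
  by ring.
Qed.

Section Recurrence.
Variables (n : nat) (be ga : nat -> R).
Hypotheses (n0 : (0 < n)%N) (beP : forall k, be (k + n)%N = be k)
  (gaP : forall k, ga (k + n)%N = ga k) (be0 : forall k, be k != 0)
  (ga0 : forall k, ga k != 0).

(** Vectors can be normalized so that four consecutive ones satisfy a linear
    recurrence with leading coefficients 1 and 1; its other two coefficients are
    monomials in the coordinates. *)
Fixpoint vertex (k : nat) : 'rV[R]_3 :=
  if k is k1.+1 then if k1 is k2.+1 then if k2 is k3.+1 then
    vertex k1 + be k3 *: vertex k2 + ga k3 *: vertex k3
  else delta_mx 0 2%:R else delta_mx 0 1 else delta_mx 0 0.

Lemma vertexE k : vertex k.+3 = vertex k.+2 + be k *: vertex k.+1 + ga k *: vertex k.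
Proof. by []. Qed.

Lemma vertex_bracket k : bracket (vertex k) (vertex k.+1) (vertex k.+2) != 0.
Proof.
elim: k => [|k IHk].
  by rewrite bracketE !mxE /= !(mul0r, mulr0, subr0, addr0, mulr1) oner_neq0.
suff -> : bracket (vertex k.+1) (vertex k.+2) (vertex k.+3) =
          ga k * bracket (vertex k) (vertex k.+1) (vertex k.+2) by rewrite mulf_neq0.
by rewrite vertexE !bracketE !mxE; ring.
Qed.

Lemma vertex_window k :
  let B i j l := bracket (vertex (k + i)) (vertex (k + j)) (vertex (k + l)) in
  [/\ B 0%N 1%N 2%N != 0, B 0%N 1%N 3%N = B 0%N 1%N 2%N,
      B 0%N 2%N 3%N = - be k * B 0%N 1%N 2%N & B 1%N 2%N 3%N = ga k * B 0%N 1%N 2%N].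
Proof.
rewrite /= addn0 addn1 addn2 addn3 vertex_bracket.
by split=> //; rewrite vertexE !bracketE !mxE; ring.
Qed.

Definition monodromy : 'M[R]_3 :=
  \matrix_(i < 3) vertex (n + i)%N.

Lemma monodromy_unit : monodromy \in unitmx.
Proof.
apply: volume_unitmx; rewrite /volume !rowK /= addn0 addn1 addn2; exact: vertex_bracket.
Qed.

Lemma vertexDn k : vertex (k + n) = vertex k *m monodromy.
Proof.
suff [] : [/\ vertex (k + n) = vertex k *m monodromy,
  vertex (k.+1 + n) = vertex k.+1 *m monodromy &
  vertex (k.+2 + n) = vertex k.+2 *m monodromy] by [].
elim: k => [|k [h0 h1 h2]].
  by split; rewrite /= -rowE rowK /= ?addn0 ?addn1 ?addn2 ?addSn ?add0n.
split=> //; rewrite !addSn !vertexE in h1 h2 *.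
by rewrite h2 h1 h0 beP gaP !mulmxDl -!scalemxAl.
Qed.

Lemma vertexDnX k q : vertex (k + q * n) = vertex k *m monodromy ^+ q.
Proof.
elim: q => [|q IHq]; first by rewrite mul0n addn0 expr0 mulmx1.
by rewrite mulSn [(n + _)%N]addnC addnA vertexDn IHq exprSr -mulmxA.
Qed.

(** The orbit of the recurrence is extended to all integers by the monodromy. *)
Definition zvertex (t : int) := vertex `|(t %% n)%Z|%N *m monodromy ^ (t %/ n)%Z.

Lemma zvertexE (k : nat) (q : int) : zvertex (k%:Z + q * n) = vertex k *m monodromy ^ q.
Proof.
have nz0 : n%:Z != 0 by rewrite eqz_nat -lt0n.
rewrite /zvertex addrC modzMDl divzMDl // modz_nat divz_nat absz_nat.
rewrite [in RHS](divn_eq k n) [in RHS]addnC vertexDnX -mulmxA.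
by rewrite [q + _]addrC exprzDr ?monodromy_unit.
Qed.
End Recurrence.

(** With [V (t + 3) = V (t + 2) + be t * V (t + 1) + ga t * V t], the coordinates of the
    polygon [V] are [- be] at one parity and [ga / (be * be)] at the other. *)
Lemma polygon_existence s n (x : int -> R) : (0 < n)%N -> (forall j, x j != 0) ->
  (forall j, x (j + (2 * n)%:Z) = x j) ->
  exists A, twisted s n A /\ forall j, xcoord s A j = x j.
Proof.
move=> n0 x0 xP.
have [d ed] : exists d : int, d = (s : nat)%:Z by exists (s : nat)%:Z.
pose be (k : nat) := - x (2 * k%:Z + 3 + d).
pose ga (k : nat) := x (2 * k%:Z + 2 + d) * x (2 * k%:Z + 1 + d) * x (2 * k%:Z + 3 + d).
have be0 k : be k != 0 by rewrite oppr_eq0.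
have ga0 k : ga k != 0 by rewrite !mulf_neq0.
have beP k : be (k + n)%N = be k.
  by rewrite /be -[in RHS]xP; congr (- x _); lia.
have gaP k : ga (k + n)%N = ga k.
  rewrite /ga -[x (2 * k%:Z + 2 + d)]xP -[x (2 * k%:Z + 1 + d)]xP.
  by rewrite -[x (2 * k%:Z + 3 + d)]xP; congr (x _ * x _ * x _); lia.
have xPz j (q : int) : x (j + 2 * n%:Z * q) = x j.
  by rewrite -[RHS](periodicZ xP _ q) PoszM.
pose V := zvertex n be ga; pose M := monodromy n be ga.
have VE := @zvertexE n be ga n0 beP gaP ga0.
pose A (a : int) := V ((a - d) %/ 2)%Z.
have uM q : M ^ q \in unitmx.
  by rewrite -[_ \in _]/(M ^ q \is a GRing.unit) unitrXz // monodromy_unit.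
(* every window of the polygon is a projective image of one of the orbit *)
have window a : parity a = s -> exists (r : nat) (q : int), forall i : nat,
    a = 2 * (r%:Z + q * n) + d /\
    A (a + 2 * i%:Z) = vertex be ga (r + i)%N *m M ^ q.
  move=> pa; have [t] := parityE a; rewrite pa -ed => et.
  have nz0 : n%:Z != 0 by rewrite eqz_nat -lt0n.
  exists `|(t %% n)%Z|%N, (t %/ n)%Z => i.
  have er : (`|(t %% n)%Z|%N)%:Z = (t %% n)%Z by rewrite gez0_abs // modz_ge0.
  have e2 := divz_eq t n.
  split; first by rewrite er; lia.
  rewrite /A -VE PoszD er /V; congr (zvertex _ _ _ _).
  have -> : a + 2 * i%:Z - d = (t + i%:Z) * 2 by lia.
  by rewrite mulzK //; lia.
have tA : twisted s n A.
  split.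
    exists M; first exact: monodromy_unit.
    move=> a pa; have [r [q h]] := window a pa.
    exists 1; first exact: oner_neq0.
    have [ea] := h 0%N; rewrite mulr0 addr0 addn0 scale1r => ->.
    have -> : A (a + (2 * n)%:Z) = V (r%:Z + (q + 1) * n).
      rewrite /A; congr V.
      have -> : a + (2 * n)%:Z - d = (r%:Z + (q + 1) * n) * 2 by lia.
      by rewrite mulzK.
    by rewrite /V VE -mulmxA exprzDr ?monodromy_unit // expr1z.
  move=> a pa; apply/gpE; have [r [q h]] := window a pa.
  have [_] := h 0%N; rewrite mulr0 addr0 addn0 => ->.
  have [_ ->] := h 1%N; have [_ ->] := h 2%N; have [_ ->] := h 3%N.
  have [] := vertex_window be ga0 r; rewrite addn0 => b1 b2 b3 b4.
  have b5 := ga0 r; have b6 := be0 r; have b7 := volume_unit (uM q).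
  by split; rewrite bracket_mulmx ?b2 ?b3 ?b4 ?mulNr ?mulrN ?oppr_eq0 !mulf_neq0.
exists A; split=> //.
have main e : parity e = s -> xl A e = x e /\ xr A e = x (e + 1).
  move=> pe; have [-> -> _ _] := xlxrE tA pe.
  have pe4 : parity (e - 4) = s by rewrite parityD pe addbF.
  have [r [q h]] := window _ pe4.
  have [ee] := h 0%N; rewrite mulr0 addr0 addn0 => ->.
  have [_] := h 1%N; have -> : e - 4 + 2 * 1%:Z = e - 2 by lia.
  move->; have [_] := h 2%N; have -> : e - 4 + 2 * 2%:Z = e by lia.
  move->; have [_] := h 3%N; have -> : e - 4 + 2 * 3%:Z = e + 2 by lia.
  move->; have [_] := h 4%N; have -> : e - 4 + 2 * 4%:Z = e + 4 by lia.
  move->.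
  have [] := vertex_window be ga0 r; rewrite addn0 => b1 b2 b3 b4.
  have [] := vertex_window be ga0 r.+1; rewrite addn0 !addSnnS => c1 c2 c3 c4.
  have b5 := ga0 r; have b6 := be0 r; have b7 := volume_unit (uM q).
  have b8 := ga0 r.+1; have b9 := be0 r.+1.
  rewrite (addn1 r) in b1 b2 b3 b4 *; rewrite /xl5 /xr5 !bracket_mulmx b2 b3 c2 c3 c4 b4.
  have -> : x e = ga r.+1 / (be r * be r.+1).
    rewrite /ga /be.
    have -> : x e = x (2 * r.+1%:Z + 2 + d).
      by rewrite -[RHS](xPz _ q); congr (x _); lia.
    have -> : 2 * r.+1%:Z + 1 + d = 2 * r%:Z + 3 + d by lia.
    by field; rewrite !x0.
  have -> : x (e + 1) = - be r.+1.
    by rewrite /be opprK -[RHS](xPz _ q); congr (x _); lia.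
  by split; field; rewrite ?b1 ?b5 ?b6 ?b7 ?b9.
move=> j; rewrite /xcoord; case: ifP => [/eqP pj|/eqP pj]; first by have [] := main _ pj.
have pj' : parity (j - 1) = s by rewrite parityD addbT; case: (parity j) pj; case: (s).
by have [_ ->] := main _ pj'; rewrite subrK.
Qed.
End Existence.

(** * Iterates of the pentagram map *)

Section Labels.
Variable y : nat.

Lemma above1 : (4 <= y)%N ->
  (y + 1 + 2 = y + 3)%N * (y + 1 - 3 = y - 2)%N * (y + 1 - 2 = y - 1)%N *
  (y + 1 + 1 = y + 2)%N * (y + 1 - 1 = y)%N.
Proof. by move=> y4; do !split; lia. Qed.

Lemma below1 : (4 <= y)%N ->
  (y - 1 + 2 = y + 1)%N * (y - 1 - 3 = y - 4)%N * (y - 1 - 2 = y - 3)%N *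
  (y - 1 + 1 = y)%N.
Proof. by move=> y4; do !split; lia. Qed.

Lemma around2 : (4 <= y)%N ->
  (y + 2 + 1 = y + 3)%N * (y + 2 - 1 = y + 1)%N *
  (y - 2 + 1 = y - 1)%N * (y - 2 - 1 = y - 3)%N.
Proof. by move=> y4; do !split; lia. Qed.

Lemma around3 : (4 <= y)%N -> (y - 3 + 1 = y - 2)%N * (y - 3 - 1 = y - 4)%N.
Proof. by move=> y4; do !split; lia. Qed.

Lemma label_parity b : odd y = b -> (4 <= y)%N ->
  [/\ odd (y + 1) = ~~ b, odd (y - 1) = ~~ b, odd (y + 2) = b, odd (y - 2) = b
    & odd (y - 3) = ~~ b].
Proof. by move=> <- y4; split; rewrite ?oddD ?oddB ?addbT ?addbF //; lia. Qed.
End Labels.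

Section Levels.
Variable R : realType.
Variables (e : nat -> lexpr R site) (K : nat).
Hypothesis ce : condensation e K.
Implicit Types (T x : nat -> R) (s : bool) (l y c : nat).

(** The labels of the [l]-th iterate carry [tau (l + 1)], except those of the parity of
    its vertices, which still carry [tau l]. *)
Definition level_tau T s l y : R := tau e T (l + (odd y != s (+) odd l)) y.

Lemma level_tau_even T s l y : odd y = s (+) odd l -> level_tau T s l y = tau e T l y.
Proof. by rewrite /level_tau => ->; rewrite eqxx addn0. Qed.

Lemma level_tau_odd T s l y : odd y = ~~ (s (+) odd l) -> level_tau T s l y = tau e T l.+1 y.
Proof. by rewrite /level_tau => ->; case: (s (+) _); rewrite addn1. Qed.

(** The coordinates [x] are those of an [l]-th iterate with initial potential [T].
    The bounds leave room for the windows of the values of [tau]. *)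
Definition on_level T s l x :=
  (forall y, (10 * l + 5 <= y)%N -> level_tau T s l y != 0) /\
  (forall y, (10 * l + 10 <= y)%N ->
    x y * (level_tau T s l (y - 2) * level_tau T s l (y + 1)) =
    level_tau T s l (y + 2) * level_tau T s l (y - 3)).

Lemma on_level0 T s x : (0 < K)%N -> (forall y, x y != 0) -> T = potential x ->
  on_level T s 0 x.
Proof.
move=> K0 x0 ->; have T0 y : potential x y != 0 by apply: potential_neq0.
have lvT y : (3 <= y)%N -> level_tau (potential x) s 0 y = potential x y.
  move=> y3; rewrite /level_tau add0n; case: (_ != _); first exact: (tau1 ce).
  exact: (tau0 ce).
split=> y hy; first by rewrite lvT //; lia.
by rewrite !lvT ?potential_coord //; lia.
Qed.

Section Step.
Variables (T : nat -> R) (s : bool) (l : nat) (x : nat -> R).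
Hypotheses (T0 : forall y, T y != 0) (lK : (l.+2 <= K)%N) (xl : on_level T s l x).
Local Notation t0 := (tau e T l).
Local Notation t1 := (tau e T l.+1).
Local Notation t2 := (tau e T l.+2).

Let ev_neq0 y : odd y = s (+) odd l -> (10 * l + 5 <= y)%N -> t0 y != 0.
Proof. by case: xl => h _ /level_tau_even <- /h. Qed.
Let od_neq0 y : odd y = ~~ (s (+) odd l) -> (10 * l + 5 <= y)%N -> t1 y != 0.
Proof. by case: xl => h _ /level_tau_odd <- /h. Qed.
Let ev_x y : odd y = s (+) odd l -> (10 * l + 10 <= y)%N ->
  x y = (t0 (y + 2) * t1 (y - 3)) / (t0 (y - 2) * t1 (y + 1)).
Proof.
case: xl => _ h oy hy; have := h y hy.
rewrite !(@level_tau_even _ _ _ (y + 2), @level_tau_even _ _ _ (y - 2), @level_tau_odd _ _ _ (y - 3),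
  @level_tau_odd _ _ _ (y + 1)); try by rewrite ?oddD ?oddB ?oy ?addbF ?addbT //; lia.
move=> <-; rewrite mulfK // mulf_neq0 ?ev_neq0 ?od_neq0 //; lia.
Qed.
Let od_x y : odd y = ~~ (s (+) odd l) -> (10 * l + 10 <= y)%N ->
  x y = (t1 (y + 2) * t0 (y - 3)) / (t1 (y - 2) * t0 (y + 1)).
Proof.
case: xl => _ h oy hy; have := h y hy.
rewrite !(@level_tau_odd _ _ _ (y + 2), @level_tau_odd _ _ _ (y - 2), @level_tau_even _ _ _ (y - 3),
  @level_tau_even _ _ _ (y + 1)); try by rewrite ?oddD ?oddB ?oy ?addbF ?addbT ?negbK //; lia.
move=> <-; rewrite mulfK // mulf_neq0 ?ev_neq0 ?od_neq0 //; lia.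
Qed.

Lemma level_product c : odd c = s (+) odd l -> (10 * l + 10 <= c)%N ->
  x c * x (c + 1)%N = (t1 (c - 3) * t1 (c + 3)) / (t1 (c - 1) * t1 (c + 1)).
Proof.
move=> oc hc; have oc1 : odd (c + 1) = ~~ (s (+) odd l) by rewrite oddD oc addbT.
rewrite ev_x // od_x //; last by lia.
have -> : (c + 1 + 2 = c + 3)%N by lia.
have -> : (c + 1 - 3 = c - 2)%N by lia.
have -> : (c + 1 - 2 = c - 1)%N by lia.
have -> : (c + 1 + 1 = c + 2)%N by lia.
have n1 : t0 (c - 2) != 0 by apply: ev_neq0; [rewrite oddB ?oc ?addbF //|]; lia.
have n2 : t0 (c + 2) != 0 by apply: ev_neq0; [rewrite oddD oc addbF|lia].
have n3 : t1 (c - 1) != 0 by apply: od_neq0; [rewrite oddB ?oc ?addbT //|]; lia.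
have n4 : t1 (c + 1) != 0 by apply: od_neq0; [rewrite oddD oc addbT|lia].
by field; rewrite n1 n2 n3 n4.
Qed.

(** The recurrence for [tau] computes the quantity by which the pentagram map divides. *)
Lemma level_defect c : odd c = s (+) odd l -> (10 * l + 10 <= c)%N ->
  [/\ 1 - x c * x (c + 1)%N = - (t2 c * t0 c) / (t1 (c - 1) * t1 (c + 1)),
      t0 c != 0, t1 (c - 1) != 0 & t1 (c + 1) != 0].
Proof.
move=> oc hc; rewrite level_product // (tau_rec ce T0 lK); last by lia.
have n3 : t1 (c - 1) != 0 by apply: od_neq0; [rewrite oddB ?oc ?addbT //|]; lia.
have n4 : t1 (c + 1) != 0 by apply: od_neq0; [rewrite oddD oc addbT|lia].
by split=> //; [field; rewrite n3 n4 | apply: ev_neq0; lia].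
Qed.

Lemma level_defect_neq0 c : odd c = s (+) odd l -> (10 * l + 10 <= c)%N ->
  (1 - x c * x (c + 1)%N != 0) = (t2 c != 0).
Proof.
move=> oc hc; have [-> n0 n1 n2] := level_defect oc hc.
by rewrite mulf_eq0 invr_eq0 oppr_eq0 !mulf_eq0 (negPf n0) (negPf n1) (negPf n2) !orbF.
Qed.

Variable x' : nat -> R.
Hypotheses
  (w1 : forall c, odd c = s (+) odd l -> (10 * l + 10 <= c)%N -> 1 - x c * x (c + 1)%N != 0)
  (x'_ev : forall y, odd y = s (+) odd l -> (3 <= y)%N ->
    x' y = x (y + 1)%N * (1 - x (y + 2)%N * x (y + 3)%N) / (1 - x (y - 2)%N * x (y - 1)%N))
  (x'_od : forall y, odd y = ~~ (s (+) odd l) -> (3 <= y)%N ->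
    x' y = x (y - 1)%N * (1 - x (y - 3)%N * x (y - 2)%N) / (1 - x (y + 1)%N * x (y + 2)%N)).

(** The coordinates of the image are [x'].  In the formulas for [x'] all values of
    [tau l] cancel. *)
Lemma on_levelS : on_level T s l.+1 x'.
Proof.
have t2n c : odd c = s (+) odd l -> (10 * l + 10 <= c)%N -> t2 c != 0.
  by move=> oc hc; rewrite -level_defect_neq0 ?w1.
have L1 y : odd y = s (+) odd l -> level_tau T s l.+1 y = t2 y.
  by move=> oy; rewrite level_tau_odd // oy /= addbN negbK.
have L0 y : odd y = ~~ (s (+) odd l) -> level_tau T s l.+1 y = t1 y.
  by move=> oy; rewrite level_tau_even // oy /= addbN.
split=> y hy.
  case: (eqVneq (odd y) (s (+) odd l)) => oy; first by rewrite L1 // t2n //; lia.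
  have oy' : odd y = ~~ (s (+) odd l) by move: oy; case: (odd y); case: (s (+) _).
  by rewrite L0 // od_neq0 //; lia.
have y4 : (4 <= y)%N by lia.
have hy2 : (10 * l + 10 <= y + 2)%N by lia.
have hy1 : (10 * l + 10 <= y + 1)%N by lia.
have hy1' : (10 * l + 10 <= y - 1)%N by lia.
have hy2' : (10 * l + 10 <= y - 2)%N by lia.
have hy3' : (10 * l + 10 <= y - 3)%N by lia.
have def c : odd c = s (+) odd l -> (10 * l + 10 <= c)%N -> [/\
    1 - x c * x (c + 1)%N = - (t2 c * t0 c) / (t1 (c - 1) * t1 (c + 1)),
    t0 c != 0, t1 (c - 1) != 0, t1 (c + 1) != 0 & t2 c != 0].
  by move=> oc hc; have [? ? ? ?] := level_defect oc hc; split=> //; apply: t2n.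
case: (eqVneq (odd y) (s (+) odd l)) => oy.
  have [oy1 _ oy2 oy2' oy3'] := label_parity oy y4.
  rewrite x'_ev ?(ltnW y4) //.
  rewrite (L1 (y - 2)%N) // (L0 (y + 1)%N) // (L1 (y + 2)%N) // (L0 (y - 3)%N) //.
  rewrite od_x //.
  have [+ n1 n2 n3 n4] := def (y + 2)%N oy2 hy2.
  have [+ n1' n2' n3' n4'] := def (y - 2)%N oy2' hy2'.
  rewrite !(above1 y4) !(around2 y4) in n2 n3 n2' n3' * => -> ->.
  by field; rewrite n1 n2 n3 n1' n2' n3' n4'.
have oy' : odd y = ~~ (s (+) odd l) by move: oy; case: (odd y); case: (s (+) _).
have [oy1 oy1' oy2 oy2' oy3'] := label_parity oy' y4.
rewrite negbK in oy1 oy1' oy3'.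
rewrite x'_od ?(ltnW y4) //.
rewrite (L0 (y - 2)%N) // (L1 (y + 1)%N) // (L0 (y + 2)%N) // (L1 (y - 3)%N) //.
rewrite ev_x //.
have [+ n1 n2 n3 n4] := def (y + 1)%N oy1 hy1.
have [+ n1' n2' n3' n4'] := def (y - 3)%N oy3' hy3'.
rewrite !(below1 y4) !(above1 y4) !(around3 y4) in n2 n3 n2' n3' * => -> ->.
by field; rewrite n1 n2 n3 n1' n2' n3' n4.
Qed.
End Step.
End Levels.

Section Iterates.
Variable R : realType.
Variables (e : nat -> lexpr R site) (K : nat).
Hypothesis ce : condensation e K.
Variables (n : nat).
Hypothesis n0 : (0 < n)%N.
Implicit Types (A : polygon R) (s : bool).

Definition labelled s A (y : nat) : R := xcoord s A y%:Z.

Lemma labelled_neq0 s A y : twisted s n A -> labelled s A y != 0.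
Proof. by move=> tA; apply: xcoord_neq0 tA. Qed.

Lemma labelled_step s A : twisted s n A -> twisted (~~ s) n (pentagram A) ->
  (forall y, odd y = s -> (3 <= y)%N -> labelled (~~ s) (pentagram A) y =
    labelled s A (y + 1) * (1 - labelled s A (y + 2) * labelled s A (y + 3)) /
    (1 - labelled s A (y - 2) * labelled s A (y - 1))) /\
  (forall y, odd y = ~~ s -> (3 <= y)%N -> labelled (~~ s) (pentagram A) y =
    labelled s A (y - 1) * (1 - labelled s A (y - 3) * labelled s A (y - 2)) /
    (1 - labelled s A (y + 1) * labelled s A (y + 2))).
Proof.
move=> tA tB; rewrite /labelled; split=> y oy y3.
  rewrite (xcoord_pentagram_l tA tB) ?parity_nat // !PoszD.
  by rewrite -!subzn //; lia.
rewrite (xcoord_pentagram_r tA tB) ?parity_nat // !PoszD.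
by rewrite -!subzn //; lia.
Qed.

Lemma labelled_defect s A c : twisted s n A -> twisted (~~ s) n (pentagram A) ->
  odd c = s -> 1 - labelled s A c * labelled s A (c + 1) != 0.
Proof.
move=> tA tB oc; have := twisted_pentagram_wc tA tB (c := c%:Z); rewrite parity_nat oc.
by move=> /(_ erefl); rewrite (wcE A (oc : parity c%:Z = s)) -PoszD subr_eq0 eq_sym.
Qed.

Section Domain.
Variables (s : bool) (A : polygon R).
Hypothesis tA : twisted s n A.
Let T := potential (labelled s A).
Let T0 y : T y != 0.
Proof. by apply: potential_neq0 => z; apply: labelled_neq0. Qed.

(** By induction along the iterates, whose coordinates are related by the explicit
    form of the pentagram map. *)
Lemma iter_dom_level k l : (k < K)%N -> iter_dom s n k A -> (l <= k)%N ->
  on_level e T s l (labelled (s (+) odd l) (iter l (@pentagram R) A)).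
Proof.
move=> kK dA; elim: l => [|l IH] lk.
  rewrite addbF; apply: (on_level0 ce) => //; first by apply: leq_ltn_trans kK.
  by move=> y; apply: labelled_neq0.
have tl := dA l (ltnW lk); have tl1 := dA l.+1 lk; rewrite /= addbN in tl1.
have [h1 h2] := labelled_step tl tl1.
rewrite /= addbN; apply: (on_levelS ce T0 _ (IH (ltnW lk)) _ h1 h2).
  by apply: leq_ltn_trans kK.
by move=> c oc _; apply: labelled_defect.
Qed.

(** The construction of the iterates breaks down only where one of the later [tau]
    vanishes; by periodicity of the coordinates one period of labels suffices. *)
Lemma iter_dom_criterion k b : (k < K)%N -> (10 * k + 10 <= b)%N ->
  (forall l y, (l < k)%N -> odd y = s (+) odd l -> (b <= y < b + 2 * n)%N ->
     tau e T l.+2 y != 0) ->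
  iter_dom s n k A.
Proof.
move=> kK kb; elim: k kK kb => [|k IH] kK kb nv.
  by move=> l; rewrite leqn0 => /eqP->; rewrite addbF.
have dA : iter_dom s n k A.
  by apply: IH; [apply: ltnW|lia|move=> l y lk; apply: nv; apply: leq_trans lk _].
move=> l; rewrite leq_eqVlt ltnS => /orP[/eqP->|]; last exact: dA.
have tk := dA k (leqnn k); rewrite /= addbN.
apply: twisted_pentagram => // c pc; rewrite (wcE _ pc).
have [y [q [by1 y2 E]]] := @label_of (2 * n) c b ltac:(lia).
have xP := periodicZ (fun j => xcoord_periodic j tk).
have oy : odd y = s (+) odd k.
  by rewrite -parity_nat E parityD pc PoszM -mulrA parityM2 addbF.
have lev := iter_dom_level (ltnW kK) dA (leqnn k).
have := level_defect_neq0 ce T0 _ lev oy; rewrite nv ?by1 ?y2 //.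
rewrite /labelled PoszD E xP addrAC xP subr_eq0 eq_sym; apply; lia.
Qed.
End Domain.

Lemma coordinate_formula s k A c : (k < K)%N -> iter_dom s n k A ->
  (10 * k + 10 <= c)%N ->
  let L := level_tau e (potential (labelled s A)) s k in
  [/\ L (c - 2)%N != 0, L (c + 1)%N != 0 &
      labelled (s (+) odd k) (iter k (@pentagram R) A) c *
        (L (c - 2)%N * L (c + 1)%N) = L (c + 2)%N * L (c - 3)%N].
Proof.
move=> kK dA hc L; have tA := dA 0%N isT; rewrite addbF in tA.
have [L0 Lx] := iter_dom_level tA kK dA (leqnn k).
by split; [apply: L0|apply: L0|apply: Lx]; lia.
Qed.

Local Notation N := (2 * n)%N.

Lemma idx_subproof (j : int) : (`|((j - 1) %% N)%Z| < N)%N.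
Proof.
have N0 : N%:Z != 0 by rewrite eqz_nat -lt0n; lia.
have := modz_ge0 (j - 1) N0; have : ((j - 1) %% N)%Z < N by rewrite ltz_pmod //; lia.
by move: (_ %% _)%Z => r; lia.
Qed.

Definition index_of (j : int) : 'I_N := Ordinal (idx_subproof j).

Lemma idxP j : exists q, (index_of j).+1%:Z = j + N%:Z * q.
Proof.
have N0 : N%:Z != 0 by rewrite eqz_nat -lt0n; lia.
exists (- ((j - 1) %/ N)%Z); rewrite /= intS gez0_abs ?modz_ge0 //.
have := divz_eq (j - 1) N; move: (_ %% _)%Z (_ %/ _)%Z => r q h.
by rewrite mulrN [N%:Z * q]mulrC; move: (q * N)%Z h => z; lia.
Qed.

Lemma idxS (i : 'I_N) : index_of i.+1%:Z = i.
Proof.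
apply: val_inj; rewrite /= intS addrAC subrr add0r modz_small ?absz_nat //.
by rewrite ltz_nat ltn_ord.
Qed.

Lemma idxD j : index_of (j + N%:Z) = index_of j.
Proof. by apply: val_inj; rewrite /= addrAC modzDr. Qed.

(** The periodic sequence with entries [x]; the index [i] carries the label [i + 1]. *)
Definition sequence_of (x : 'I_N -> R) (y : nat) : R := x (index_of y%:Z).

Lemma extP (X : nat -> R) : (forall y, X (y + N)%N = X y) ->
  sequence_of (fun i => X i.+1) = X.
Proof.
move=> XP; apply/funext => y; rewrite /sequence_of.
have XPn m z : X (z + m * N)%N = X z.
  by elim: m => [|m IH]; rewrite ?addn0 // mulSn [(N + _)%N]addnC addnA XP.
have [q] := idxP y; set i := (index_of y : nat).
case: q => q; rewrite ?NegzE => E.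
  by rewrite -(XPn q y); congr X; lia.
by rewrite -(XPn q.+1 i.+1); congr X; lia.
Qed.

Lemma ext_coords s A : twisted s n A -> sequence_of (coords s A) = labelled s A.
Proof.
move=> tA; apply/funext => y; rewrite /sequence_of /coords /labelled; have [q ->] := idxP y.
by rewrite (periodicZ (fun j => xcoord_periodic j tA)).
Qed.

Lemma coords_neq0 s A : twisted s n A -> nz (coords s A : 'I_N -> R).
Proof. by move=> tA i; apply: xcoord_neq0 tA. Qed.

Lemma coords_surjective s (x : 'I_N -> R) : nz x ->
  exists2 A, twisted s n A & coords s A = x.
Proof.
move=> nx; have [||A [tA xA]] := @polygon_existence R s n (fun j => x (index_of j)) n0 => //.
  by move=> j; rewrite idxD.
by exists A => //; apply/funext => i; rewrite /coords xA idxS.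
Qed.

Definition tau_of k y (x : 'I_N -> R) : R := tau e (potential (sequence_of x)) k y.

Lemma ulau_potential y : ulau (fun x : 'I_N -> R => potential (sequence_of x) y).
Proof.
apply: ulau_prod => k; apply: ulau_prod => t; exact: ulau_var.
Qed.

Lemma lau_tau_of k y : lau (tau_of k y).
Proof.
apply: (lau_comp (s := fun v x => fold (potential (sequence_of x)) (y - 3 * k) v)
  (lau_Pv e k 0 0)) => v; exact: ulau_potential.
Qed.

Definition level_of s l y (x : 'I_N -> R) : R := level_tau e (potential (sequence_of x)) s l y.

Lemma lau_level_of s l y : lau (level_of s l y).
Proof. exact: lau_tau_of. Qed.

End Iterates.

(** * Subvarieties of the coordinate torus *)

Section Polynomials.
Variables (R : realType) (N : nat).

Lemma lau_meval (p : {mpoly R[N]}) : lau (fun x : 'I_N -> R => p.@[x]).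
Proof.
have l : lau (fun x : 'I_N -> R =>
    \sum_(m <- msupp p) p@_m * \prod_(i <- index_enum 'I_N) x i ^+ m i).
  apply: lau_sum => m; apply: lauM; first exact: lau_cst.
  by apply: lau_prod => i; have [] := ulauX (m i) (ulau_var R i).
by apply: eq_lau l => x _; rewrite mevalE.
Qed.

(** The domain of definition of rational maps is expressed by quotients of polynomials,
    so Laurent functions have to be written as such. *)
Lemma lau_fraction (f : ('I_N -> R) -> R) : lau f ->
  exists p d : {mpoly R[N]}, forall x, nz x -> d.@[x] != 0 /\ f x = p.@[x] / d.@[x].
Proof.
move=> [e fe].
suff [p [d h]] : exists p d : {mpoly R[N]}, forall x, nz x ->
    d.@[x] != 0 /\ ev x e = p.@[x] / d.@[x].
  by exists p, d => x nx; rewrite fe //; apply: h.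
elim: e {f fe} => [c|i|i|e1 [p1 [d1 h1]] e2 [p2 [d2 h2]]|e1 [p1 [d1 h1]] e2 [p2 [d2 h2]]].
- by exists c%:MP, 1 => x nx; rewrite meval1 mevalC divr1 oner_neq0.
- by exists 'X_i, 1 => x nx; rewrite meval1 mevalXU divr1 oner_neq0.
- by exists 1, 'X_i => x nx; rewrite meval1 mevalXU div1r nx.
- exists (p1 * d2 + p2 * d1), (d1 * d2) => x nx; have [n1 E1] := h1 x nx.
  have [n2 E2] := h2 x nx; rewrite mevalD !mevalM mulf_neq0 //=; split=> //.
  by rewrite E1 E2; field; rewrite n1 n2.
- exists (p1 * p2), (d1 * d2) => x nx; have [n1 E1] := h1 x nx.
  have [n2 E2] := h2 x nx; rewrite !mevalM mulf_neq0 //=; split=> //.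
  by rewrite E1 E2; field; rewrite n1 n2.
Qed.
End Polynomials.

Section Subvariety.
Variable R : realType.
Variables (e : nat -> lexpr R site) (K : nat).
Hypothesis ce : condensation e K.
Variables (n : nat).
Hypothesis n0 : (0 < n)%N.
Local Notation N := (2 * n)%N.
Local Notation ext := (sequence_of n0).
Local Notation idx := (index_of n0).
Local Notation Tau := (tau_of e n0).
Local Notation Lv := (level_of e n0).
Implicit Types (x : 'I_N -> R).

Lemma ext_period x y : ext x (y + N) = ext x y.
Proof. by rewrite /sequence_of PoszD idxD. Qed.

Lemma ext_periodX x y k : ext x (y + k * N) = ext x y.
Proof. by elim: k => [|k IH]; rewrite ?addn0 // mulSn [(N + _)%N]addnC addnA ext_period. Qed.

Lemma ext_mod x y y' : y = y' %[mod N] -> ext x y = ext x y'.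
Proof.
by move=> E; rewrite (divn_eq y N) (divn_eq y' N) E ![(_ * N + _)%N]addnC !ext_periodX.
Qed.

Lemma ext_neq0 x y : nz x -> ext x y != 0.
Proof. by apply. Qed.

Lemma extS x (i : 'I_N) : ext x i.+1 = x i.
Proof. by rewrite /sequence_of idxS. Qed.

Section Sites.
Variable Z : pred nat.

(** The equations of the subvariety with singular sites [Z]. *)
Definition on_sites x := forall y, Z y -> ext x y * ext x y.+1 = 1.

(** At a site the second coordinate is forced to be the inverse of the first; the
    index [i] carries the label [i + 1], hence the test [Z i]. *)
Definition glue x (i : 'I_N) : R := if Z i then (ext x i)^-1 else x i.

Lemma ulau_glue i : ulau (glue ^~ i).
Proof.
by rewrite /glue; case: (Z i); [apply: ulauV|]; apply: ulau_var.
Qed.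

Lemma nz_glue x : nz x -> nz (glue x).
Proof. by move=> nx i; have [_ _] := ulau_glue i; apply. Qed.

Lemma lau_glue f : lau f -> lau (fun x => f (glue x)).
Proof. by move=> lf; apply: (lau_comp (s := fun i x => glue x i) lf) => i; apply: ulau_glue. Qed.

Lemma glue_id x : nz x -> on_sites x -> glue x = x.
Proof.
move=> nx sx; apply/funext => i; rewrite /glue; case: ifP => // Zi.
rewrite -(extS x i); apply: (mulfI (ext_neq0 i nx)).
by rewrite sx // divff // ext_neq0.
Qed.

Variable b : bool.
Hypotheses (Zper : forall y, Z (y + N)%N = Z y) (Zodd : forall y, Z y -> odd y = b).

Let ZX y k : Z (y + k * N)%N = Z y.
Proof.
elim: k => [|k IH]; first by rewrite mul0n addn0.
by rewrite mulSn addnCA addnA [(N + y)%N]addnC addnAC Zper.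
Qed.

Let Zmod y y' : y = y' %[mod N] -> Z y = Z y'.
Proof.
by move=> E; rewrite (divn_eq y N) (divn_eq y' N) E ![(_ * N + _)%N]addnC !ZX.
Qed.

Lemma ext_glue x y : ext (glue x) y.+1 = if Z y then (ext x y)^-1 else ext x y.+1.
Proof.
rewrite {1}/sequence_of /glue; set i := idx _.
have E : i = y %[mod N].
  have [q] := idxP n0 y.+1; rewrite -/i !intS => /(congr1 (fun z => ((z - 1) %% N)%Z)).
  rewrite addrAC subrr add0r modz_nat.
  have -> : 1 + y%:Z + N%:Z * q - 1 = q * N + y by ring.
  by rewrite modzMDl modz_nat => -[].
by rewrite (Zmod E) (ext_mod x E); case: (Z y).
Qed.

Lemma on_sites_glue x : nz x -> on_sites (glue x).
Proof.
move=> nx y Zy; rewrite ext_glue Zy -ext_period.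
have [z E] : exists z, (y + N = z.+1)%N by exists (y + N).-1; lia.
have NZ : Z z = false.
  apply/negP => /Zodd oz; have := Zodd Zy.
  by have := congr1 odd E; rewrite /= oddD oz mul2n odd_double addbF; case: (odd y); case: (b).
by rewrite E ext_glue NZ -E ext_period divff // ext_neq0.
Qed.

(** Through [glue] the subvariety is the image of a torus, hence irreducible. *)
Lemma on_sites_dense f g : lau f -> lau g ->
  (exists x, [/\ nz x, on_sites x & f x != 0]) ->
  (exists x, [/\ nz x, on_sites x & g x != 0]) ->
  exists x, [/\ nz x, on_sites x, f x != 0 & g x != 0].
Proof.
move=> lf lg [x [nx sx fx]] [y [ny sy gy]].
have [||z nzz /andP[fz gz]] := lau_nonzero2 (lau_glue lf) (lau_glue lg).
- by exists x => //; rewrite glue_id.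
- by exists y => //; rewrite glue_id.
by exists (glue z); split=> //; [apply: nz_glue | apply: on_sites_glue].
Qed.

Lemma on_sites_prod (T : eqType) (r : seq T) (F : T -> ('I_N -> R) -> R) :
  (forall t, lau (F t)) ->
  {in r, forall t, exists x, [/\ nz x, on_sites x & F t x != 0]} ->
  exists x, [/\ nz x, on_sites x & \prod_(t <- r) F t x != 0].
Proof.
move=> lF hF.
have [|t tr|z nzz hz] := lau_prod_nonzero (r := r) (F := fun t x => F t (glue x)).
- by move=> t; apply: lau_glue.
- by have [x [nx sx fx]] := hF t tr; exists x => //; rewrite glue_id.
by exists (glue z); split=> //; [apply: nz_glue | apply: on_sites_glue].
Qed.

Lemma tau_of_nonvanishing k q : (2 <= k <= K)%N -> (6 * k <= N + 10)%N ->
  (forall y, Z y -> odd y = odd q) ->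
    (exists2 f, (f <= 2 * k - 3)%N & forall u, Z (q + 6 + u.*2)%N -> (u + 6 <= 3 * k)%N ->
       (f <= u)%N && (u + 3 <= f + k)%N) \/
    (forall u, Z (q + 6 + u.*2)%N -> (u + 6 <= 3 * k)%N ->
       (u + 3 < k)%N || (end_label k <= u)%N) ->
  exists x, [/\ nz x, on_sites x & Tau k (q + 3 * k) x != 0].
Proof.
move=> kK Nk Zq hZ.
have [||X [X0 XP XZ nv]] := @tau_nonvanishing R e K ce N k q Z kK _ _ Nk Zper Zq hZ.
- by lia.
- by rewrite mul2n odd_double.
exists (fun i : 'I_N => X i.+1); split; first by move=> i; apply: X0.
  by move=> y /XZ; rewrite (extP n0 XP).
by rewrite /tau_of (extP n0 XP).
Qed.
End Sites.
End Subvariety.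

Lemma eq_double_mod n u v : (u < n)%N -> (v < 2 * n)%N ->
  (u.*2 = v.*2 %[mod 2 * n])%N -> u = v \/ (u + n)%N = v.
Proof.
move=> un vn; rewrite [LHS]modn_small; last by lia.
have [h|h] := ltnP v n; first by rewrite modn_small => [E|]; [left|]; lia.
rewrite (_ : v.*2 = (v - n).*2 + 2 * n)%N; last by lia.
by rewrite modnDr modn_small => [E|]; [right|]; lia.
Qed.

Lemma half_offset a y n : (a <= y)%N -> (y < a + 2 * n)%N -> odd y = odd a ->
  exists2 u, (u < n)%N & (a + u.*2)%N = y.
Proof. by move=> h1 h2 h3; exists ((y - a)./2); lia. Qed.

Section Runs.
Variable R : realType.
Variables (e : nat -> lexpr R site) (K : nat).
Hypothesis ce : condensation e K.
Variables (n : nat).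
Hypothesis n0 : (0 < n)%N.
Local Notation N := (2 * n)%N.
Local Notation ext := (sequence_of n0).
Local Notation Tau := (tau_of e n0).
Implicit Types (x : 'I_N -> R).

Variable c0 : nat.
(** A run of [mu] consecutive sites, repeated with the period of the labels. *)
Definition run (mu : nat) : pred nat :=
  fun y => [exists t : 'I_mu, y == c0 + (t : nat).*2 %[mod N]]%N.

Lemma run_intro mu t : (t < mu)%N -> run mu (c0 + t.*2)%N.
Proof. by move=> tm; apply/existsP; exists (Ordinal tm). Qed.

Lemma run_period mu y : run mu (y + N)%N = run mu y.
Proof. by rewrite /run modnDr. Qed.

Lemma run_odd mu y : run mu y -> odd y = odd c0.
Proof.
case/existsP => t /eqP /(congr1 odd); rewrite !odd_mod ?mul2n ?odd_double //.
by rewrite oddD odd_double addbF.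
Qed.

Lemma run_sub mu mu' y : (mu <= mu')%N -> run mu y -> run mu' y.
Proof.
by move=> h /existsP[t tP]; apply/existsP; exists (widen_ord h t).
Qed.

Lemma on_run_sub mu mu' x : (mu <= mu')%N ->
  on_sites n0 (run mu') x -> on_sites n0 (run mu) x.
Proof. by move=> h sx y /(run_sub h); apply: sx. Qed.

(** The window of a determinant is shorter than a period, so the sites meet it in the
    run starting at [u0] or in the one before. *)
Lemma run_position mu q u0 u : (mu <= n)%N -> (u0 < n)%N -> (u < n)%N ->
  (q + 6 + u0.*2 = c0 %[mod N])%N -> run mu (q + 6 + u.*2)%N ->
  exists2 t, (t < mu)%N & u = (u0 + t)%N \/ (u + n = u0 + t)%N.
Proof.
move=> mn u0n un E /existsP[[t tm] /= /eqP E1].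
have /eqP : (q + 6 + u.*2 = q + 6 + u0.*2 + t.*2 %[mod N])%N.
  by rewrite E1 -[in LHS]modnDml -E modnDml.
rewrite -(addnA (q + 6)) eqn_modDl -doubleD => /eqP E2; exists t => //.
apply: eq_double_mod E2 => //; move: {E E1} mn u0n tm; lia.
Qed.

Lemma run_offset q : odd q = odd c0 ->
  exists2 u0, (u0 < n)%N & (q + 6 + u0.*2 = c0 %[mod N])%N.
Proof.
move=> oq; have [y [z [h1 h2 E]]] := @label_of N c0 (q + 6) ltac:(lia).
have Em : (y = c0 %[mod N])%N.
  by have := congr1 (fun w => (w %% N)%Z) E; rewrite addrC mulrC modzMDl !modz_nat => -[].
have oy : odd y = odd q.
  by have := congr1 odd Em; rewrite !odd_mod ?mul2n ?odd_double // oq.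
have [|u0 u0n Eu] := half_offset h1 h2; first by rewrite oy oddD addbF.
by exists u0; rewrite // Eu.
Qed.

(** The run meets the window in one strip, unless it wraps around the period; in that
    case it meets the window at both ends only. *)
Lemma tau_run_generic mu k y : (3 * mu + 4 <= n)%N -> (mu + 2 <= k <= mu + 3)%N ->
  (k <= K)%N -> (3 * k <= y)%N -> odd y = odd (c0 + k) ->
  exists x, [/\ nz x, on_sites n0 (run mu) x & Tau k y x != 0].
Proof.
move=> mn kmu kK ky oy; rewrite -(subnK ky); set q := (y - 3 * k)%N.
have oq : odd q = odd c0.
  by rewrite /q oddB // oy oddD oddM; case: (odd c0); case: (odd k).
have [u0 u0n Eu] := run_offset oq.
have pos u : run mu (q + 6 + u.*2)%N -> (u + 6 <= 3 * k)%N -> exists2 t, (t < mu)%N &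
    u = (u0 + t)%N \/ (u + n = u0 + t)%N.
  move=> ru uk; have un : (u < n)%N by clear -uk kmu mn; lia.
  by apply: run_position Eu ru => //; clear -mn; lia.
clear Eu.
apply: (@tau_of_nonvanishing R e K ce n n0 (run mu) (@run_period mu)) => //; try lia.
  by move=> z /run_odd ->.
have [h|h] := leqP (u0 + mu) n; [left|right].
  exists (minn u0 (2 * k - 3)); first by rewrite geq_minr.
  by move=> u ru uk; have [t tm] := pos u ru uk; clear -uk tm kmu mn h; rewrite minnE; lia.
by move=> u ru uk; have [t tm] := pos u ru uk; clear -uk tm kmu mn h u0n; rewrite /end_label; lia.
Qed.

(** On the level at which [tau] vanishes at every fourth label, the preceding label
    of the same progression is still free: the run lies at the far end of the window. *)
Lemma tau_run_adjacent mu : (0 < mu)%N -> (3 * mu + 4 <= n)%N -> (mu.+1 <= K)%N ->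
  (4 * mu + 6 <= c0)%N ->
  exists x, [/\ nz x, on_sites n0 (run mu) x & Tau mu.+1 (c0 - mu - 3) x != 0].
Proof.
move=> mu0 mn kK hc; rewrite (_ : c0 - mu - 3 = c0 - 4 * mu - 6 + 3 * mu.+1)%N; last by lia.
set q := (c0 - 4 * mu - 6)%N.
apply: (@tau_of_nonvanishing R e K ce n n0 (run mu) (@run_period mu)) => //; try lia.
  by move=> z /run_odd ->; rewrite /q; lia.
left; exists (2 * mu.+1 - 3)%N => // u ru uk.
have [|||||t tm] := @run_position mu q (2 * mu) u => //; try lia.
by congr (_ %% _)%N; rewrite /q; lia.
Qed.

(** The window of this label contains no site. *)
Lemma tau_run1_adjacent : (7 <= n)%N -> (2 <= K)%N -> (2 <= c0)%N ->
  exists x, [/\ nz x, on_sites n0 (run 1) x & Tau 2 (c0 + 4) x != 0].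
Proof.
move=> n7 K2 hc; rewrite (_ : c0 + 4 = c0 - 2 + 3 * 2)%N; last by lia.
set q := (c0 - 2)%N.
apply: (@tau_of_nonvanishing R e K ce n n0 (run 1) (@run_period 1)) => //; try lia.
  by move=> z /run_odd ->; rewrite /q; lia.
left; exists 0%N => // u ru uk.
have [|||||t tm] := @run_position 1 q (n - 2) u => //; try lia.
by rewrite (_ : q + 6 + _ = c0 + N)%N ?modnDr // /q; lia.
Qed.

Lemma tau_generic k y : (2 <= k <= K)%N -> (6 * k <= N + 10)%N -> (3 * k <= y)%N ->
  exists2 x, nz x & Tau k y x != 0.
Proof.
move=> kK Nk ky; rewrite -(subnK ky).
have [|||x [nx _ hx]] := @tau_of_nonvanishing R e K ce n n0 pred0 _ k (y - 3 * k)%N kK Nk.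
- by [].
- by [].
- by right.
by exists x.
Qed.

(** The sites are the places of a column of the folded data. *)
Lemma tau_run_vanish mu j x : nz x -> on_sites n0 (run mu) x -> (mu < K)%N ->
  (j < mu)%N -> (4 * mu + 6 <= c0)%N -> Tau mu.+1 (c0 + 3 * mu - 3 - 4 * j) x = 0.
Proof.
move=> nx sx mK jm hc; rewrite /tau_of; set X := ext x; set T := potential X.
have X0 y : X y != 0 by apply: nx.
have T0 y : T y != 0 by apply: potential_neq0.
pose q := (c0 - 6 - 4 * j)%N.
have := Pv_fold e T mu.+1 q 0 0.
have -> : (q + (0 + 0.*2).*2 + 3 * mu.+1 = c0 + 3 * mu - 3 - 4 * j)%N by rewrite /q; lia.
move=> <-; apply: (Pv_vanish ce (j0 := j)) => //.
- by apply/andP; split=> //; lia.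
- by move=> v; apply: T0.
move=> i im; rewrite Pv_fold.
have -> : (q + (i + j.*2).*2 + 3 * 2 = c0 + i.*2)%N by rewrite /q; lia.
apply: (tau2_eq0 ce T0); try lia.
have := sx _ (run_intro im); rewrite -/X; set y := (c0 + i.*2)%N => E.
have y6 : (6 <= y)%N by rewrite /y; lia.
have h1 := @potential_coord R X y ltac:(lia).
have := @potential_coord R X y.+1 ltac:(lia); rewrite -/T in h1 *.
have -> : (y.+1 + 2 = y + 3)%N by lia.
have -> : (y.+1 - 3 = y - 2)%N by lia.
have -> : (y.+1 - 2 = y - 1)%N by lia.
have -> : (y.+1 + 1 = y + 2)%N by lia.
move=> h2; have n1 : T (y + 2)%N * T (y - 2)%N != 0 by rewrite mulf_neq0.
apply: (mulIf n1).
transitivity ((T (y + 2)%N * T (y - 3)%N) * (T (y + 3)%N * T (y - 2)%N)); first by ring.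
rewrite h1 h2.
transitivity ((X y * X y.+1) * (T (y - 2)%N * T (y + 1)%N * (T (y - 1)%N * T (y + 2)%N))).
  by ring.
by rewrite E mul1r; ring.
Qed.
End Runs.

(** * Singularities and their confinement *)

Section Values.
Variable R : realType.
Variables (e : nat -> lexpr R site) (K : nat).
Hypothesis ce : condensation e K.
Variables (n : nat).
Hypothesis n0 : (0 < n)%N.
Local Notation N := (2 * n)%N.
Local Notation ext := (sequence_of n0).
Local Notation idx := (index_of n0).
Local Notation Tau := (tau_of e n0).
Local Notation Lv := (level_of e n0).
Implicit Types (x : 'I_N -> R).

(** The factors of a product whose nonvanishing allows the construction of the
    iterates. *)
Definition window_factor s (v : nat * nat) x : R :=
  if odd v.2 == s (+) odd v.1 then Tau v.1.+2 v.2 x else 1.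

Definition label_window k b : seq (nat * nat) :=
  [seq (l, y) | l <- iota 0 k, y <- iota b N].

Lemma lau_window_factor s v : lau (window_factor s v).
Proof.
rewrite /window_factor; case: (_ == _); first exact: lau_tau_of.
by apply: lau_cst.
Qed.

Lemma iter_dom_window s k b A : twisted s n A -> (k < K)%N -> (10 * k + 10 <= b)%N ->
  \prod_(v <- label_window k b) window_factor s v (coords s A) != 0 -> iter_dom s n k A.
Proof.
move=> tA kK kb; rewrite prodf_seq_neq0 => /allP h.
apply: (iter_dom_criterion ce n0 tA kK kb) => l y lk oy /andP[yb yN].
have := h (l, y); rewrite /window_factor /= oy eqxx.
rewrite /tau_of ext_coords //; apply; apply/allpairsP; exists (l, y).
by rewrite !mem_iota; split=> //=; rewrite yb.
Qed.

Lemma window_generic s k b : (k < K)%N -> (6 * k.+1 <= N + 10)%N ->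
  (10 * k + 10 <= b)%N ->
  exists2 x, nz x & \prod_(v <- label_window k b) window_factor s v x != 0.
Proof.
move=> kK kN kb; apply: lau_prod_nonzero; first exact: lau_window_factor.
move=> v /allpairsP[[l y] [/=]]; rewrite !mem_iota => lk yb ->.
rewrite /window_factor /=; case: (_ == _).
  by apply: (tau_generic ce); move: lk yb kK kN kb; clear; lia.
by exists (fun _ => 1) => [i|]; rewrite oner_neq0.
Qed.

(** A regular value is computed by polynomials that represent the iterate wherever it
    is constructed.  Such polygons are dense, so the representation agrees with
    the ratio of values of [tau] as an identity of Laurent functions. *)
Lemma value_identity s k A B c : (k < K)%N -> (6 * k.+1 <= N + 10)%N ->
  (10 * k + 10 <= c)%N -> twisted s n A -> Tk_value s n k A B ->
  exists f g, [/\ lau f, forall x, nz x ->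
      f x * (Lv s k (c - 2) x * Lv s k (c + 1) x) =
      Lv s k (c + 2) x * Lv s k (c - 3) x * g x,
    g (coords s A) != 0 &
    labelled (s (+) odd k) B c = f (coords s A) / g (coords s A)].
Proof.
move=> kK kN kc tA [tB [f [g [gA fgA fg]]]]; pose j := idx c.
have lf (p : {mpoly R[N]}) := lau_meval p.
exists (fun x => (f j).@[x]), (fun x => (g j).@[x]); split=> //; last first.
  by rewrite -(ext_coords n0 tB) -fgA.
have lF : lau (fun x => (f j).@[x] * (Lv s k (c - 2) x * Lv s k (c + 1) x) -
    Lv s k (c + 2) x * Lv s k (c - 3) x * (g j).@[x]).
  by apply: lauB; do ?apply: lauM; (exact: lf || exact: lau_level_of).
have lG : lau (fun x => \prod_(i <- index_enum 'I_N) (g i).@[x]).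
  by apply: lau_prod => i; apply: lf.
have lH : lau (fun x => \prod_(v <- label_window k (10 * k + 10)) window_factor s v x).
  by apply: lau_prod => v; apply: lau_window_factor.
move=> x nx; apply/eqP; rewrite -subr_eq0; apply/eqP.
apply: (lau_eq0_dense lF (lauM lG lH)) => //.
  have [||D nD /andP[h1 h2]] := lau_nonzero2 lG lH.
  - exists (coords s A); first exact: coords_neq0.
    by rewrite prodf_seq_neq0; apply/allP => i _; rewrite gA.
  - by apply: window_generic.
  by exists D => //; rewrite mulf_neq0.
move=> D nD; rewrite mulf_eq0 negb_or => /andP[hg hw].
have [A' tA' EA'] := coords_surjective n0 s nD.
have dA' : iter_dom s n k A'.
  by apply: (@iter_dom_window s k (10 * k + 10)) => //; rewrite EA'.
have gA' i : (g i).@[coords s A'] != 0.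
  by move: hg; rewrite EA' prodf_seq_neq0 => /allP /(_ i (mem_index_enum i)).
have := fg A' dA' gA' j.
have tk := dA' k (leqnn k); have [L1 L2 L3] := coordinate_formula ce n0 kK dA' kc.
rewrite -[coords _ _ j]/(ext (coords _ _) c) ext_coords // EA'.
rewrite -(ext_coords n0 tA') EA' in L1 L2 L3 => Ef.
have gj : (g j).@[D] != 0 by rewrite -EA'.
rewrite Ef in L3.
by rewrite /level_of -L3 [X in _ - X]mulrAC divfK // subrr.
Qed.

(** On the subvariety the numerator of the ratio vanishes and its denominator does not
    vanish identically, so the polynomial representing the numerator of the
    regular value vanishes on the subvariety, which is irreducible. *)
Lemma singular_criterion (Z : pred nat) s k (A : polygon R) c : (k < K)%N -> (6 * k.+1 <= N + 10)%N ->
  (10 * k + 10 <= c)%N -> twisted s n A ->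
  (forall y, Z (y + N)%N = Z y) -> (exists b, forall y, Z y -> odd y = b) ->
  on_sites n0 Z (coords s A) ->
  (forall x, nz x -> on_sites n0 Z x -> Lv s k (c + 2) x * Lv s k (c - 3) x = 0) ->
  (exists x, [/\ nz x, on_sites n0 Z x & Lv s k (c - 2) x != 0]) ->
  (exists x, [/\ nz x, on_sites n0 Z x & Lv s k (c + 1) x != 0]) ->
  ~ Tk_nonsingular s n k A.
Proof.
move=> kK kN kc tA ZP [b Zb] sA num den1 den2 [B vB].
have [tB _] := vB; have [f [g [lf fg gA xB]]] := value_identity kK kN kc tA vB.
have nA := coords_neq0 tA.
have /eqP := labelled_neq0 c tB; rewrite xB; apply.
suff -> : f (coords s A) = 0 by rewrite mul0r.
pose G x := Lv s k (c - 2) x * Lv s k (c + 1) x.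
have lG : lau G by apply: lauM; apply: lau_level_of.
have [x [nx sx h1 h2]] := on_sites_dense ZP Zb (lau_level_of e n0 s k (c - 2))
  (lau_level_of e n0 s k (c + 1)) den1 den2.
rewrite -(glue_id nA sA).
apply: (lau_eq0_dense (lau_glue n0 Z lf) (lau_glue n0 Z lG)) => //.
  by exists x => //; rewrite glue_id // /G mulf_neq0.
move=> D nD; have nD' := nz_glue n0 Z nD.
have := fg _ nD'; rewrite num // ?mul0r.
  by move/eqP; rewrite mulf_eq0 => /orP[/eqP-> //|/eqP E]; rewrite /G E eqxx.
exact: (on_sites_glue n0 ZP Zb nD).
Qed.

Variables (c0 m : nat).
Hypotheses (m0 : (0 < m)%N) (mn : (3 * m + 4 <= n)%N) (mK : (m + 3 <= K)%N)
  (c0_large : (100 * m + 100 <= c0)%N).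
Local Notation s := (odd c0).
Local Notation sites := (run n c0 m).

(** The iterate [k] is singular already on the larger subvariety of the first [k - 1]
    sites, whose last vanishing [tau] is [tau k].  For [k = 1] the first site is
    used, where the map itself has a zero numerator. *)
Lemma run_singular (A : polygon R) k : (1 <= k <= m + 1)%N -> twisted s n A ->
  on_sites n0 sites (coords s A) -> ~ Tk_nonsingular s n k A.
Proof.
move=> /andP[k1 km] tA sA; have [k2|k2] := leqP k 1.
  have -> : k = 1%N by lia.
  have o3 : odd (c0 + 3) = ~~ s by rewrite oddD addbT.
  have s1 : s (+) odd 1 = ~~ s by rewrite addbT.
  have [x [nx sx hx]] := @tau_run1_adjacent R e K ce n n0 c0 ltac:(lia) ltac:(lia) ltac:(lia).
  apply: (@singular_criterion (run n c0 1) _ _ _ (c0 + 3)) => //; try lia.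
  - exact: run_period.
  - by exists s; apply: run_odd.
  - exact: on_run_sub sA.
  - move=> x' nx' sx'; rewrite [X in _ * X](_ : _ = 0) ?mulr0 //.
    rewrite /level_of level_tau_odd; last by rewrite s1 negbK addnK.
    have := @tau_run_vanish R e K ce n n0 c0 1 0 x' nx' sx' ltac:(lia) ltac:(lia) ltac:(lia).
    by rewrite /tau_of (_ : c0 + 3 * 1 - 3 - 4 * 0 = c0 + 3 - 3)%N //; lia.
  - exists x; split=> //; rewrite /level_of level_tau_even; last first.
      by rewrite s1 oddB ?o3 ?addbF //; lia.
    have T0 u : potential (ext x) u != 0 by apply: potential_neq0 => y; apply: nx.
    by rewrite (tau1 ce T0) //; lia.
  exists x; split=> //; rewrite /level_of level_tau_odd; last first.
    by rewrite s1 oddD o3 addbT.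
  by move: hx; rewrite /tau_of (_ : c0 + 3 + 1 = c0 + 4)%N //; lia.
have [mu [Ek mu0 mum]] : exists mu, [/\ k = mu.+1, (0 < mu)%N & (mu <= m)%N].
  by exists k.-1; split; lia.
rewrite {k k1 km k2}Ek.
have oc : odd (c0 - mu - 1) = s (+) odd mu.+1.
  rewrite oddB; last by lia.
  by rewrite oddB /= ?addbT ?addbN //; lia.
apply: (@singular_criterion (run n c0 mu) _ _ _ (c0 - mu - 1)) => //; try lia.
- exact: run_period.
- by exists s; apply: run_odd.
- exact: on_run_sub sA.
- move=> x nx sx; rewrite [X in X * _](_ : _ = 0) ?mul0r //.
  rewrite /level_of level_tau_even; last by rewrite oddD oc addbF.
  have b1 : (mu < K)%N by clear -mum mK; lia.
  have b2 : (mu.-1 < mu)%N by clear -mu0; lia.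
  have b3 : (4 * mu + 6 <= c0)%N by clear -mum c0_large; lia.
  have := @tau_run_vanish R e K ce n n0 c0 mu mu.-1 x nx sx b1 b2 b3.
  rewrite /tau_of (_ : c0 + 3 * mu - 3 - 4 * mu.-1 = c0 - mu - 1 + 2)%N //.
  by clear -mu0 b3; lia.
- have [||||x [nx sx hx]] := @tau_run_adjacent R e K ce n n0 c0 mu => //; try lia.
  exists x; split=> //; rewrite /level_of level_tau_even; last by rewrite oddB ?oc ?addbF //; lia.
  by move: hx; rewrite /tau_of (_ : c0 - mu - 3 = c0 - mu - 1 - 2)%N //; lia.
have [|||||x [nx sx hx]] :=
  @tau_run_generic R e K ce n n0 c0 mu mu.+2 (c0 - mu - 1 + 1); try lia.
exists x; split=> //; rewrite /level_of level_tau_odd //.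
by rewrite oddD oc addbT.
Qed.

Local Notation k := (m + 2)%N.
Local Notation base := (10 * k + 15)%N.

Lemma level_of_exit c : (base <= c)%N -> exists x,
  [/\ nz x, on_sites n0 sites x & Lv s k c x != 0].
Proof.
move=> hc; rewrite /level_of.
have [oc|oc] := eqVneq (odd c) (s (+) odd k).
  have [|||||x [nx sx hx]] := @tau_run_generic R e K ce n n0 c0 m k c; try lia.
  by exists x; rewrite level_tau_even.
have oc' : odd c = ~~ (s (+) odd k) by move: oc; case: (odd c); case: (s (+) _).
have [|||||x [nx sx hx]] := @tau_run_generic R e K ce n n0 c0 m k.+1 c; try lia.
by exists x; rewrite level_tau_odd.
Qed.


(** Nonvanishing of this product is the open condition on the points at which the
    singularity is left; the labels cover one period for every coordinate and
    the neighbourhoods of the labels of [S]. *)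
Definition exit_product x : R :=
  \prod_(c <- iota base (c0 + 3 * m + N * base + N + 100)) Lv s k c x.

Lemma lau_exit_product : lau exit_product.
Proof. by apply: lau_prod => c; apply: lau_level_of. Qed.

Lemma exit_product_generic : exists x,
  [/\ nz x, on_sites n0 sites x & exit_product x != 0].
Proof.
apply: (on_sites_prod (@run_period n c0 m) (@run_odd n c0 m)).
  by move=> c; apply: lau_level_of.
by move=> c; rewrite mem_iota => /andP[hc _]; apply: level_of_exit.
Qed.

Lemma exit_productP x c : exit_product x != 0 ->
  (base <= c)%N -> (c <= c0 + 3 * m + N * base + N + 50)%N -> Lv s k c x != 0.
Proof.
rewrite prodf_seq_neq0 => /allP h h1 h2; apply: (implyP (h c _)) => //.
by rewrite mem_iota h1 /=; move: h2; clear; lia.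
Qed.


Lemma exit_labels (i : 'I_N) : exists c, [/\ (base + 5 <= c)%N,
  (c <= c0 + 3 * m + N * base + N + 20)%N & forall x, ext x c = x i].
Proof.
exists (i.+1 + base * N)%N; split; last by move=> x; rewrite ext_periodX extS.
  apply: leq_trans (leq_addl _ _); apply: (@leq_trans (base * 2)); first by clear; lia.
  by rewrite leq_mul2l; clear -n0; lia.
case: i => i /= iN; rewrite [(base * N)%N]mulnC; move: iN; move: (N * base)%N => z; clear; lia.
Qed.

Lemma exit_regular (A : polygon R) : twisted s n A ->
  exit_product (coords s A) != 0 -> Tk_nonsingular s n k A.
Proof.
move=> tA GA; have nA := coords_neq0 tA.
have kK : (k < K)%N by lia.
have [C CP] : exists C : 'I_N -> nat, forall i, [/\ (base + 5 <= C i)%N,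
  (C i <= c0 + 3 * m + N * base + N + 20)%N & forall x, ext x (C i) = x i].
  by have [C CP] := choice exit_labels; exists C.
pose num i x := Lv s k (C i + 2) x * Lv s k (C i - 3) x.
pose den i x := Lv s k (C i - 2) x * Lv s k (C i + 1) x.
have lnum i : lau (num i) by apply: lauM; apply: lau_level_of.
have lden i : lau (den i) by apply: lauM; apply: lau_level_of.
have Ln i c : (C i - 3 <= c)%N -> (c <= C i + 2)%N -> Lv s k c (coords s A) != 0.
  have [h1 h2 _] := CP i; move=> h3 h4; apply: exit_productP => //.
    by move: h1 h3; clear; lia.
  by move: h2 h4; move: (N * base)%N; clear; lia.
have num0 i : num i (coords s A) != 0.
  by rewrite mulf_neq0 // (Ln i) // -?addnBA ?leq_subr ?leq_addr //; lia.
have den0 i : den i (coords s A) != 0.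
  by rewrite mulf_neq0 // (Ln i) //; lia.
have [|B tB EB] := @coords_surjective R n n0 (s (+) odd k)
  (fun i => num i (coords s A) / den i (coords s A)).
  by move=> i; rewrite mulf_neq0 ?invr_eq0.
exists B; split=> //.
have [p1 hp1] := choice (fun i => lau_fraction (lnum i)).
have [d1 hd1] := choice hp1.
have [p2 hp2] := choice (fun i => lau_fraction (lden i)).
have [d2 hd2] := choice hp2.
have mult i x : nz x -> (p2 i * d1 i).@[x] != 0 -> 
    num i x / den i x = (p1 i * d2 i).@[x] / (p2 i * d1 i).@[x].
  move=> nx; have [n1 ->] := hd1 i x nx; have [n2 ->] := hd2 i x nx.
  rewrite !mevalM mulf_eq0 negb_or => /andP[n3 _].
  by field; rewrite n1 n2 n3.
have pd i : (p2 i * d1 i).@[coords s A] != 0.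
  rewrite mevalM mulf_neq0 //; last by have [] := hd1 i _ nA.
  have := den0 i; have [n2 ->] := hd2 i _ nA.
  by rewrite mulf_eq0 negb_or => /andP[].
exists (fun i => p1 i * d2 i), (fun i => p2 i * d1 i); split=> // [i|A' dA' hA' i].
  by rewrite EB mult.
have tA' := dA' 0%N isT; rewrite addbF in tA'.
rewrite -mult //; last exact: coords_neq0.
have [h1 h2 h3] := CP i.
have tk := dA' k (leqnn k).
have hc : (10 * k + 10 <= C i)%N by move: h1; clear; lia.
have [L1 L2 L3] := @coordinate_formula R e K ce n n0 s k A' (C i) kK dA' hc.
rewrite -h3 (ext_coords n0 tk).
rewrite /num /den /level_of (ext_coords n0 tA') -L3 mulfK // mulf_neq0 //.
Qed.

(** At the labels [c] of [S] the recurrence loses its left-hand side, since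
    [tau (m + 1) c = 0]. *)
Lemma exit_value (A B : polygon R) j : twisted s n A ->
  on_sites n0 sites (coords s A) -> exit_product (coords s A) != 0 ->
  Tk_value s n k A B -> (j < m)%N ->
  let c := (c0 + 3 * m - 3 - 4 * j)%N in
  labelled (s (+) odd k) B c * labelled (s (+) odd k) B c.+1 = 1.
Proof.
move=> tA sA GA vB jm c; have nA := coords_neq0 tA.
have kK : (k < K)%N by lia.
have kN : (6 * k.+1 <= N + 10)%N by lia.
have cb : (base + 5 <= c)%N by rewrite /c; lia.
have cc : (c <= c0 + 3 * m)%N by rewrite /c; lia.
have oc : odd c = ~~ (s (+) odd k) by rewrite /c; lia.
have value c' : (c <= c' <= c + 1)%N -> labelled (s (+) odd k) B c' =
    Lv s k (c' + 2) (coords s A) * Lv s k (c' - 3) (coords s A) /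
   (Lv s k (c' - 2) (coords s A) * Lv s k (c' + 1) (coords s A)).
  move=> hc'; have [|f [g [_ fg gA ->]]] := value_identity (c := c') kK kN _ tA vB.
    by move: cb hc'; clear; lia.
  have Ln i : (c' - 3 <= i)%N -> (i <= c' + 2)%N -> Lv s k i (coords s A) != 0.
    move=> h3 h4; apply: exit_productP => //.
      by move: cb hc' h3; clear; lia.
    by move: cc hc' h4; move: (N * base)%N; clear; lia.
  have n1 : Lv s k (c' - 2) (coords s A) != 0 by apply: Ln; clear; lia.
  have n2 : Lv s k (c' + 1) (coords s A) != 0 by apply: Ln; clear; lia.
  apply: (mulIf gA); rewrite divfK //; apply: (mulIf (mulf_neq0 n1 n2)).
  by rewrite fg // [RHS]mulrAC divfK // mulf_neq0.
have c1 : (c <= c + 1 <= c + 1)%N by rewrite leq_addr leqnn.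
rewrite -(addn1 c) (value _ c1) value ?leqnn ?leq_addr //.
have Ln i : (c - 3 <= i)%N -> (i <= c + 3)%N -> Lv s k i (coords s A) != 0.
  move=> h3 h4; apply: exit_productP => //.
    by move: cb h3; clear; lia.
  by move: cc h4; move: (N * base)%N; clear; lia.
have n1 : Lv s k (c + 1) (coords s A) != 0 by apply: Ln; clear -cb; lia.
have n1' : Lv s k (c - 1) (coords s A) != 0 by apply: Ln; clear -cb; lia.
have n2 : Lv s k (c + 2) (coords s A) != 0 by apply: Ln; clear -cb; lia.
have n2' : Lv s k (c - 2) (coords s A) != 0 by apply: Ln; clear -cb; lia.
have c4 : (4 <= c)%N by clear -cb; lia.
have Ek : (m + 1).+1 = k by rewrite -addnS.
have E' : Lv s k (c - 3) (coords s A) * Lv s k (c + 3) (coords s A) =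
   Lv s k (c - 1) (coords s A) * Lv s k (c + 1) (coords s A).
  have T0 y : potential (ext (coords s A)) y != 0 by apply: potential_neq0 => z; apply: nA.
  have b1 : ((m + 1).+2 <= K)%N by clear -mK; lia.
  have b2 : (3 * (m + 1) + 6 <= c)%N by clear -cb; lia.
  have b3 : (m < K)%N by clear -mK; lia.
  have b4 : (4 * m + 6 <= c0)%N by clear -c0_large; lia.
  have := @tau_rec R e K ce _ T0 (m + 1) c b1 b2.
  have := @tau_run_vanish R e K ce n n0 c0 m j (coords s A) nA sA b3 jm b4.
  rewrite -/c /tau_of -(addn1 m) => ->; rewrite mulr0 Ek => /esym/eqP.
  rewrite subr_eq0 => /eqP E.
  have [oc1 oc1' _ _ oc3'] := label_parity oc c4.
  have oc3 : odd (c + 3) = ~~ ~~ (s (+) odd k) by rewrite oddD oc addbT.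
  by rewrite negbK in oc1 oc1' oc3' oc3; rewrite /level_of !level_tau_even.
rewrite !(above1 c4).
rewrite -(divff (mulf_neq0 n1' n1)) -{1}E'.
by field; rewrite n1 n1' n2 n2'.
Qed.

Lemma run_confined : generically s n
  [set A : polygon R | twisted s n A /\ on_sites n0 sites (coords s A)]
  (fun A => Tk_nonsingular s n k A /\
    forall B, Tk_value s n k A B -> forall j, (j < m)%N ->
      let c := (c0 + 3 * m - 3 - 4 * j)%N in
      labelled (s (+) odd k) B c * labelled (s (+) odd k) B c.+1 = 1).
Proof.
have [p [d hpd]] := lau_fraction lau_exit_product.
have pE x : nz x -> (p.@[x] != 0) = (exit_product x != 0).
  by move=> nx; have [n1 ->] := hpd x nx; rewrite mulf_eq0 invr_eq0 (negPf n1) orbF.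
pose U := [set A : polygon R | [set A : polygon R | twisted s n A /\ on_sites n0 sites (coords s A)] A /\
  exists2 f, [set p] f & f.@[coords s A] != 0]%classic.
exists U; split.
- by exists [set p]%classic.
- move=> V [F ->] [A0 [[tA0 sA0] [h Fh hA0]]].
  have [||x [nx sx hx Gx]] := @on_sites_dense R n n0 sites s (@run_period n c0 m)
    (@run_odd n c0 m) _ _ (lau_meval h) lau_exit_product.
  + by exists (coords s A0); split=> //; apply: coords_neq0.
  + exact: exit_product_generic.
  have [A tA EA] := coords_surjective n0 s nx.
  exists A; split; (split; first by split; rewrite ?EA).
    by exists p; rewrite // EA pE.
  by exists h; rewrite // EA.
move=> A [[tA sA] [_ ->]]; rewrite pE; last exact: coords_neq0.
move=> GA; split; first exact: exit_regular.
by move=> B vB j jm; apply: (exit_value tA sA GA vB jm).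
Qed.
End Values.

Section Translation.
Variable R : realType.
Variables (n : nat).
Hypothesis n0 : (0 < n)%N.
Variables (c0 m : nat) (a q : int).
Hypothesis c0E : c0%:Z = a + (2 * n)%:Z * q.
Local Notation N := (2 * n)%N.

Lemma labelled_translate s (A : polygon R) y b r : twisted s n A ->
  y%:Z = b + N%:Z * r -> labelled s A y = xcoord s A b.
Proof. by move=> tA E; rewrite /labelled E (periodicZ (fun j => xcoord_periodic j tA)). Qed.

Lemma yparam_even s (A : polygon R) b : parity b = s ->
  yparam s A b = -1 <-> xcoord s A b * xcoord s A (b + 1) = 1.
Proof.
move=> pb; rewrite /yparam pb eqxx; split=> [/oppr_inj/(congr1 GRing.inv)|->].
  by rewrite invrK invr1.
by rewrite invr1.
Qed.

Lemma parity_c0 : parity a = odd c0.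
Proof.
have := congr1 parity c0E; rewrite parity_nat parityD PoszM -mulrA parityM2.
by rewrite addbF.
Qed.

(** Here [a] is the first element of [S'] and [c0] a large label congruent to it. *)
Lemma XS_run (A : polygon R) : (0 < m)%N ->
  XS n (arith a (a + 2 * (m%:Z - 1)) 2) A <->
  twisted (odd c0) n A /\ on_sites n0 (run n c0 m) (coords (odd c0) A).
Proof.
move=> m0; split=> [XA|[tA sA] c [t [-> ht]]].
  have X t : (t < m)%N -> twisted (odd c0) n A /\
      xcoord (odd c0) A (a + 2 * t%:Z) * xcoord (odd c0) A (a + 2 * t%:Z + 1) = 1.
    move=> tm; have /XA [] : arith a (a + 2 * (m%:Z - 1)) 2 (a + 2 * t%:Z).
      by exists t; split=> //; lia.
    have pc : parity (a + 2 * t%:Z) = odd c0 by rewrite parityD parityM2 addbF parity_c0.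
    by rewrite pc => tA /(yparam_even A pc).
  have [tA _] := X 0%N m0; split=> // y /existsP[[t tm] /= /eqP E].
  rewrite -addn1 (ext_mod n0 _ E) (ext_mod n0 _ (y := (y + 1)%N) (y' := (c0 + t.*2 + 1)%N)); last first.
    by apply/eqP; rewrite eqn_modDr; apply/eqP.
  rewrite ext_coords // (labelled_translate tA (b := a + 2 * t%:Z) (r := q)); last first.
    by rewrite PoszD c0E -muln2 PoszM; ring.
  rewrite (labelled_translate tA (b := a + 2 * t%:Z + 1) (r := q)); last first.
    by rewrite !PoszD c0E -muln2 PoszM; ring.
  by have [] := X t tm.
have pc : parity (a + 2 * t%:Z) = odd c0 by rewrite parityD parityM2 addbF parity_c0.
split; rewrite pc //; apply/(yparam_even A pc).
have tm : (t < m)%N by move: ht; clear; lia.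
have := sA _ (run_intro n c0 tm); rewrite ext_coords // -addn1.
rewrite (labelled_translate tA (b := a + 2 * t%:Z) (r := q)); last first.
  by rewrite PoszD c0E -muln2 PoszM; ring.
rewrite (labelled_translate tA (b := a + 2 * t%:Z + 1) (r := q)) //.
by rewrite !PoszD c0E -muln2 PoszM; ring.
Qed.

(** The labels [c0 + 3 m - 3 - 4 j] with [j < m] are those of [S]. *)
Lemma YS_run (B : polygon R) : (0 < m)%N -> (m + 10 <= c0)%N -> odd c0 = ~~ odd m ->
  twisted true n B ->
  (forall j, (j < m)%N -> let c := (c0 + 3 * m - 3 - 4 * j)%N in
     labelled true B c * labelled true B c.+1 = 1) ->
  YS n (arith (a - m%:Z + 1) (a + 3 * m%:Z - 3) 4) B.
Proof.
move=> m0 hc oc tB hB c [t [cE ht]].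
have tm : (t < m)%N by move: cE ht; clear; lia.
have pc : parity c = false.
  rewrite cE; have -> : a - m%:Z + 1 + 4 * t%:Z = a + - m%:Z + 1 + 2 * (2 * t%:Z) by ring.
  by rewrite !parityD parityM2 parity_c0 oc parityN parity_nat; case: (odd m).
split; rewrite pc // /yparam pc /=.
have /= := hB (m - 1 - t)%N; set c' := (c0 + 3 * m - 3 - 4 * (m - 1 - t))%N.
have c'E : c'%:Z = c + N%:Z * q.
  have -> : c'%:Z = c0%:Z - m%:Z + 1 + 4 * t%:Z by rewrite /c'; move: hc tm m0; clear; lia.
  by rewrite cE c0E; ring.
rewrite (labelled_translate tB c'E) (labelled_translate tB (b := c + 1) (r := q)).
  by move=> -> //; move: m0; clear; lia.
by rewrite intS c'E; ring.
Qed.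
End Translation.

Theorem theorem4p5 (R : realType) (n : nat) (i m : int)
  (hn : (1 <= n)%N) (hm1 : 1 <= m)
  (hmn : m%:~R < n%:R / 3%:R - 1 :> rat) :
  let S := arith (2 * (i - (m - 1))) (2 * (i + (m - 1))) 4 in
  let S' := arith (2 * i - (m - 1)) (2 * i + (m - 1)) 2 in
  (* X_{S'} lies in P_n for m odd and in P_n^* for m even *)
  let s := ~~ parity m in
  (forall k : nat, (1 <= k)%N -> k%:Z <= m + 1 ->
     forall A : polygon R, XS n S' A -> ~ Tk_nonsingular s n k A) /\
  generically s n (XS n S') (fun A : polygon R =>
     Tk_nonsingular s n (absz (m + 2)) A /\
     forall B : polygon R, Tk_value s n (absz (m + 2)) A B -> YS n S B).
Proof.
case: m hm1 hmn => // m hm1 hmn S S' s.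
have mn : (3 * m + 4 <= n)%N.
  have : (3 * m%:Z + 3)%:~R < (n%:Z)%:~R :> rat.
    rewrite intrD intrM; move: hmn; rewrite -[n%:~R]/(n%:R); move: (m%:~R) (n%:R) => u v.
    by lra.
  by rewrite ltr_int; clear; lia.
clear hmn; have m0 : (0 < m)%N by move: hm1; clear; lia.
set a : int := 2 * i - (m%:Z - 1).
(* a label of the first site, large enough for the windows of all values of tau *)
have [c0 [q [h1 _ c0E]]] := @label_of (2 * n) a (100 * m + 100) ltac:(lia).
have oc : odd c0 = s.
  rewrite -(parity_c0 c0E) /s /a !parityD parityN parityD parityM2 parityN.
  by rewrite parity_nat /= addbT.
have [e ce] := condensation_laurent R (m + 3).
have XE : XS n S' = [set A : polygon R | twisted s n A /\
    on_sites hn (run n c0 m) (coords s A)]%classic.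
  have -> : S' = arith a (a + 2 * (m%:Z - 1)) 2 by congr (arith _ _ _); rewrite /a; ring.
  by apply/funext => A; apply/propext; rewrite (XS_run hn c0E A m0) oc.
rewrite XE; split.
  move=> k k1 km A [tA sA]; rewrite -oc in tA sA *.
  apply: (run_singular ce) (tA) (sA) => //; first by rewrite k1; move: km; clear; lia.
have -> : absz (m%:Z + 2) = (m + 2)%N by [].
have := run_confined ce hn m0 mn (leqnn _) h1; rewrite oc.
move=> [U [oU dU hU]]; exists U; split=> // A UA; have [nsA vA] := hU A UA.
split=> // B vB.
have sk : s (+) odd (m + 2) = true by rewrite /s parity_nat oddD addbF; case: (odd m).
have tB : twisted true n B by case: vB; rewrite sk.
have -> : S = arith (a - m%:Z + 1) (a + 3 * m%:Z - 3) 4.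
  by congr (arith _ _ _); rewrite /a; ring.
apply: (YS_run c0E) => //; first by move: h1; clear; lia.
by move=> j jm; have := vA B vB j jm; rewrite sk.
Qed.
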